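(* The verification of safety properties under the release-acquire semantics for parameterized systems of the class $\mathsf{env}(\mathsf{nocas},\mathsf{acyc})\parallel\mathsf{dis}(\mathsf{nocas})$ is $\mathsf{NEXPTIME}$-hard.
   Context: Programs. Fix finite sets $\mathrm{Reg}$ (registers), $\mathrm{Var}$ (shared variables) and a finite data domain $\mathrm{Dom}$. Commands: $c ::= \mathsf{skip} \mid \mathsf{assume}(e(\bar r)) \mid \mathsf{assert}(\mathsf{false}) \mid r := e(\bar r) \mid c;c \mid c \oplus c \mid c^* \mid r := x \mid x := r \mid \mathsf{cas}(x,r_1,r_2)$. A program is $\mathsf{acyc}$ if it contains no $^*$ and $\mathsf{nocas}$ if it contains no $\mathsf{cas}$. RA semantics. Views are maps $vw:\mathrm{Var}\to\mathbb N$; messages are $(x,d,vw)$; a memory is a set of messages; a configuration is a memory together with a local configuration (command, register valuation, view) for each thread identifier in $\mathbb N$. Messages $(x_1,d_1,vw_1),(x_2,d_2,vw_2)$ are non-conflicting if $x_1\neq x_2$ or $vw_1(x_1)\neq vw_2(x_2)$ or $vw_1(x_1)=vw_2(x_2)=0$. A step is made by one thread with view $vw$: standard control-flow/register steps ($\mathsf{assume}(e)$ passes only if $e\ne0$; $\mathsf{assert}(\mathsf{false})$ leads to an error); load $r:=x$ picks $(x,d,vw')$ in memory with $vw(x)\le vw'(x)$, sets $r:=d$ and view to $vw\sqcup vw'$ (pointwise max); store $x:=r$ picks $vw'$ equal to $vw$ except $vw'(x)>vw(x)$ and adds $(x,rv(r),vw')$ if non-conflicting with every message in memory, view $:=vw'$;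 $\mathsf{cas}$ is an atomic load followed by a store with $x$-timestamps $ts$ and $ts+1$. Initially the memory is $\{(x,d_{\mathrm{init}},\mathbf 0)\}_{x\in\mathrm{Var}}$, all threads have zero registers and zero view. The class $\mathsf{env}(\mathsf{nocas},\mathsf{acyc})\parallel\mathsf{dis}(\mathsf{nocas})$: systems given by a loop-free, CAS-free program $c_{\mathsf{env}}$ and a CAS-free program $c_{\mathsf{dis}}$ (loops allowed); one distinguished thread executes $c_{\mathsf{dis}}$ and all other (infinitely many) threads execute $c_{\mathsf{env}}$. Safety verification: given such a system, decide whether some finite computation from the initial configuration leads to some thread executing $\mathsf{assert}(\mathsf{false})$. *)

(* Defs.v *)
From HB Require Import structures.
From mathcomp Require Import all_boot.
From mathcomp Require Import finmap.

Set Implicit Arguments.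
Unset Strict Implicit.
Unset Printing Implicit Defensive.

(** * Turing machines, NEXPTIME and polynomial-time reductions *)

Definition word := seq bool.
Definition language := word -> Prop.

Inductive move := MoveLeft | Stay | MoveRight.

Definition move_code (m : move) : option bool :=
  match m with
  | MoveLeft => Some false | Stay => None | MoveRight => Some true
  end.
Definition move_decode (o : option bool) : move :=
  match o with
  | Some false => MoveLeft | None => Stay | Some true => MoveRight
  end.
Lemma move_codeK : cancel move_code move_decode. Proof. by case. Qed.
HB.instance Definition _ := Finite.copy move (can_type move_codeK).

(* [None] is the blank, [Some (inl b)] an input/output bit, [Some (inr s)] an
   auxiliary tape symbol. *)
Definition cell (S : finType) : finType := option (bool + S).

(* Nondeterministic machine with [k.+1] two-way infinite tapes.  [trans q a] is
   the set of available actions in state [q] when the scanned cells are [a]: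
   a new state and, for each tape, a cell to write and a head move. *)
Record tm (k : nat) := TM {
  state : finType;
  sym : finType;
  start : state;
  accepting : {set state};
  trans : state -> {ffun 'I_k.+1 -> cell sym} ->
          {set state * {ffun 'I_k.+1 -> cell sym * move}}
}.

(* [(l, r)]: [r] is the content from the scanned cell rightwards, [l] the
   content to the left of the head, nearest cell first; all further cells are
   blank. *)
Definition tape (S : finType) := (seq (cell S) * seq (cell S))%type.

Definition read_tape S (t : tape S) : cell S := head None t.2.

Definition act_tape S (t : tape S) (a : cell S * move) : tape S :=
  let r := a.1 :: behead t.2 in
  match a.2 with
  | MoveLeft => (behead t.1, head None t.1 :: r)
  | Stay => (t.1, r)
  | MoveRight => (a.1 :: t.1, behead t.2)
  end.

Section Runs.
Context (k : nat) (M : tm k).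

Record tmconf := TMConf {
  cstate : state M;
  ctapes : {ffun 'I_k.+1 -> tape (sym M)}
}.

Definition actions (c : tmconf) :=
  trans (cstate c) [ffun i => read_tape (ctapes c i)].

Definition act (c : tmconf)
    (a : state M * {ffun 'I_k.+1 -> cell (sym M) * move}) : tmconf :=
  TMConf a.1 [ffun i => act_tape (ctapes c i) (a.2 i)].

Inductive run : nat -> tmconf -> tmconf -> Prop :=
| run0 c : run 0 c c
| runS n c a c' : a \in actions c -> run n (act c a) c' -> run n.+1 c c'.

Definition halted (c : tmconf) : bool := actions c == set0.

(* The input is on the first tape, with the head on its first symbol. *)
Definition input_tape (w : word) : tape (sym M) :=
  ([::], [seq Some (inl b) | b <- w]).

Definition init_conf (w : word) : tmconf :=
  TMConf (start M) [ffun i => if i == ord0 then input_tape w else ([::], [::])].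

(* The output is the maximal word of bits that starts at the head of the last
   tape. *)
Fixpoint bits_prefix (s : seq (cell (sym M))) : word :=
  if s is Some (inl b) :: s' then b :: bits_prefix s' else [::].

Definition output (c : tmconf) : word := bits_prefix (ctapes c ord_max).2.

Definition deterministic : Prop := forall q a, #|trans (t := M) q a| <= 1.

End Runs.

(* Every polynomial with natural coefficients is bounded by one of these. *)
Definition poly_bound (c n : nat) : nat := n ^ c + c.

(* The union over polynomials p of NTIME(2^p(n)), where nondeterministic time
   bounds the length of every computation of a one-tape machine. *)
Definition NEXPTIME (L : language) : Prop :=
  exists (M : tm 0) (c : nat),
    (forall w n cf,
       run n (init_conf M w) cf -> n <= 2 ^ poly_bound c (size w)) /\
    (forall w, L w <->
       exists n cf, [/\ run n (init_conf M w) cf, halted cf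
                      & cstate cf \in accepting M]).

Definition polytime_computable (f : word -> word) : Prop :=
  exists (k : nat) (M : tm k) (c : nat),
    deterministic M /\
    forall w, exists n cf,
      [/\ n <= poly_bound c (size w), run n (init_conf M w) cf, halted cf
        & output cf = f w].

Definition polytime_reducible (L L' : language) : Prop :=
  exists f, polytime_computable f /\ forall w, L w <-> L' (f w).

Definition NEXPTIME_hard (L' : language) : Prop :=
  forall L, NEXPTIME L -> polytime_reducible L L'.

(** * Programs *)

(* Registers are ['I_R], shared variables ['I_V] and the data domain is
   ['I_D.+1], whose zero is [ord0]. *)
Section Programs.
Context (R V D : nat).

Definition data := 'I_D.+1.
Definition regval := {ffun 'I_R -> data}.

(* [ECond e1 e2 e3 e4] is "if e1 = e2 then e3 else e4"; every function
   Dom^n -> Dom of registers is denoted by an expression. *)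
Inductive expr :=
| EConst of data
| EReg of 'I_R
| ECond of expr & expr & expr & expr.

Fixpoint eval (rv : regval) (e : expr) : data :=
  match e with
  | EConst d => d
  | EReg r => rv r
  | ECond e1 e2 e3 e4 =>
      if eval rv e1 == eval rv e2 then eval rv e3 else eval rv e4
  end.

Inductive cmd :=
| Skip
| Assume of expr
| AssertFalse
| Assign of 'I_R & expr
| Seq of cmd & cmd
| Choice of cmd & cmd
| Star of cmd
| LoadVar of 'I_R & 'I_V   (* r := x *)
| StoreVar of 'I_V & 'I_R   (* x := r *)
| Cas of 'I_V & 'I_R & 'I_R.

Fixpoint acyc (c : cmd) : bool :=
  match c with
  | Star _ => false
  | Seq c1 c2 | Choice c1 c2 => acyc c1 && acyc c2
  | _ => true
  end.

Fixpoint nocas (c : cmd) : bool :=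
  match c with
  | Cas _ _ _ => false
  | Seq c1 c2 | Choice c1 c2 => nocas c1 && nocas c2
  | Star c1 => nocas c1
  | _ => true
  end.

(** * Release-acquire semantics *)

Definition view := {ffun 'I_V -> nat}.
Definition message := ('I_V * data * view)%type.
Definition memory := {fset message}.

Definition mvar (m : message) : 'I_V := m.1.1.
Definition mview (m : message) : view := m.2.

Definition join (v w : view) : view := [ffun x => maxn (v x) (w x)].

Definition upd (A : finType) (B : Type) (f : {ffun A -> B}) (a : A) (b : B)
  : {ffun A -> B} := [ffun y => if y == a then b else f y].

Definition nonconflicting (m1 m2 : message) : Prop :=
  [\/ mvar m1 <> mvar m2,
      mview m1 (mvar m1) <> mview m2 (mvar m2)
    | mview m1 (mvar m1) = 0 /\ mview m2 (mvar m2) = 0].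

Record lconf := LConf { lcmd : cmd; lreg : regval; lview : view }.

(* One step of a single thread, together with its effect on the memory. *)
Inductive lstep : memory -> lconf -> memory -> lconf -> Prop :=
| st_seq M c1 rv vw M' c1' rv' vw' c2 :
    lstep M (LConf c1 rv vw) M' (LConf c1' rv' vw') ->
    lstep M (LConf (Seq c1 c2) rv vw) M' (LConf (Seq c1' c2) rv' vw')
| st_seq_skip M c2 rv vw :
    lstep M (LConf (Seq Skip c2) rv vw) M (LConf c2 rv vw)
| st_choice_l M c1 c2 rv vw :
    lstep M (LConf (Choice c1 c2) rv vw) M (LConf c1 rv vw)
| st_choice_r M c1 c2 rv vw :
    lstep M (LConf (Choice c1 c2) rv vw) M (LConf c2 rv vw)
| st_star_exit M c rv vw :
    lstep M (LConf (Star c) rv vw) M (LConf Skip rv vw)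
| st_star_iter M c rv vw :
    lstep M (LConf (Star c) rv vw) M (LConf (Seq c (Star c)) rv vw)
| st_assume M e rv vw :
    eval rv e != ord0 ->
    lstep M (LConf (Assume e) rv vw) M (LConf Skip rv vw)
| st_assign M r e rv vw :
    lstep M (LConf (Assign r e) rv vw) M (LConf Skip (upd rv r (eval rv e)) vw)
| st_load (M : memory) r x d (vw' : view) (rv : regval) (vw : view) :
    (x, d, vw') \in M -> vw x <= vw' x ->
    lstep M (LConf (LoadVar r x) rv vw)
          M (LConf Skip (upd rv r d) (join vw vw'))
| st_store (M : memory) x r (vw' : view) (rv : regval) (vw : view) :
    vw x < vw' x -> (forall y, y != x -> vw' y = vw y) ->
    (forall m, m \in M -> nonconflicting (x, rv r, vw') m) ->
    lstep M (LConf (StoreVar x r) rv vw)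
          ((x, rv r, vw') |` M)%fset (LConf Skip rv vw')
| st_cas (M : memory) x r1 r2 (vw1 vw2 : view) (rv : regval) (vw : view) :
    (x, rv r1, vw1) \in M -> vw x <= vw1 x ->
    vw2 = upd (join vw vw1) x (vw1 x).+1 ->
    (forall m, m \in M -> nonconflicting (x, rv r2, vw2) m) ->
    lstep M (LConf (Cas x r1 r2) rv vw)
          ((x, rv r2, vw2) |` M)%fset (LConf Skip rv vw2).

(* The next instruction of the command is assert(false). *)
Inductive asserts_false : cmd -> Prop :=
| af_here : asserts_false AssertFalse
| af_seq c1 c2 : asserts_false c1 -> asserts_false (Seq c1 c2).

Record conf := Conf { cmem : memory; cthreads : nat -> lconf }.

Inductive gstep : conf -> conf -> Prop :=
| gstep_thread t M th M' l' :
    lstep M (th t) M' l' ->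
    gstep (Conf M th) (Conf M' (fun i => if i == t then l' else th i)).

Inductive greach : conf -> conf -> Prop :=
| greach_refl c : greach c c
| greach_step c1 c2 c3 : gstep c1 c2 -> greach c2 c3 -> greach c1 c3.

(* Thread 0 is the distinguished thread. *)
Definition ginit (dinit : data) (cenv cdis : cmd) : conf :=
  Conf [fset (x, dinit, [ffun=> 0]) | x : 'I_V]%fset
       (fun t => LConf (if t == 0 then cdis else cenv)
                       [ffun=> ord0] [ffun=> 0]).

Definition unsafe_from (c : conf) : Prop :=
  exists c' t, greach c c' /\ asserts_false (lcmd (cthreads c' t)).

End Programs.

(** * Safety verification as a decision problem *)

Record system := System {
  nreg : nat;
  nvar : nat;
  ndom : nat;   (* the data domain has [ndom.+1] elements *)
  dinit : data ndom;
  cenv : cmd nreg nvar ndom;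
  cdis : cmd nreg nvar ndom
}.

Definition unsafe (S : system) : Prop :=
  unsafe_from (ginit (dinit S) (cenv S) (cdis S)).

(* env(nocas, acyc) || dis(nocas) *)
Definition env_nocas_acyc_dis_nocas (S : system) : bool :=
  [&& nocas (cenv S), acyc (cenv S) & nocas (cdis S)].

(* Systems are written in prefix notation.  All numbers are in unary, so that
   the code of a system is at least as long as its finite sets are large. *)
Definition enc_nat (n : nat) : word := rcons (nseq n true) false.

Section Encoding.
Context (R V D : nat).

Fixpoint enc_expr (e : expr R D) : word :=
  match e with
  | EConst d => enc_nat 0 ++ enc_nat d
  | EReg r => enc_nat 1 ++ enc_nat r
  | ECond e1 e2 e3 e4 =>
      enc_nat 2 ++ enc_expr e1 ++ enc_expr e2 ++ enc_expr e3 ++ enc_expr e4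
  end.

Fixpoint enc_cmd (c : cmd R V D) : word :=
  match c with
  | Skip => enc_nat 0
  | Assume e => enc_nat 1 ++ enc_expr e
  | AssertFalse => enc_nat 2
  | Assign r e => enc_nat 3 ++ enc_nat r ++ enc_expr e
  | Seq c1 c2 => enc_nat 4 ++ enc_cmd c1 ++ enc_cmd c2
  | Choice c1 c2 => enc_nat 5 ++ enc_cmd c1 ++ enc_cmd c2
  | Star c1 => enc_nat 6 ++ enc_cmd c1
  | LoadVar r x => enc_nat 7 ++ enc_nat r ++ enc_nat x
  | StoreVar x r => enc_nat 8 ++ enc_nat x ++ enc_nat r
  | Cas x r1 r2 => enc_nat 9 ++ enc_nat x ++ enc_nat r1 ++ enc_nat r2
  end.

End Encoding.

Definition enc_system (S : system) : word :=
  enc_nat (nreg S) ++ enc_nat (nvar S) ++ enc_nat (ndom S) ++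
  enc_nat (dinit S) ++ enc_cmd (cenv S) ++ enc_cmd (cdis S).

(* The instances of the class for which assert(false) is reachable. *)
Definition safety_verification (C : pred system) : language :=
  fun w => exists S : system, [/\ C S, enc_system S = w & unsafe S].

(** ** The encoding is unambiguous *)

Lemma enc_nat_inj m n s t :
  enc_nat m ++ s = enc_nat n ++ t -> m = n /\ s = t.
Proof.
rewrite /enc_nat; elim: m n => [|m IH] [|n] //=; first by case.
by case=> /IH [-> ->].
Qed.

Lemma enc_ord_inj n (i j : 'I_n) s t :
  enc_nat i ++ s = enc_nat j ++ t -> i = j /\ s = t.
Proof. by case/enc_nat_inj => /val_inj -> ->. Qed.

Lemma enc_expr_inj R D (e e' : expr R D) s t :
  enc_expr e ++ s = enc_expr e' ++ t -> e = e' /\ s = t.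
Proof.
elim: e e' s t => [d|r|a IHa b IHb c IHc d IHd] [d'|r'|a' b' c' d'] s t;
  cbn [enc_expr]; rewrite -!catA => /enc_nat_inj [] // _.
- by case/enc_ord_inj => -> ->.
- by case/enc_ord_inj => -> ->.
- by case/IHa => -> /IHb [-> /IHc [-> /IHd [-> ->]]].
Qed.

Lemma enc_cmd_inj R V D (c c' : cmd R V D) s t :
  enc_cmd c ++ s = enc_cmd c' ++ t -> c = c' /\ s = t.
Proof.
elim: c c' s t => [|e||r e|a IHa b IHb|a IHa b IHb|a IHa|r x|x r|x r1 r2]
                  [|e'||r' e'|a' b'|a' b'|a'|r' x'|x' r'|x' r1' r2'] s t;
  cbn [enc_cmd]; rewrite -?catA => /enc_nat_inj [] // _.
- by case/enc_expr_inj => -> ->.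
- by case/enc_ord_inj => -> /enc_expr_inj [-> ->].
- by case/IHa => -> /IHb [-> ->].
- by case/IHa => -> /IHb [-> ->].
- by case/IHa => -> ->.
- by case/enc_ord_inj => -> /enc_ord_inj [-> ->].
- by case/enc_ord_inj => -> /enc_ord_inj [-> ->].
- by case/enc_ord_inj => -> /enc_ord_inj [-> /enc_ord_inj [-> ->]].
Qed.

Lemma enc_system_inj : injective enc_system.
Proof.
case=> R V D d ce cd [R' V' D' d' ce' cd']; rewrite /enc_system /=.
case/enc_nat_inj => eR /enc_nat_inj [eV /enc_nat_inj [eD]].
case: _ / eR in ce' cd' *; case: _ / eV in ce' cd' *.
case: _ / eD in d' ce' cd' *.
case/enc_ord_inj => -> /enc_cmd_inj [->].
by rewrite -(cats0 (enc_cmd cd)) -(cats0 (enc_cmd cd')) => /enc_cmd_inj [->].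
Qed.

(* Main.v *)
(* Let [M] run in time 2^q(n) on inputs of length n, and choose m polynomial in n
   such that P = 2^m exceeds the length of all configurations.  Written one after
   the other, P configurations of [M] form a word of length K = P^2, which a finite
   control can check from left to right if, in step i, it is told the letter that
   it wrote in step i - P.  So [M] accepts iff a finite control with a queue of
   length P has an accepting run of K steps ([queue_run]).

   The distinguished thread guesses such a run, one step per iteration of its loop.
   In round r it stores the 2m bits of r, the popped letter y, the pushed letter z,
   and the bits of r once more, each in a variable of its own.  Another thread reads
   these variables in the opposite order and compares the bits with an index v of
   its own.  Its view forces successive reads to be of nondecreasing rounds.  Hence
   the bits read first, from the most significant one down, belong to rounds whose
   last one is at least v, and those read afterwards, from the least significant one
   up, to rounds whose first one is at most v: the letter read in between is that of
   round v ([env_exact]).  In this way a thread compares the letter pushed in round v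
   with the letter popped in round v + P.

   To be sure that all 2^(2m) indices are checked, the results are combined along a
   binary tree of threads.  A thread that guesses bit u of its index as b stores to
   the rail variable of (u, 1 - b), and all later messages derived from its result
   carry this timestamp in their view.  An inner thread at level j reads a result
   with value 0 and one with value 1 of level j + 1 and then the initial message of
   the rail of (j, b); this is possible only if no index below it has bit j different
   from b.  The distinguished thread finally reads both results of level 0. *)

From HB Require Import structures.
From mathcomp Require Import all_boot.
From mathcomp Require Import finmap.
From mathcomp Require Import zify.
From Stdlib Require Import FunctionalExtensionality.
Require Import Defs.

Set Implicit Arguments.
Unset Strict Implicit.
Unset Printing Implicit Defensive.

(** * Demonic and angelic preconditions *)

(** The two directions need different tools, because the number of threads is unbounded. Soundness
    is a rely-guarantee argument whose ghost state is only the log of the stores of the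
    distinguished thread. The other threads leave no trace in it: what their messages vouch for is a
    fact about the log that stays true while the log grows, so one invariant on messages covers any
    number of them in any interleaving. Completeness needs just one schedule: the distinguished
    thread finishes all its rounds, and then one fresh thread per tree node runs alone, children
    before parents. The finite control cannot count to P, and yet the rows need no separator letter:
    the carry out of the lower half of the round counter tells the control where a row begins. For
    polynomial time a concrete machine is required. The code of the system is a text produced by
    loops over unary counters, and a small compiler turns such loops into a deterministic machine
    with ten tapes, together with a bound on its running time. *)

Section Wp.
Context (R V D : nat) (World : Type) (ext : World -> World -> Prop).
Context (minv : World -> message V D -> Prop) (goal : Prop).
Hypothesis ext_refl : forall W, ext W W.
Hypothesis ext_trans : forall W1 W2 W3, ext W1 W2 -> ext W2 W3 -> ext W1 W3.
Hypothesis minv_ext : forall W W' m, ext W W' -> minv W m -> minv W' m.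

Local Notation asrt := (World -> regval R D -> view V -> Prop).

Definition stable (rely : World -> World -> Prop) (Q : asrt) :=
  forall W W' rv vw, rely W W' -> Q W rv vw -> Q W' rv vw.

(* A thread loads only messages that satisfy the invariant [minv] of the current
   world, and moves to a world where [minv] holds of the message that it stores.
   [goal] is what has to be derived from a failing assertion. *)
Fixpoint wp (rely guar : World -> World -> Prop) (c : cmd R V D) (Q : asrt) : asrt :=
  fun W rv vw =>
  match c with
  | Skip => Q W rv vw
  | Assume e => eval rv e != ord0 -> Q W rv vw
  | AssertFalse => goal
  | Assign r e => Q W (upd rv r (eval rv e)) vw
  | Seq c1 c2 => wp rely guar c1 (wp rely guar c2 Q) W rv vw
  | Choice c1 c2 => wp rely guar c1 Q W rv vw /\ wp rely guar c2 Q W rv vw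
  | Star c1 => exists J : asrt,
      [/\ stable rely J, J W rv vw,
          forall W rv vw, J W rv vw -> wp rely guar c1 J W rv vw
        & forall W rv vw, J W rv vw -> Q W rv vw]
  | LoadVar r x => forall W' d vw', rely W W' -> minv W' (x, d, vw') ->
      vw x <= vw' x -> Q W' (upd rv r d) (join vw vw')
  | StoreVar x r => forall W' (vw' : view V), rely W W' -> vw x < vw' x ->
      (forall y, y != x -> vw' y = vw y) ->
      exists W'', [/\ guar W' W'', minv W'' (x, rv r, vw') & Q W'' rv vw']
  | Cas _ _ _ => False
  end.

Section Rules.
Context (rely guar : World -> World -> Prop).
Hypothesis rely_refl : forall W, rely W W.
Hypothesis rely_trans : forall W1 W2 W3, rely W1 W2 -> rely W2 W3 -> rely W1 W3.
Hypothesis guar_refl : forall W, guar W W.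
Hypothesis guar_ext : forall W W', guar W W' -> ext W W'.

Local Notation wp := (wp rely guar).

Lemma wp_mono c (Q Q' : asrt) W rv vw :
  (forall W rv vw, Q W rv vw -> Q' W rv vw) -> wp c Q W rv vw -> wp c Q' W rv vw.
Proof.
elim: c Q Q' W rv vw => [|e||r e|c1 IH1 c2 IH2|c1 IH1 c2 IH2|c1 IH1|r x|x r|x r1 r2] Q Q' W rv vw HQ //=.
- exact: HQ.
- by move=> H He; apply/HQ/H.
- exact: HQ.
- by apply: IH1 => *; apply: IH2; eauto.
- by case=> H1 H2; split; [apply: IH1 H1 | apply: IH2 H2].
- by case=> J [sJ HJ Hb Hx]; exists J; split=> // *; apply/HQ/Hx.
- by move=> H W' d vw' HW Hm Hv; apply/HQ/H.
- move=> H W' vw' HW Hv Hy; have [W'' [H1 H2 H3]] := H W' vw' HW Hv Hy.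
  by exists W''; split=> //; apply: HQ.
Qed.

(** Loads and stores quantify over all worlds that [rely] leads to, and a loop brings a stable
    invariant, so only the postcondition can be sensitive to a change of the world. *)
Lemma wp_stable c Q : stable rely Q -> stable rely (wp c Q).
Proof.
elim: c Q => [|e||r e|c1 IH1 c2 IH2|c1 IH1 c2 IH2|c1 IH1|r x|x r|x r1 r2] Q sQ W W' rv vw HW /=.
- exact: sQ.
- by move=> H He; apply: sQ HW _; apply: H.
- by [].
- exact: sQ.
- by apply: IH1 HW; apply: IH2.
- by case=> H1 H2; split; [apply: IH1 HW H1 | apply: IH2 HW H2].
- by case=> J [sJ HJ Hb Hx]; exists J; split=> //; apply: sJ HW HJ.
- move=> H W2 d vw' HW2; apply: H; exact: rely_trans HW HW2.
- move=> H W2 vw' HW2; apply: H; exact: rely_trans HW HW2.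
- by [].
Qed.

(** Subject reduction. An iteration of a loop keeps the same [J], and a store preserves the
    invariant of the older messages because [guar] refines [ext]. *)
Lemma lstep_wp M l M' l' Q W :
  stable rely Q -> lstep M l M' l' ->
  (forall m, m \in M -> minv W m) ->
  wp (lcmd l) Q W (lreg l) (lview l) ->
  exists W', [/\ guar W W', forall m, m \in M' -> minv W' m
               & wp (lcmd l') Q W' (lreg l') (lview l')].
Proof.
move=> sQ st; elim: st Q W sQ => /= {M l M' l'}.
- move=> M c1 rv vw M' c1' rv' vw' c2 _ IH Q W sQ HM H.
  by apply: (IH (wp c2 Q)) => //; apply: wp_stable.
- by move=> M c2 rv vw Q W sQ HM H; exists W.
- by move=> M c1 c2 rv vw Q W sQ HM [H _]; exists W.
- by move=> M c1 c2 rv vw Q W sQ HM [_ H]; exists W.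
- by move=> M c rv vw Q W sQ HM [J [_ HJ _ Hx]]; exists W; split=> //; apply: Hx.
- move=> M c rv vw Q W sQ HM [J [sJ HJ Hb Hx]]; exists W; split=> //.
  by apply: wp_mono (Hb _ _ _ HJ) => *; exists J.
- by move=> M e rv vw He Q W sQ HM H; exists W; split=> //; apply: H.
- by move=> M r e rv vw Q W sQ HM H; exists W.
- move=> M r x d vw' rv vw Hin Hv Q W sQ HM H; exists W; split=> //.
  by apply: H => //; apply: HM.
- move=> M x r vw' rv vw Hv Hy _ Q W sQ HM H.
  have [W' [H1 H2 H3]] := H W vw' (rely_refl W) Hv Hy.
  exists W'; split=> // mm; rewrite in_fset1U => /orP [/eqP -> //|Hin].
  by apply: minv_ext (guar_ext H1) _; apply: HM.
- by [].
Qed.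

Lemma wp_asserts_false c Q W rv vw :
  asserts_false c -> wp c Q W rv vw -> goal.
Proof.
by move=> H; elim: H Q W rv vw => [|c1 c2 _ IH] Q W rv vw //= /IH.
Qed.

Lemma wp_seq c1 c2 Q W rv vw :
  wp c1 (wp c2 Q) W rv vw -> wp (Seq c1 c2) Q W rv vw.
Proof. by []. Qed.

Lemma wp_assume e (Q : asrt) W (rv : regval R D) (vw : view V) :
  (eval rv e != ord0 -> Q W rv vw) -> wp (Assume V e) Q W rv vw.
Proof. by []. Qed.

Lemma wp_choice c1 c2 Q W rv vw :
  wp c1 Q W rv vw -> wp c2 Q W rv vw -> wp (Choice c1 c2) Q W rv vw.
Proof. by []. Qed.

Lemma wp_seqs (f : nat -> cmd R V D) (I : nat -> asrt) (s n : nat) W rv vw :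
  (forall j W rv vw, s <= j < s + n -> I j W rv vw -> wp (f j) (I j.+1) W rv vw) ->
  I s W rv vw ->
  wp (foldr (@Seq R V D) (@Skip R V D) [seq f j | j <- iota s n]) (I (s + n)) W rv vw.
Proof.
elim: n s W rv vw => [|n IH] s W rv vw H HI /=; first by rewrite addn0.
apply: wp_mono (H _ _ _ _ _ HI); last by lia.
move=> W' rv' vw' H'; rewrite addnS -addSn; apply: IH => // j *.
by apply: H => //; lia.
Qed.

Lemma wp_chs (T : Type) (f : T -> cmd R V D) (ds : seq T) e Q W rv vw :
  (forall rv, eval rv e = ord0) ->
  (forall i, i < size ds -> forall d0, wp (f (nth d0 ds i)) Q W rv vw) ->
  wp (foldr (@Choice R V D) (Assume V e) [seq f d | d <- ds]) Q W rv vw.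
Proof.
move=> He; elim: ds => [|d ds IH] H /=; first by rewrite He.
split; first exact: (H 0 isT d).
by apply: IH => i Hi d0; apply: (H i.+1).
Qed.

End Rules.

(* Thread 0 extends the world, which the other threads only observe. *)
Lemma unsafe_wp (dinit : data D) (cenv cdis : cmd R V D) (W0 : World) :
  (forall x, minv W0 (x, dinit, [ffun=> 0])) ->
  wp eq ext cdis (fun _ _ _ => True) W0 [ffun=> ord0] [ffun=> 0] ->
  wp ext eq cenv (fun _ _ _ => True) W0 [ffun=> ord0] [ffun=> 0] ->
  unsafe_from (ginit dinit cenv cdis) -> goal.
Proof.
move=> Hm Hd He.
pose rely t : World -> World -> Prop := if t == 0 then eq else ext.
pose guar t : World -> World -> Prop := if t == 0 then ext else eq.
pose T : asrt := fun _ _ _ => True.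
have sT r : stable r T by [].
pose inv (c : conf R V D) := exists W, (forall m, m \in cmem c -> minv W m) /\
   forall t, wp (rely t) (guar t) (lcmd (cthreads c t)) T W
                (lreg (cthreads c t)) (lview (cthreads c t)).
have rr t W : rely t W W by rewrite /rely; case: ifP.
have rt t W1 W2 W3 : rely t W1 W2 -> rely t W2 W3 -> rely t W1 W3.
  by rewrite /rely; case: ifP => _; [move=> -> | apply: ext_trans].
have ge t W1 W2 : guar t W1 W2 -> ext W1 W2.
  by rewrite /guar; case: ifP => // _ ->.
have gr t t' W1 W2 : t' != t -> guar t W1 W2 -> rely t' W1 W2.
  rewrite /guar /rely; case: (t =P 0) => [->|_]; first by move=> /negPf ->.
  by move=> _ ->; case: ifP.
have pres c c' : gstep c c' -> inv c -> inv c'.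
  case=> t M th M' l' st [W [HM Ht]].
  have [W' [g1 g2 g3]] : exists W', [/\ guar t W W', forall m, m \in M' -> minv W' m
      & wp (rely t) (guar t) (lcmd l') T W' (lreg l') (lview l')].
    apply: (lstep_wp _ _ _ _ (sT _) st HM (Ht t)); eauto.
    by rewrite /guar; case: ifP.
  exists W'; split=> // t' /=; case: eqP => [->|/eqP ne] //.
  have := Ht t'; apply: (wp_stable (rt t') (sT _)); exact: gr ne g1.
have preach c c' : greach c c' -> inv c -> inv c'.
  by elim=> // c1 c2 c3 s12 _ IH /(pres _ _ s12).
have i0 : inv (ginit dinit cenv cdis).
  exists W0; split=> [mm|t] /=.
    by case/imfsetP => x _ ->; apply: Hm.
  by rewrite /rely /guar; case: eqP.
case=> c' [t [/preach /(_ i0) [W [_ Ht]] ha]].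
exact: wp_asserts_false ha (Ht t).
Qed.

End Wp.

(** * Angelic executions of a single thread *)

Section Can.
Context (R V D : nat).
Local Notation post := (memory V D -> regval R D -> view V -> Prop).

Inductive lreach : memory V D -> lconf R V D -> memory V D -> lconf R V D -> Prop :=
| lreach_refl M l : lreach M l M l
| lreach_step M1 l1 M2 l2 M3 l3 :
    lstep M1 l1 M2 l2 -> lreach M2 l2 M3 l3 -> lreach M1 l1 M3 l3.

(** The thread runs alone: completeness needs only schedules in which threads take turns in long
    blocks, so no interference is modelled. *)
Definition can (c : cmd R V D) (Q : post) : post := fun M rv vw =>
  exists M' rv' vw', lreach M (LConf c rv vw) M' (LConf (@Skip R V D) rv' vw')
                     /\ Q M' rv' vw'.

Lemma lreach_trans M1 l1 M2 l2 M3 l3 :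
  lreach M1 l1 M2 l2 -> lreach M2 l2 M3 l3 -> lreach M1 l1 M3 l3.
Proof. by elim=> // *; apply: lreach_step; eauto. Qed.

Lemma lreach_seq M c rv vw M' c' rv' vw' c2 :
  lreach M (LConf c rv vw) M' (LConf c' rv' vw') ->
  lreach M (LConf (Seq c c2) rv vw) M' (LConf (Seq c' c2) rv' vw').
Proof.
move E1: (LConf c rv vw) => l; move E2: (LConf c' rv' vw') => l' H.
elim: H c rv vw E1 E2 => [M1 l1|M1 l1 M2 [c2' r2 v2] M3 l3 st _ IH] c rv vw E1 E2.
  by move: E1; rewrite -E2 => -[-> -> ->]; apply: lreach_refl.
by subst l1; apply: lreach_step (st_seq _ st) (IH _ _ _ erefl E2).
Qed.

Lemma can_skip (Q : post) M rv vw : Q M rv vw -> can (@Skip R V D) Q M rv vw.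
Proof. by move=> H; exists M, rv, vw; split=> //; apply: lreach_refl. Qed.

Lemma can_seq c1 c2 Q M rv vw :
  can c1 (can c2 Q) M rv vw -> can (Seq c1 c2) Q M rv vw.
Proof.
case=> M1 [rv1 [vw1 [H1 [M2 [rv2 [vw2 [H2 HQ]]]]]]].
exists M2, rv2, vw2; split=> //.
apply: lreach_trans (lreach_seq _ H1) _.
by apply: lreach_step H2; apply: st_seq_skip.
Qed.

Lemma can_step c c' Q M rv vw M' rv' vw' :
  lstep M (LConf c rv vw) M' (LConf c' rv' vw') ->
  can c' Q M' rv' vw' -> can c Q M rv vw.
Proof.
move=> st [M2 [rv2 [vw2 [H HQ]]]]; exists M2, rv2, vw2; split=> //.
exact: lreach_step H.
Qed.

Lemma can_mono c (Q Q' : post) M rv vw :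
  (forall M rv vw, Q M rv vw -> Q' M rv vw) -> can c Q M rv vw -> can c Q' M rv vw.
Proof.
by move=> HQ [M' [rv' [vw' [H /HQ H']]]]; exists M', rv', vw'.
Qed.

(** A variant of [can] for targets other than [Skip]: the distinguished thread pauses in the middle
    of its program, and it ends at an assertion that no step leaves. *)
Definition leads (c : cmd R V D) (T : lconf R V D -> memory V D -> Prop) : post := fun M rv vw =>
  exists M' l', lreach M (LConf c rv vw) M' l' /\ T l' M'.

Lemma leads_here c (T : lconf R V D -> memory V D -> Prop) M rv vw :
  T (LConf c rv vw) M -> leads c T M rv vw.
Proof. by move=> H; exists M, (LConf c rv vw); split=> //; apply: lreach_refl. Qed.

Lemma leads_seq c1 c2 T M rv vw : can c1 (leads c2 T) M rv vw -> leads (Seq c1 c2) T M rv vw.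
Proof.
case=> M1 [rv1 [vw1 [H1 [M2 [l2 [H2 HT]]]]]]; exists M2, l2; split=> //.
by apply: lreach_trans (lreach_seq _ H1) _; apply: lreach_step H2; apply: st_seq_skip.
Qed.

Lemma can_choice_l c1 c2 Q M rv vw : can c1 Q M rv vw -> can (Choice c1 c2) Q M rv vw.
Proof. by apply: can_step; apply: st_choice_l. Qed.

Lemma can_choice_r c1 c2 Q M rv vw : can c2 Q M rv vw -> can (Choice c1 c2) Q M rv vw.
Proof. by apply: can_step; apply: st_choice_r. Qed.

Lemma can_assume e (Q : post) M rv vw :
  eval rv e != ord0 -> Q M rv vw -> can (Assume V e) Q M rv vw.
Proof.
by move=> He HQ; apply: (can_step (st_assume _ _ He)); apply: can_skip.
Qed.

Lemma can_assign r e (Q : post) M rv vw :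
  Q M (upd rv r (eval rv e)) vw -> can (Assign V r e) Q M rv vw.
Proof. by move=> HQ; apply: (can_step (st_assign _ _ _ _ _)); apply: can_skip. Qed.

Lemma can_load r x d (vw' : view V) (Q : post) (M : memory V D) (rv : regval R D)
    (vw : view V) :
  (x, d, vw') \in M -> vw x <= vw' x -> Q M (upd rv r d) (join vw vw') ->
  can (LoadVar D r x) Q M rv vw.
Proof.
by move=> Hin Hv HQ; apply: (can_step (st_load _ _ Hin Hv)); apply: can_skip.
Qed.

(* Storing above every timestamp in use avoids all conflicts. *)
Lemma can_store x r (n : nat) (Q : post) (M : memory V D) (rv : regval R D)
    (vw : view V) :
  vw x < n -> (forall m, m \in M -> mvar m = x -> mview m x < n) ->
  Q ((x, rv r, upd vw x n) |` M)%fset rv (upd vw x n) ->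
  can (StoreVar D x r) Q M rv vw.
Proof.
move=> Hv HM HQ.
have st : lstep M (LConf (StoreVar D x r) rv vw)
   ((x, rv r, upd vw x n) |` M)%fset (LConf (@Skip R V D) rv (upd vw x n)).
  apply: st_store; first by rewrite ffunE eqxx.
  - by move=> y /negPf ne; rewrite ffunE ne.
  - move=> mm Hin; have [e|/eqP ne] := eqVneq (mvar mm) x; last first.
      by apply: Or31 => e; apply: ne.
    apply: Or32; rewrite /mvar /mview /= ffunE eqxx => e2.
    have := HM _ Hin e; rewrite /mview; move: e2; rewrite -/(mvar mm) e => <-.
    by rewrite ltnn.
by apply: (can_step st); apply: can_skip.
Qed.

Lemma can_seqs (f : nat -> cmd R V D) (I : nat -> post) (s n : nat) M rv vw :
  (forall j M rv vw, s <= j < s + n -> I j M rv vw -> can (f j) (I j.+1) M rv vw) ->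
  I s M rv vw ->
  can (foldr (@Seq R V D) (@Skip R V D) [seq f j | j <- iota s n]) (I (s + n)) M rv vw.
Proof.
elim: n s M rv vw => [|n IH] s M rv vw H HI /=.
  by rewrite addn0; apply: can_skip.
apply: can_seq; apply: can_mono (H _ _ _ _ _ HI); last by lia.
move=> M' rv' vw' H'; rewrite addnS -addSn; apply: IH => // j *.
by apply: H => //; lia.
Qed.

Lemma can_chs (T : eqType) (f : T -> cmd R V D) (ds : seq T) c d Q M rv vw :
  d \in ds -> can (f d) Q M rv vw ->
  can (foldr (@Choice R V D) c [seq f d | d <- ds]) Q M rv vw.
Proof.
move=> Hin H; elim: ds Hin => [|d' ds IH] //=; rewrite inE => /orP [/eqP <-|/IH].
  exact: can_choice_l.
exact: can_choice_r.
Qed.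

Lemma can_star_exit c (Q : post) M rv vw : Q M rv vw -> can (Star c) Q M rv vw.
Proof.
by move=> HQ; apply: (can_step (st_star_exit _ _ _ _)); apply: can_skip.
Qed.

Lemma can_star (c : cmd R V D) (I : nat -> post) s n M rv vw :
  (forall j M rv vw, s <= j < s + n -> I j M rv vw -> can c (I j.+1) M rv vw) ->
  I s M rv vw -> can (Star c) (I (s + n)) M rv vw.
Proof.
elim: n s M rv vw => [|n IH] s M rv vw H HI.
  by rewrite addn0; apply: can_star_exit.
apply: (can_step (st_star_iter _ _ _ _)); apply: can_seq.
apply: can_mono (H _ _ _ _ _ HI); last by lia.
move=> M' rv' vw' H'; rewrite addnS -addSn; apply: IH => // j *.
by apply: H => //; lia.
Qed.

Lemma greach_trans (c1 c2 c3 : conf R V D) :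
  greach c1 c2 -> greach c2 c3 -> greach c1 c3.
Proof. by elim=> // *; apply: greach_step; eauto. Qed.

Lemma greach_lreach M (th : nat -> lconf R V D) t M' l' :
  lreach M (th t) M' l' ->
  exists th', [/\ greach (Conf M th) (Conf M' th'), th' t = l'
                & forall i, i != t -> th' i = th i].
Proof.
move E: (th t) => l H; elim: H th E => {M l M' l'} [M l|M1 l1 M2 l2 M3 l3 st _ IH] th E.
  by exists th; split=> //; apply: greach_refl.
subst l1; have [|th' [H1 H2 H3]] := IH (fun i => if i == t then l2 else th i).
  by rewrite eqxx.
exists th'; split=> //; first by apply: greach_step H1; apply: gstep_thread.
by move=> i ne; rewrite H3 // (negPf ne).
Qed.

End Can.

(** * The system *)

Definition bit (v j : nat) : nat := odd (v %/ 2 ^ j).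

Lemma bit_le1 v j : bit v j <= 1. Proof. by rewrite /bit; case: odd. Qed.

Lemma divn_bit v j : v %/ 2 ^ j = 2 * (v %/ 2 ^ j.+1) + bit v j.
Proof.
rewrite /bit expnSr divnMA mul2n addnC -[LHS]odd_double_half.
by rewrite divn2.
Qed.

Lemma bits_inj n u v : u < 2 ^ n -> v < 2 ^ n ->
  (forall j, j < n -> bit u j = bit v j) -> u = v.
Proof.
move=> Hu Hv H.
suff G j : j <= n -> u %/ 2 ^ (n - j) = v %/ 2 ^ (n - j).
  by have := G n (leqnn n); rewrite subnn !divn1.
elim: j => [|j IH] Hj; first by rewrite subn0 !divn_small.
rewrite (divn_bit u) (divn_bit v) H; last by lia.
have -> : (n - j.+1).+1 = n - j by lia.
by rewrite IH //; lia.
Qed.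

Lemma bits_exist n (f : nat -> nat) : (forall j, j < n -> f j <= 1) ->
  exists v, v < 2 ^ n /\ forall j, j < n -> bit v j = f j.
Proof.
elim: n f => [|n IH] f Hf; first by exists 0.
have [|v [Hv Hb]] := IH (fun j => f j.+1); first by move=> j Hj; apply: Hf.
exists (2 * v + f 0); have f0 := Hf 0 isT; split; first by rewrite expnS; lia.
move=> [|j] Hj.
  by rewrite /bit expn0 divn1; case: (f 0) f0 => [|[|//]] _; lia.
rewrite -Hb // /bit expnS divnMA; do 2 f_equal; f_equal.
by case: (f 0) f0 => [|[|//]] _; lia.
Qed.

(** Ripple-carry addition with [c] the carry into position [j]. Since nothing but a carry is added,
    the outgoing carry is [c] if the new bit is 0 and is 0 otherwise; this is why [inc] tests the
    bit that it has just written. *)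
Lemma bit_carry u v c j : c <= 1 -> u %/ 2 ^ j = v %/ 2 ^ j + c ->
  [/\ bit u j = (if bit v j == c then 0 else 1)
    & u %/ 2 ^ j.+1 = v %/ 2 ^ j.+1 + (if bit u j == 1 then 0 else c)].
Proof.
move=> Hc H; move: (divn_bit u j) (divn_bit v j) (bit_le1 u j) (bit_le1 v j).
rewrite H => H1 H2; case: (bit u j) H1 => [|[|//]] H1 _;
  case: (bit v j) H2 => [|[|//]] H2 _; case: c Hc H H1 => [|[|//]] _ H H1 //=;
  split=> //; lia.
Qed.

Lemma bit_addP m v j : j < m -> bit (v + 2 ^ m) j = bit v j.
Proof.
move=> Hj; rewrite /bit addnC -{1}(subnK (ltnW Hj)) expnD divnMDl ?expn_gt0 //.
by rewrite oddD oddX subn_eq0 leqNgt Hj.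
Qed.

Section Access.
Context (n D : nat).

(** The programs are built from natural numbers. [inord] sends every number out of range to 0, so
    the lemmas on updates carry bounds. *)
Definition rd (rv : regval n.+1 D) (i : nat) : nat := rv (inord i).
Definition vt (vw : view n.+1) (x : nat) : nat := vw (inord x).

Lemma inord_eq i j : i <= n -> j <= n -> (@inord n i == inord j) = (i == j).
Proof. by move=> Hi Hj; rewrite -val_eqE /= !inordK. Qed.

Lemma rd_upd rv r d i : r <= n -> i <= n ->
  rd (upd rv (inord r) d) i = if i == r then nat_of_ord d else rd rv i.
Proof. by move=> Hr Hi; rewrite /rd /upd ffunE inord_eq //; case: eqP. Qed.

Lemma vt_upd vw x t y : x <= n -> y <= n ->
  vt (upd vw (inord x) t) y = if y == x then t else vt vw y.
Proof. by move=> Hx Hy; rewrite /vt /upd ffunE inord_eq //; case: eqP. Qed.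

Lemma vt_join v w x : vt (join v w) x = maxn (vt v x) (vt w x).
Proof. by rewrite /vt /join ffunE. Qed.

Lemma rd_le rv i : rd rv i <= D.
Proof. by rewrite /rd -ltnS. Qed.

End Access.

Section System.
Context (m D acc : nat) (Delta : seq (nat * nat * nat * nat * nat)).

Definition nbits := m + m.
Local Notation N := nbits.
Definition regmax := N + 5.
Local Notation Rn := regmax.
(** The last variable is [vF N]. The node of level [N - 1] loads it, but no thread stores to it, so
    it keeps the value 2 and that node blocks. *)
Definition varmax := 5 * N + 6.
Local Notation Vn := varmax.

Local Notation cmd := (cmd Rn.+1 Vn.+1 D).
Local Notation expr := (expr Rn.+1 D).

Definition ereg r : expr := EReg D (inord r).
Definition econst d : expr := EConst Rn.+1 (inord d).
Definition load r x : cmd := LoadVar D (inord r) (inord x).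
Definition store x r : cmd := StoreVar D (inord x) (inord r).
Definition assign r e : cmd := Assign Vn.+1 (inord r) e.
Definition assume e : cmd := Assume Vn.+1 e.
Definition assume_eq r d := assume (ECond (ereg r) (econst d) (econst 1) (econst 0)).
Definition assume_same r r' := assume (ECond (ereg r) (ereg r') (econst 1) (econst 0)).
Definition seqs (cs : seq cmd) : cmd := foldr (@Seq _ _ _) (@Skip _ _ _) cs.
(** The closing branch blocks, so exactly the members of the list can be chosen. *)
Definition chs (cs : seq cmd) : cmd := foldr (@Choice _ _ _) (assume (econst 0)) cs.

Definition rcarry := 0.
Definition rflag := 1.
Definition rstate := 2.
Definition ry := 3.
Definition rz := 4.
Definition rt := 5.
Definition rbit j := 6 + j.

(* [vy] and [vz] carry the popped and the pushed letter, [vA j] and [vB j] the two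
   copies of bit [j] of the round, and [vF j] the results of level [j].  All
   variables are initially 2, which is the value of no bit. *)
Definition vy := 0.
Definition vz := 1.
Definition vA j := 2 + 5 * j.
Definition vB j := 3 + 5 * j.
Definition vrail j b := 4 + 5 * j + b.
Definition vF j := 6 + 5 * j.

(* The distinguished thread writes its variables in the order
   [ordv 0, ..., ordv (L - 1)] in every round, and the other threads read them
   in the opposite order. *)
Definition rlen := N + 2 + N.
Local Notation L := rlen.
Definition ordv i :=
  if i < N then vB (N.-1 - i) else
  if i == N then vy else if i == N.+1 then vz else vA (i - (N + 2)).
Definition regof i :=
  if i < N then rbit (N.-1 - i) else
  if i == N then ry else if i == N.+1 then rz else rbit (i - (N + 2)).

Definition inc j : cmd :=
  Seq (assign (rbit j) (ECond (ereg (rbit j)) (ereg rcarry) (econst 0) (econst 1)))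
      (assign rcarry (ECond (ereg (rbit j)) (econst 1) (econst 0) (ereg rcarry))).

Definition branch (d : nat * nat * nat * nat * nat) : cmd :=
  let: (x, s, o, w, s') := d in
  Seq (assume_eq rflag x) (Seq (assume_eq rstate s)
    (Seq (assign ry (econst o)) (Seq (assign rz (econst w))
      (assign rstate (econst s'))))).

Definition round : cmd := seqs [seq store (ordv i) (regof i) | i <- iota 0 L].

(** The carry out of the lower half of the counter marks the first round of a row and is kept in
    [rflag] for the next iteration. A carry out of the upper half stays in [rcarry]: it means that
    all [K] rounds are done, and it blocks a further iteration. *)
Definition body : cmd :=
  Seq (assume_eq rcarry 0) (Seq (chs [seq branch d | d <- Delta]) (Seq round
    (Seq (assign rcarry (econst 1)) (Seq (seqs [seq inc j | j <- iota 0 m])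
      (Seq (assign rflag (ereg rcarry)) (seqs [seq inc j | j <- iota m m])))))).

Definition cdis_sys : cmd :=
  Seq (Star body) (Seq (assume_eq rcarry 1) (Seq (assume_eq rstate acc)
    (Seq (load rt (vF 0)) (Seq (assume_eq rt 0)
      (Seq (load rt (vF 0)) (Seq (assume_eq rt 1) (@AssertFalse _ _ _))))))).

Definition check i : cmd := Seq (load rt (ordv i)) (assume_same rt (regof i)).

Definition exact x r : cmd :=
  Seq (seqs [seq check (L.-1 - j) | j <- iota 0 N])
    (Seq (load r x) (seqs [seq check (N.-1 - j) | j <- iota 0 N])).

(** The value stored on the opposite rail is the 0 that is still in [rcarry]; it cannot be mistaken
    for the initial 2. *)
Definition guess j : cmd :=
  Choice (Seq (assign (rbit j) (econst 0)) (store (vrail j 1) rcarry))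
         (Seq (assign (rbit j) (econst 1)) (store (vrail j 0) rcarry)).

(* The carry after the increment tells whether [v + P] is beyond the last round. *)
Definition leaf : cmd :=
  Seq (seqs [seq guess j | j <- iota 0 N])
  (Seq (assign rflag (ereg (rbit N.-1)))
  (Seq (exact vz rz)
  (Seq (assign rcarry (econst 1))
  (Seq (seqs [seq inc j | j <- iota m m])
  (Seq (Choice (assume_eq rcarry 1) (Seq (assume_eq rcarry 0) (Seq (exact vy ry) (assume_same ry rz))))
       (store (vF N.-1) rflag)))))).

Definition nodeb j b : cmd :=
  Seq (load rt (vrail j b)) (Seq (assume_eq rt 2)
    (Seq (assign rt (econst b)) (store (vF j) rt))).

(** Both results are messages on one variable, so the result 1 must not be older than the result 0.
    The schedule of the completeness proof therefore evaluates the subtree of 0 first. *)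
Definition node j : cmd :=
  Seq (load rt (vF j.+1)) (Seq (assume_eq rt 0)
    (Seq (load rt (vF j.+1)) (Seq (assume_eq rt 1)
      (Choice (nodeb j 0) (nodeb j 1))))).

Definition cenv_sys : cmd := Choice leaf (chs [seq node j | j <- iota 0 N]).

Definition sys : system :=
  @System Rn.+1 Vn.+1 D (inord 2) cenv_sys cdis_sys.

Definition period := 2 ^ m.
Local Notation P := period.
Definition horizon := 2 ^ N.
Local Notation K := horizon.

(** Row 0 is not flagged, in accordance with the initial value 0 of [rflag]; the control recognizes
    it by its initial state. *)
Definition flag (i : nat) : nat := (0 < i) && (P %| i).

(* Runs of a finite control with a queue of length [P]: in step [i] it pops
   [o i] and pushes [w i]; the first [P] pops are unconstrained. *)
Definition queue_run : Prop :=
  exists sg o w : nat -> nat,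
    [/\ sg 0 = 0, sg K = acc,
        forall i, i < K -> (flag i, sg i, o i, w i, sg i.+1) \in Delta
      & forall i, i + P < K -> w i = o (i + P)].

Lemma regofE i : i < L -> i != N -> i != N.+1 -> exists2 j, j < N & regof i = rbit j.
Proof.
move=> Hi n1 n2; rewrite /regof (negPf n1) (negPf n2).
case: ifP => H; first by exists (N.-1 - i) => //; lia.
by exists (i - (N + 2)) => //; move: Hi; rewrite /rlen; lia.
Qed.

Lemma regofN : (regof N = ry) * (regof N.+1 = rz).
Proof.
rewrite /regof ltnn eqxx ltnNge leqnSn /= eqxx.
by case: eqP => // /eqP; rewrite eqn_leq ltnn.
Qed.

Lemma ordvN : (ordv N = vy) * (ordv N.+1 = vz).
Proof.
rewrite /ordv ltnn eqxx ltnNge leqnSn /= eqxx.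
by case: eqP => // /eqP; rewrite eqn_leq ltnn.
Qed.

Lemma regof_le i : i < L -> regof i <= Rn.
Proof. by rewrite /regof /rlen /regmax /rbit /ry /rz; do 3?case: ifP; lia. Qed.

Lemma ordv_le i : i < L -> ordv i <= Vn.
Proof. by rewrite /ordv /rlen /varmax /vA /vB /vy /vz; do 3?case: ifP; lia. Qed.

Lemma ordv_inj i j : i < L -> j < L -> ordv i = ordv j -> i = j.
Proof.
by rewrite /ordv /rlen /vA /vB /vy /vz; do 6?case: ifP; lia.
Qed.

Lemma ordv_rail i j b : i < L -> b <= 1 -> ordv i <> vrail j b.
Proof. by rewrite /ordv /rlen /vA /vB /vy /vz /vrail; do 3?case: ifP; lia. Qed.

Lemma ordv_F i j : i < L -> ordv i <> vF j.
Proof. by rewrite /ordv /rlen /vA /vB /vy /vz /vF; do 3?case: ifP; lia. Qed.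

Lemma reg_small r : r < 6 -> r <= Rn. Proof. by rewrite /regmax; lia. Qed.

Lemma rbit_le j : j < N -> rbit j <= Rn.
Proof. by rewrite /rbit /regmax; lia. Qed.

Lemma vrail_le j b : j < N -> b <= 1 -> vrail j b <= Vn.
Proof. by rewrite /vrail /varmax; lia. Qed.

Lemma vF_le j : j <= N -> vF j <= Vn.
Proof. by rewrite /vF /varmax; lia. Qed.

Lemma regof_bitA j : j < N -> regof (L.-1 - j) = rbit (N.-1 - j).
Proof. by move=> Hj; rewrite /regof /rlen; do 3?case: ifP; rewrite /rbit; lia. Qed.

Lemma regof_bitB j : j < N -> regof (N.-1 - j) = rbit j.
Proof. by move=> Hj; rewrite /regof; do 3?case: ifP; rewrite /rbit; lia. Qed.

(** A carry reaches position [j] exactly if all lower bits of [r] are 1. With [j = m] this detects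
    the row boundaries, and with [j = N] the end of the run. *)
Lemma carry_dvd r j c : r.+1 %/ 2 ^ j = r %/ 2 ^ j + c -> c = (2 ^ j %| r.+1).
Proof. by rewrite divnS ?expn_gt0 // addnC => /addnI. Qed.

Lemma rlen_gt0 : 0 < L. Proof. by rewrite /rlen; lia. Qed.

Lemma N_lt_L : N.+1 < L. Proof. by rewrite /rlen /nbits; lia. Qed.

Lemma period_gt0 : 0 < P. Proof. by rewrite /period expn_gt0. Qed.

Lemma sys_class : env_nocas_acyc_dis_nocas sys.
Proof.
have nc (f : nat -> cmd) s : all (fun j => nocas (f j)) s -> nocas (seqs [seq f j | j <- s]).
  by elim: s => //= j s IH /andP [-> /IH ->].
have nc' T (f : T -> cmd) s : all (fun j => nocas (f j)) s -> nocas (chs [seq f j | j <- s]).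
  by elim: s => //= j s IH /andP [-> /IH ->].
have ac (f : nat -> cmd) s : all (fun j => acyc (f j)) s -> acyc (seqs [seq f j | j <- s]).
  by elim: s => //= j s IH /andP [-> /IH ->].
have ac' T (f : T -> cmd) s : all (fun j => acyc (f j)) s -> acyc (chs [seq f j | j <- s]).
  by elim: s => //= j s IH /andP [-> /IH ->].
have tr T (p : pred T) s : (forall x, p x) -> all p s by move=> Hp; elim: s => //= x s ->; rewrite Hp.
rewrite /env_nocas_acyc_dis_nocas /= !nc ?nc' ?ac ?ac' //; apply: tr => //.
by move=> [[[[x s] o] w] s'].
Qed.

Hypothesis m_gt0 : 0 < m.
Hypothesis D_ge2 : 2 <= D.

Local Notation regval := (regval Rn.+1 D).
Local Notation view := (view Vn.+1).
Local Notation message := (message Vn.+1 D).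
Local Notation memory := (memory Vn.+1 D).
Local Notation lconf := (lconf Rn.+1 Vn.+1 D).
Local Notation post := (memory -> regval -> view -> Prop).

Hypothesis Delta_le : forall x s o w s', (x, s, o, w, s') \in Delta ->
  [/\ x <= 1, s <= D, o <= D, w <= D & s' <= D].
Hypothesis acc_le : acc <= D.

Implicit Types (rv : regval) (vw : view) (M : memory).

Lemma eval_eq rv (e1 e2 : expr) :
  eval rv (ECond e1 e2 (econst 1) (econst 0)) != ord0 = (eval rv e1 == eval rv e2).
Proof.
have D1 : 1 < D.+1 by lia.
have i1 : (inord 1 : 'I_D.+1) != ord0 by rewrite -val_eqE /= inordK.
have -> : eval rv (ECond e1 e2 (econst 1) (econst 0)) =
  if eval rv e1 == eval rv e2 then inord 1 else inord 0 by [].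
by case: (eval rv e1 == eval rv e2); rewrite -?val_eqE /= ?inordK.
Qed.

Lemma eval_reg rv r : nat_of_ord (eval rv (ereg r)) = rd rv r. Proof. by []. Qed.

Lemma eval_const rv d : d <= D -> nat_of_ord (eval rv (econst d)) = d.
Proof. by move=> Hd; rewrite /= inordK. Qed.

(* The state of the registers while the number held by the bit registers is
   changed from [v] to [u], the bits below [j] being done. *)
Definition inc_inv (rv0 : regval) u v j rv : Prop :=
  [/\ forall i, i < N -> rd rv (rbit i) = if i < j then bit u i else bit v i,
      rd rv rcarry <= 1 /\ u %/ 2 ^ j = v %/ 2 ^ j + rd rv rcarry
    & forall r, 0 < r < 6 -> rd rv r = rd rv0 r].

Definition inc_reg j rv :=
  let rv1 := upd rv (inord (rbit j))
     (eval rv (ECond (ereg (rbit j)) (ereg rcarry) (econst 0) (econst 1))) in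
  upd rv1 (inord rcarry)
     (eval rv1 (ECond (ereg (rbit j)) (econst 1) (econst 0) (ereg rcarry))).

Lemma inc_regP rv0 u v j rv : j < N ->
  inc_inv rv0 u v j rv -> inc_inv rv0 u v j.+1 (inc_reg j rv).
Proof.
move=> Hj [Hb [Hc Hd] Hr]; have Hj' : rbit j <= Rn by rewrite /rbit /regmax; lia.
have b6 i : i < N -> rbit i <= Rn by rewrite /rbit /regmax; lia.
have [c1 c2] := bit_carry Hc Hd.
have Ej : rd rv (rbit j) = bit v j by rewrite Hb // ltnn.
set rv1 := upd rv (inord (rbit j))
     (eval rv (ECond (ereg (rbit j)) (ereg rcarry) (econst 0) (econst 1))).
have E1 i : i <= Rn -> rd rv1 i = if i == rbit j then bit u j else rd rv i.
  move=> Hi; rewrite rd_upd //; case: eqP => // _; rewrite c1 /= -val_eqE /=.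
  by rewrite -/(rd rv (rbit j)) -/(rd rv rcarry) Ej; case: eqP; rewrite inordK //; lia.
have E2 i : i <= Rn -> rd (inc_reg j rv) i =
    if i == rcarry then (if bit u j == 1 then 0 else rd rv rcarry) else rd rv1 i.
  move=> Hi; rewrite /inc_reg -/rv1 rd_upd //; case: eqP => // _.
  rewrite /= -val_eqE /= -/(rd rv1 (rbit j)) -/(rd rv1 rcarry) !E1 // eqxx inordK; last by lia.
  by case: (bit u j == 1); rewrite ?inordK // -/(rd rv1 rcarry) E1.
split.
- move=> i Hi; rewrite E2 ?b6 //= E1 ?b6 // Hb // ltnS /rbit eqn_add2l.
  by case: ltngtP => // ->.
- by rewrite E2 //=; split=> //; case: ifP.
- move=> r /andP [r0 reg_small]; rewrite E2; last by rewrite /regmax; lia.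
  have -> : (r == rcarry) = false by rewrite /rcarry; apply/eqP; lia.
  rewrite E1; last by rewrite /regmax; lia.
  have -> : (r == rbit j) = false by rewrite /rbit; lia.
  by apply: Hr; rewrite r0.
Qed.

Lemma rd_bit rv r d j : r < 6 -> j < N ->
  rd (upd rv (inord r) d) (rbit j) = rd rv (rbit j).
Proof.
move=> Hr Hj; rewrite rd_upd ?(reg_small Hr) ?rbit_le //.
by have -> : (rbit j == r) = false by rewrite /rbit; lia.
Qed.

Lemma rd0 r : rd ([ffun=> ord0] : regval) r = 0.
Proof. by rewrite /rd ffunE. Qed.

Lemma vt0 x : vt ([ffun=> 0] : view) x = 0.
Proof. by rewrite /vt ffunE. Qed.

(** * Soundness of the system *)

(* The stores of the distinguished thread so far: variable, value, timestamp. *)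
Definition world := seq (nat * nat * nat).
Implicit Type W : world.
Definition wvar W k := (nth (0, 0, 0) W k).1.1.
Definition wval W k := (nth (0, 0, 0) W k).1.2.
Definition wts W k := (nth (0, 0, 0) W k).2.

(** Entry [k] of the log is store [k %% L] of round [k %/ L]. Only the values of the bit variables
    are prescribed; the letters are guesses. *)
Definition wfW W : Prop :=
  [/\ size W <= K * L,
      forall k, k < size W -> wvar W k = ordv (k %% L) /\ 0 < wts W k,
      forall k k', k < k' -> k' < size W -> wvar W k = wvar W k' ->
        wts W k < wts W k'
    & forall r i j, r * L + i < size W -> i < L -> regof i = rbit j ->
        wval W (r * L + i) = bit r j].

(** Well-formedness is preserved by definition, so that a thread which merely observes the log can
    keep it without knowing how the log grows. *)
Definition ext W W' : Prop := exists2 s, W' = W ++ s & wfW W -> wfW W'.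

Lemma ext_refl W : ext W W. Proof. by exists [::]; rewrite ?cats0. Qed.

Lemma ext_trans W1 W2 W3 : ext W1 W2 -> ext W2 W3 -> ext W1 W3.
Proof.
by case=> s -> H1 [s' -> H2]; exists (s ++ s'); rewrite ?catA //; auto.
Qed.

Lemma ext_wf W W' : ext W W' -> wfW W -> wfW W'. Proof. by case. Qed.

Lemma ext_size W W' : ext W W' -> size W <= size W'.
Proof. by case=> s -> _; rewrite size_cat leq_addr. Qed.

Lemma ext_nth W W' k : ext W W' -> k < size W ->
  [/\ wvar W' k = wvar W k, wval W' k = wval W k & wts W' k = wts W k].
Proof. by case=> s -> _ Hk; rewrite /wvar /wval /wts nth_cat Hk. Qed.

(** The queue condition at index [v], vacuous if round [v + P] does not exist. Demanding that both
    letters are already in the log makes it stable under [ext]. *)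
Definition good W (v : nat) : Prop :=
  v + P < K ->
  (v + P) * L + N < size W /\ wval W (v * L + N.+1) = wval W ((v + P) * L + N).

Lemma good_ext W W' v : ext W W' -> good W v -> good W' v.
Proof.
move=> HE Hg Hv; have [Hs He] := Hg Hv; have Hs' := leq_trans Hs (ext_size HE).
split=> //; have := period_gt0; have := N_lt_L.
have [_ -> _] := ext_nth HE Hs; move=> HN HP.
have [|_ -> _] := @ext_nth W W' (v * L + N.+1) HE; last by [].
by apply: leq_ltn_trans Hs; rewrite mulnDl; nia.
Qed.

(** The distinguished thread is the only writer of these variables, and its view contains all its
    earlier stores; a message passes them on to its reader. *)
Definition dismsg W (x d : nat) vw : Prop :=
  (d = 2 /\ vt vw x = 0) \/
  exists k, [/\ k < size W, wvar W k = x, wval W k = d, wts W k = vt vw x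
              & forall k', k' <= k -> wts W k' <= vt vw (wvar W k')].

(* A leaf that guesses bit [u] as [b] advances its view on the opposite rail
   [vrail u (1 - b)].  The indices that a message on [vF j] can vouch for are thus
   those whose own rails are at 0 in its view. *)
Definition certF W (j b : nat) vw : Prop :=
  forall v, v < K -> bit v j = b ->
    (forall u, u < j -> vt vw (vrail u (bit v u)) = 0) -> good W v.

(** There is one clause for each class of variables. The initial value 2 on a [vF] vouches for
    nothing, and on a rail it betrays the timestamp 0. Through [wfW W] every load also yields that
    the log is well formed. *)
Definition minv W (mm : message) : Prop :=
  let x : nat := mm.1.1 in let d : nat := mm.1.2 in let vw := mm.2 in
  [/\ wfW W,
      forall i, i < L -> x = ordv i -> dismsg W x d vw,
      forall j b, j < N -> b <= 1 -> x = vrail j b -> d = 2 -> vt vw x = 0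
    & forall j, j <= N -> x = vF j -> d <= 1 -> certF W j d vw].

Lemma minv_ext W W' mm : ext W W' -> minv W mm -> minv W' mm.
Proof.
move=> HE [wf Hd Hr HF]; split=> //; first exact: ext_wf HE wf.
- move=> i Hi Ex; case: (Hd i Hi Ex) => [?|[k [Hk E1 E2 E3 E4]]]; first by left.
  right; exists k; have [-> -> ->] := ext_nth HE Hk.
  split=> //; first exact: leq_trans Hk (ext_size HE).
  move=> k' Hk'; have Hk2 := leq_ltn_trans Hk' Hk.
  by have [-> _ ->] := ext_nth HE Hk2; apply: E4.
- move=> j Hj Ex Hb v Hv Hbit Hu; apply: good_ext HE _.
  exact: (HF j Hj Ex Hb v Hv Hbit Hu).
Qed.

Lemma minv0 (x : 'I_Vn.+1) : minv [::] (x, inord 2, [ffun=> 0]).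
Proof.
have v0 y : vt ([ffun=> 0] : view) y = 0 by rewrite /vt ffunE.
split=> //=.
- move=> i Hi _; left; rewrite inordK ?v0 //; lia.
- by move=> j _ _; rewrite inordK //; lia.
Qed.

Definition cov W r i vw : Prop :=
  forall k, k < size W -> k <= r * L + i -> wts W k <= vt vw (wvar W k).

Lemma cov_ext W W' r i vw vw' : ext W W' -> r * L + i < size W ->
  (forall x, vt vw x <= vt vw' x) -> cov W r i vw -> cov W' r i vw'.
Proof.
move=> HE Hs Hv Hc k Hk Hk'; have Hk2 := leq_ltn_trans Hk' Hs.
have [-> _ ->] := ext_nth HE Hk2.
by apply: leq_trans (Hv _); apply: Hc.
Qed.

Lemma cov_le W r i i' vw : i' <= i -> cov W r i vw -> cov W r i' vw.
Proof. by move=> Hi Hc k Hk Hk'; apply: Hc => //; lia. Qed.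

Lemma read_dis0 W i vw vw' d :
  i < L -> minv W (inord (ordv i), d, vw') ->
  (nat_of_ord d = 2 /\ vt vw' (ordv i) = 0) \/
  exists r', [/\ r' * L + i < size W, wval W (r' * L + i) = d,
    wts W (r' * L + i) = vt vw' (ordv i) & cov W r' i (join vw vw')].
Proof.
move=> Hi [[_ wv _ _] Hd _ _]; have := Hd i Hi.
have /= -> := inordK (n' := Vn) (ordv_le Hi : ordv i < Vn.+1).
case=> // [[E0 E1]|[k [Hk E1 E2 E3 E4]]]; [by left|right].
have [Ek _] := wv _ Hk; rewrite E1 in Ek.
have Ei : i = k %% L by apply: ordv_inj => //; rewrite ltn_mod rlen_gt0.
have Ek' : k = (k %/ L) * L + i by rewrite Ei -divn_eq.
exists (k %/ L); rewrite -Ek'; split=> // k' Hk' Hle'.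
by rewrite vt_join leq_max; apply/orP; right; apply: E4; rewrite Ek'.
Qed.

(** The timestamps on one variable increase with the round, so a view that covers the store of round
    [r] admits no earlier one. The initial message is excluded because stores have positive
    timestamps. *)
Lemma read_dis W r i vw vw' d :
  i < L -> minv W (inord (ordv i), d, vw') ->
  r * L + i < size W -> cov W r i vw -> vt vw (ordv i) <= vt vw' (ordv i) ->
  exists r', [/\ r <= r', r' * L + i < size W, wval W (r' * L + i) = d
               & cov W r' i (join vw vw')].
Proof.
move=> Hi Hm Hs Hc Hle; have [[_ wv wt _] _ _ _] := Hm.
have Em r0 : (r0 * L + i) %% L = i by rewrite modnMDl modn_small.
have [Evar Ets] := wv _ Hs; rewrite Em in Evar.
have Hcr := Hc _ Hs (leqnn _); rewrite Evar in Hcr.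
case: (read_dis0 vw Hi Hm) => [[_ E0]|[r' [H1 H2 H3 H4]]]; first by lia.
exists r'; split=> //; rewrite leqNgt; apply/negP => Hlt.
have Hlt' : r' * L + i < r * L + i by rewrite ltn_add2r ltn_pmul2r // rlen_gt0.
have [Evar' _] := wv _ H1; rewrite Em in Evar'.
by have := wt _ _ Hlt' Hs; rewrite Evar Evar' => /(_ erefl); lia.
Qed.

Local Notation asrt := (world -> regval -> view -> Prop).

Local Notation envp := (@wp Rn.+1 Vn.+1 D world minv (queue_run) ext eq).
Local Notation disp := (@wp Rn.+1 Vn.+1 D world minv (queue_run) eq ext).

Lemma wp_assume_eq goal rely guar r d (Q : asrt) W rv vw :
  d <= D -> (rd rv r = d -> Q W rv vw) ->
  wp minv goal rely guar (assume_eq r d : cmd) Q W rv vw.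
Proof.
move=> Hd HQ; apply: wp_assume; rewrite eval_eq // => /eqP E.
by apply: HQ; rewrite -eval_reg E eval_const.
Qed.

Lemma wp_assume_same goal rely guar r r' (Q : asrt) W rv vw :
  (rd rv r = rd rv r' -> Q W rv vw) ->
  wp minv goal rely guar (assume_same r r' : cmd) Q W rv vw.
Proof.
move=> HQ; apply: wp_assume; rewrite eval_eq // => /eqP E.
by apply: HQ; rewrite -!eval_reg E.
Qed.

Definition frame (q : nat -> bool) rv vw rv' vw' :=
  (forall r, r <= Rn -> ~~ q r -> rd rv' r = rd rv r) /\
  (forall x, vt vw x <= vt vw' x).

Lemma frame_trans q rv1 vw1 rv2 vw2 rv3 vw3 :
  frame q rv1 vw1 rv2 vw2 -> frame q rv2 vw2 rv3 vw3 -> frame q rv1 vw1 rv3 vw3.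
Proof.
case=> H1 H2 [H3 H4]; split=> [r Hr Hq|x]; first by rewrite H3 // H1.
exact: leq_trans (H2 x) (H4 x).
Qed.

Lemma frame_load (q : nat -> bool) rv vw r d vw' : r <= Rn -> q r ->
  frame q rv vw (upd rv (inord r) d) (join vw vw').
Proof.
move=> Hr Hq; split=> [r' Hr' Hq'|x]; last by rewrite vt_join leq_maxl.
by rewrite rd_upd //; case: eqP => // E; rewrite E Hq in Hq'.
Qed.

Lemma env_assign r (e : expr) (Q : asrt) W rv vw :
  Q W (upd rv (inord r) (eval rv e)) vw -> envp (assign r e) Q W rv vw.
Proof. by []. Qed.

Lemma env_load x r (Q : asrt) W rv vw :
  (forall W' (d : data D) vw', ext W W' -> minv W' (inord x, d, vw') ->
     vt vw x <= vt vw' x -> Q W' (upd rv (inord r) d) (join vw vw')) ->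
  envp (load r x) Q W rv vw.
Proof. by []. Qed.

Lemma env_store x r (Q : asrt) W rv vw : x <= Vn ->
  (forall W' vw', ext W W' -> vt vw x < vt vw' x ->
     (forall y, y <= Vn -> y != x -> vt vw' y = vt vw y) ->
     minv W' (inord x, rv (inord r), vw') /\ Q W' rv vw') ->
  envp (store x r) Q W rv vw.
Proof.
move=> Hx HQ /= W' vw' HW Hlt Hne.
have [|H1 H2] := HQ W' vw' HW Hlt.
  by move=> y Hy ne; apply: Hne; rewrite inord_eq.
by exists W'.
Qed.

(* Reading the most significant bit first, the value assembled from successive
   rounds is at most the last round; reading the least significant bit first it
   is at least the first round.  The read in between is thus of round [v]. *)
Lemma env_exact v i r (Q : asrt) W0 rv0 vw0 :
  v < K -> N <= i <= N.+1 -> 3 <= r <= 4 ->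
  (forall j, j < N -> rd rv0 (rbit j) = bit v j) ->
  (forall W rv vw, ext W0 W -> wfW W -> v * L + i < size W ->
     rd rv r = wval W (v * L + i) ->
     frame (fun q => (q == rt) || (q == r)) rv0 vw0 rv vw -> Q W rv vw) ->
  envp (exact (ordv i) r) Q W0 rv0 vw0.
Proof.
move=> Hv Hi Hr Hb HQ; set q := fun _ => _ in HQ.
have qt : q rt by rewrite /q eqxx.
have qr : q r by rewrite /q eqxx orbT.
have qb j : ~~ q (rbit j) by rewrite /q /rbit /rt; lia.
have rtn : rt <= Rn by rewrite /rt /regmax; lia.
have rn : r <= Rn by rewrite /regmax; lia.
have iL : i < L by rewrite /rlen; lia.
have bn j : j < N -> rbit j <= Rn by rewrite /rbit /regmax; lia.
(* [rho] is the round of the last read. Reading against the order of writing matters here: a view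
   that covers position [L - j] of [rho] also covers the position below it, so the next read cannot
   fall behind [rho]. *)
pose I1 j W rv vw := exists rho,
  [/\ ext W0 W, frame q rv0 vw0 rv vw, v %/ 2 ^ (N - j) <= rho %/ 2 ^ (N - j)
    & if j == 0 then rho = 0 else [/\ wfW W, rho * L + (L - j) < size W & cov W rho (L - j) vw] ].
(* [rho1] is the round of the letter. From the least significant bit up no bound is available before
   all bits are read, so it is carried as an implication; its premise holds at [j = N], where both
   quotients vanish. *)
pose I2 rho1 j W rv vw := exists rho,
  [/\ [/\ ext W0 W, frame q rv0 vw0 rv vw & wfW W], v <= rho1,
      rho1 * L + i < size W /\ rd rv r = wval W (rho1 * L + i),
      rho * L + (N - j) < size W /\ cov W rho (N - j) vw
    & rho %/ 2 ^ j <= v %/ 2 ^ j -> rho1 <= v].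
rewrite /exact; apply: wp_seq; apply: (wp_mono (Q := I1 N)); last first.
  rewrite -[X in I1 X]add0n; apply: wp_seqs; last first.
    exists 0; split=> //; first exact: ext_refl.
    by rewrite subn0 !divn_small ?expn_gt0.
  move=> j W rv vw Hj [rho [HE HF Hp Hc]]; have jN : j < N by clear -Hj; lia.
  rewrite /check; apply: wp_seq; apply: env_load => W' d vw' HW' Hm Hle.
  have HE' := ext_trans HE HW'; rewrite regof_bitA //.
  apply: wp_assume_same; rewrite rd_upd // eqxx rd_upd ?bn //; last by clear -jN; lia.
  have -> /= : (rbit (N.-1 - j) == rt) = false by [].
  rewrite (proj1 HF) ?bn ?Hb //; [|by clear -jN; lia..] => Ed.
  have HL : L.-1 - j < L by clear; rewrite /rlen; lia.
  have HLs : L - j.+1 = L.-1 - j by clear; lia.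
  have HNs : N.-1 - j = N - j.+1 by clear; lia.
  have jn : N - j = (N - j.+1).+1 by clear -jN; lia.
  have [rho' [Hrr Hs' Ev Hc']] : exists rho', [/\ (rho %/ 2 ^ (N - j) <= rho' %/ 2 ^ (N - j))%N,
     rho' * L + (L.-1 - j) < size W', wval W' (rho' * L + (L.-1 - j)) = d
     & cov W' rho' (L.-1 - j) (join vw vw')].
    (* Nothing is covered before the first read, but the initial message fails the comparison, since
       its value 2 is no bit. *)
    case: (posnP j) => [j0|j0].
      case: (read_dis0 vw HL Hm) => [[Ed2 _]|[rho' [H1 H2 _ H3]]].
        by move: Ed; rewrite Ed2 /bit; case: odd.
      by exists rho'; split=> //; move: Hc; rewrite j0 /= => ->; rewrite div0n.
    move: Hc; rewrite eqn0Ngt j0 /= => -[wf Hs Hcv].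
    have Hs2 := leq_trans Hs (ext_size HW').
    have [||rho' [H0 H1 H2 H3]] := read_dis (r := rho) HL Hm _ _ Hle.
    - by apply: leq_ltn_trans Hs2; rewrite leq_add2l -HLs leq_sub2l.
    - apply: (cov_le (i := L - j)); first by rewrite -HLs leq_sub2l.
      exact: cov_ext HW' Hs (fun _ => leqnn _) Hcv.
    - by exists rho'; split=> //; apply: leq_div2r.
  exists rho'; split=> //.
  - by apply: frame_trans HF _; apply: frame_load.
  - rewrite (divn_bit v) (divn_bit rho') -jn.
    have -> : bit rho' (N - j.+1) = bit v (N.-1 - j).
      have [_ _ _ Hbw] : wfW W' by case: Hm.
      rewrite -Ed -Ev (Hbw _ _ (N - j.+1)) // regof_bitA // HNs //.
    rewrite HNs.
    by rewrite leq_add2r leq_mul2l (leq_trans Hp Hrr) orbT.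
  - by split; [case: Hm|rewrite HLs..].
move=> W rv vw [rho [HE HF Hp Hc]].
have N0 : (N == 0) = false by rewrite /nbits; lia.
move: Hc; rewrite N0 => -[wf Hs Hcv].
rewrite subnn !divn1 in Hp.
have HLN : i <= L - N by clear -Hi; rewrite /rlen; lia.
apply: wp_seq; apply: env_load => W1 d vw' HW1 Hm Hle.
have Hs1 : rho * L + i < size W1 by apply: leq_trans (ext_size HW1); apply: leq_ltn_trans Hs; rewrite leq_add2l.
have Hc1 : cov W1 rho i vw.
  by apply: (cov_le HLN); apply: cov_ext HW1 Hs _ Hcv.
have [rho1 [Hr1 Hs2 Ed Hc2]] := read_dis iL Hm Hs1 Hc1 Hle.
have wf1 : wfW W1 by case: Hm.
apply: (wp_mono (Q := I2 rho1 N)); last first.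
  rewrite -[X in I2 rho1 X]add0n; apply: wp_seqs; last first.
    exists rho1; split=> //.
    - split=> //; first exact: ext_trans HE HW1.
      by apply: frame_trans HF _; apply: frame_load.
    - exact: leq_trans Hp Hr1.
    - by split=> //; rewrite rd_upd // eqxx.
    - have HNi : N - 0 <= i by rewrite subn0; case/andP: Hi.
      split; last exact: cov_le HNi Hc2.
      by apply: leq_ltn_trans Hs2; rewrite leq_add2l.
    - by rewrite !divn1.
  move=> j W2 rv2 vw2 Hj [rho2 [[HE2 HF2 wf2] Hv1 [Hs3 Er] [Hs4 Hc4] Himp]].
  have jN : j < N by clear -Hj; lia.
  rewrite /check; apply: wp_seq; apply: env_load => W3 d3 vw3 HW3 Hm3 Hle3.
  rewrite regof_bitB //.
  apply: wp_assume_same; rewrite rd_upd // eqxx rd_upd ?bn //.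
  have -> /= : (rbit j == rt) = false by [].
  rewrite (proj1 HF2) ?bn ?Hb // => Ed3.
  have HNs : N - j.+1 = N.-1 - j by clear; lia.
  have HNj : N.-1 - j < L by clear; rewrite /rlen; lia.
  have wf3 : wfW W3 by case: Hm3.
  have HNj' : N.-1 - j <= N - j by clear; lia.
  have [||rho3 [H0 H1 H2 H3]] := read_dis (r := rho2) HNj Hm3 _ _ Hle3.
  - by apply: leq_ltn_trans (leq_trans Hs4 (ext_size HW3)); rewrite leq_add2l.
  - by apply: (cov_le HNj'); apply: cov_ext HW3 Hs4 _ Hc4.
  exists rho3; split=> //.
  - split=> //; first exact: ext_trans HE2 HW3.
    by apply: frame_trans HF2 _; apply: frame_load.
  - have [_ -> _] := ext_nth HW3 Hs3; split; first exact: leq_trans Hs3 (ext_size HW3).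
    by rewrite rd_upd // -Er; case: eqP => // E; move: Hr; rewrite E.
  - by rewrite HNs.
  - move=> Hle4; apply: Himp; apply: leq_trans (leq_div2r _ H0) _.
    rewrite (divn_bit v) (divn_bit rho3).
    have [_ _ _ Hbw] := wf3.
    have <- : bit rho3 j = bit v j by rewrite -Ed3 -H2 (Hbw _ _ j) // regof_bitB.
    by rewrite leq_add2r leq_mul2l Hle4 orbT.
move=> W2 rv2 vw2 [rho2 [[HE2 HF2 wf2] Hv1 [Hs3 Er] [Hs4 Hc4] Himp]].
have [Ks _ _ _] := wf2.
have rK : rho2 < K.
  by rewrite -(ltn_pmul2r rlen_gt0); apply: leq_trans Ks; apply: leq_ltn_trans Hs4; apply: leq_addr.
have E : rho1 = v.
  by apply/eqP; rewrite eqn_leq Hv1 Himp // divn_small.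
by rewrite E in Hs3 Er; apply: HQ HE2 wf2 Hs3 Er HF2.
Qed.

Lemma minv_rail W j b (d : data D) vw :
  wfW W -> j < N -> b <= 1 -> nat_of_ord d = 0 -> minv W (inord (vrail j b), d, vw).
Proof.
move=> wf Hj Hb Hd; split=> //=.
- by move=> i Hi; rewrite inordK ?ltnS ?vrail_le // => /esym /(ordv_rail Hi Hb).
- by move=> j' b' _ _ _; rewrite Hd.
- by move=> j' Hj'; rewrite inordK ?ltnS ?vrail_le // /vrail /vF; lia.
Qed.

Lemma minv_F W j (d : data D) vw :
  wfW W -> j <= N -> certF W j d vw -> minv W (inord (vF j), d, vw).
Proof.
move=> wf Hj Hc; split=> //=.
- by move=> i Hi; rewrite inordK ?ltnS ?vF_le // => /esym /(ordv_F Hi).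
- by move=> j' b' H1 H2; rewrite inordK ?ltnS ?vF_le // /vrail /vF; lia.
- move=> j' Hj'; rewrite inordK ?ltnS ?vF_le // => E _.
  by have <- : j = j' by move: E; rewrite /vF; lia.
Qed.

Lemma minvF W j (d : data D) vw : j <= N -> minv W (inord (vF j), d, vw) ->
  wfW W /\ (nat_of_ord d <= 1 -> certF W j d vw).
Proof.
move=> Hj [wf _ _ /(_ j Hj) H]; split=> //; apply: H.
by rewrite /= inordK ?ltnS ?vF_le.
Qed.

Lemma minvR W j b (d : data D) vw : j < N -> b <= 1 ->
  minv W (inord (vrail j b), d, vw) -> nat_of_ord d = 2 -> vt vw (vrail j b) = 0.
Proof.
move=> Hj Hb [_ _ H _]; have := H j b Hj Hb.
by rewrite /= inordK ?ltnS ?vrail_le //; apply.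
Qed.

(** Take an index with bit [j] equal to [b] whose own rails above level [j] are at 0 in the stored
    view. Its rail at level [j] is at 0 too, because the initial message of that rail was still
    readable; so one of the two results that were read vouches for it. *)
Lemma env_node j W rv vw : j < N -> envp (node j) (fun _ _ _ => True) W rv vw.
Proof.
move=> Hj; have rtn : rt <= Rn by rewrite /rt /regmax; lia.
rewrite /node; apply: wp_seq; apply: env_load => W1 d1 vw1 _ /(minvF Hj) [wf1 c1] _.
apply: wp_seq; apply: wp_assume_eq => //; rewrite rd_upd // eqxx => E1.
apply: wp_seq; apply: env_load => W2 d2 vw2 HE2 /(minvF Hj) [_ c2] _.
apply: wp_seq; apply: wp_assume_eq; first by lia.
rewrite rd_upd // eqxx => E2.
have wf2 := ext_wf HE2 wf1.
rewrite E1 in c1; rewrite E2 in c2.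
have {}c2 := c2 isT; have {}c1 := c1 isT.
set rv2 := upd _ _ d2; set vw3 := join _ vw2.
have main b : b <= 1 -> envp (nodeb j b) (fun _ _ _ => True) W2 rv2 vw3.
  move=> Hb; rewrite /nodeb; apply: wp_seq; apply: env_load => W4 d4 vw4 HE4 /(minvR Hj Hb) Hrail Hle.
  apply: wp_seq; apply: wp_assume_eq => //; rewrite rd_upd // eqxx => E4.
  have {}Hrail := Hrail E4.
  apply: wp_seq; apply env_assign.
  apply: env_store; first by rewrite vF_le // ltnW.
  move=> W5 vw5 HE5 Hlt Hne; split=> //.
  have HE45 := ext_trans HE4 HE5.
  apply: minv_F; [exact: ext_wf HE45 wf2|exact: ltnW|].
  rewrite -/(rd _ rt) rd_upd // eqxx eval_const; last by lia.
  move=> v Hv Eb Hu.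
  have Hr u : u < j.+1 -> vt vw1 (vrail u (bit v u)) = 0 /\ vt vw2 (vrail u (bit v u)) = 0.
    move=> Hju; suff : vt vw3 (vrail u (bit v u)) = 0.
      by rewrite /vw3 !vt_join; lia.
    case: (ltngtP u j) => Huj; last first.
    - by rewrite Huj Eb; move: Hle; rewrite Hrail; lia.
    - by lia.
    - have := Hu u Huj; rewrite Hne ?vt_join; first by lia.
        by rewrite vrail_le ?bit_le1 //; lia.
      by rewrite /vrail /vF; have := bit_le1 v u; lia.
  (* Bit [j + 1] of the index selects the result that covers it. *)
  case E: (bit v j.+1) (bit_le1 v j.+1) => [|[|//]] _.
  - apply: good_ext (ext_trans HE2 HE45) _; apply: c1 => // u Hu'.
    by case: (Hr u Hu').
  - apply: good_ext HE45 _; apply: c2 => // u Hu'.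
    by case: (Hr u Hu').
by apply: wp_choice; apply: main.
Qed.

Lemma env_leaf W : wfW W ->
  envp (leaf) (fun _ _ _ => True) W [ffun=> ord0] [ffun=> 0].
Proof.
move=> wf0; have N1 : 1 < N by rewrite /nbits; lia.
have rb j r : r < 6 -> (rbit j == r) = false by rewrite /rbit; lia.
pose G j W rv vw := [/\ wfW W, rd rv rcarry = 0
  & forall u, u < j -> rd rv (rbit u) <= 1 /\ 0 < vt vw (vrail u (1 - rd rv (rbit u)))].
rewrite /leaf; apply: wp_seq.
apply: (wp_mono (Q := G N)); last first.
  rewrite -[X in G X]add0n; apply: wp_seqs; last by split=> //; rewrite rd0.
  move=> j W1 rv vw Hj [wf1 E0 Hu]; have jN : j < N by lia.
  have main b : b <= 1 -> envp (Seq (assign (rbit j) (econst b)) (store (vrail j (1 - b)) rcarry))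
     (G j.+1) W1 rv vw.
    move=> Hb; apply: wp_seq; apply env_assign.
    apply: env_store => [|W2 vw2 HE Hlt Hne]; first by rewrite vrail_le // leq_subr.
    have c0 : rd (upd rv (inord (rbit j)) (eval rv (econst b))) rcarry = 0.
      by rewrite rd_upd ?rbit_le ?reg_small // eq_sym rb.
    have wf2 := ext_wf HE wf1.
    split; first by apply: (minv_rail _ wf2 jN _ c0); exact: leq_subr.
    split=> // u; rewrite ltnS leq_eqVlt => /orP [/eqP ->|Huj].
      by rewrite rd_upd ?rbit_le // eqxx eval_const; [split=> //; lia|lia].
    have [H1 H2] := Hu u Huj; rewrite rd_upd ?rbit_le //; last by lia.
    have -> : (rbit u == rbit j) = false by rewrite /rbit; lia.
    rewrite Hne ?vrail_le //; first by lia.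
    - lia.
    - by rewrite /vrail; lia.
  by apply: wp_choice; [apply: (main 0) | apply: (main 1)].
move=> {wf0} {}W rv vw [wf _ Hu].
have [v [Hv Hb]] := bits_exist (fun u Hu' => proj1 (Hu u Hu')).
have Hrail u : u < N -> 0 < vt vw (vrail u (1 - bit v u)).
  by move=> Hu'; rewrite Hb //; case: (Hu u Hu').
have {Hu} Hb u : u < N -> rd rv (rbit u) = bit v u by move=> Hu'; rewrite Hb.
apply: wp_seq; apply env_assign; set rv1 := upd _ _ _.
have Hb1 u : u < N -> rd rv1 (rbit u) = bit v u.
  by move=> Hu'; rewrite rd_upd ?rbit_le ?reg_small // rb // Hb.
have Ef : rd rv1 rflag = bit v N.-1.
  by rewrite rd_upd ?reg_small // eqxx eval_reg Hb //; lia.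
have Ez : vz = ordv N.+1 by rewrite ordvN.
have Ey : vy = ordv N by rewrite ordvN.
apply: wp_seq; rewrite {1}Ez; apply: (env_exact Hv) => //; first by lia.
move=> W1 rv2 vw2 HE1 wf1 Hs1 Er1 HF1.
apply: wp_seq; apply env_assign; set rv3 := upd _ _ _.
have H3 r : r <= Rn -> r != 0 -> r != 4 -> r != 5 -> rd rv3 r = rd rv1 r.
  move=> Hr n0 n4 n5; rewrite rd_upd //= (negPf n0); apply: (proj1 HF1) => //.
  by rewrite negb_or n5.
(* Adding [P = 2 ^ m] is an increment that starts at bit [m], with the bits below unchanged. *)
have I0 : inc_inv rv3 (v + P) v m rv3.
  split=> //; last first.
    rewrite rd_upd //= inordK; last by lia.
    by split=> //; rewrite divnDr ?divnn ?expn_gt0 //.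
  move=> i Hi; rewrite H3 ?rbit_le // Hb1 //.
  by case: ifP => // Him; rewrite bit_addP.
apply: wp_seq; apply: (wp_mono (Q := fun W rv vw => [/\ W = W1, vw = vw2 & inc_inv rv3 (v + P) v (m + m) rv])); last first.
  apply: (@wp_seqs _ _ _ _ _ _ _ _ _ (fun j W rv vw => [/\ W = W1, vw = vw2 & inc_inv rv3 (v + P) v j rv])) => //.
  move=> j W' rv' vw' Hj [-> -> HI]; apply: wp_seq; apply env_assign; apply env_assign; split=> //.
  by apply: inc_regP => //; move: Hj => /andP [].
move=> _ rv4 _ [-> -> [Hb4 [Hc4 Hd4] Hr4]].
have vsm : v %/ 2 ^ (m + m) = 0 by rewrite divn_small.
rewrite vsm add0n in Hd4.
have Ef4 : rd rv4 rflag = bit v N.-1.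
  by rewrite Hr4 // H3 ?reg_small.
have Erz4 : rd rv4 rz = wval W1 (v * L + N.+1).
  by rewrite Hr4 // rd_upd ?reg_small //= -Er1.
(* The advanced rails fix all bits below [N - 1], and the stored value is bit [N - 1]; so [v] is the
   only index for which this message vouches. *)
have final W5 rv5 vw5 : ext W1 W5 -> frame (fun q => (q == rt) || (q == ry)) rv4 vw2 rv5 vw5 -> good W5 v ->
    envp (store (vF N.-1) rflag) (fun _ _ _ => True) W5 rv5 vw5.
  move=> HE5 HF5 Hg; apply: env_store => [|W6 vw6 HE6 Hlt Hne]; first by rewrite vF_le //; lia.
  split=> //; apply: minv_F; [exact: ext_wf (ext_trans HE5 HE6) wf1|lia|].
  rewrite -/(rd _ rflag) (proj1 HF5) ?reg_small // Ef4 => v' Hv' Eb Hru.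
  suff -> : v' = v by apply: good_ext HE6 Hg.
  apply: (bits_inj Hv' Hv) => u Hu.
  case: (ltngtP u N.-1) => Hun; [|lia|by rewrite Hun].
  have := Hru u Hun; rewrite Hne ?vrail_le ?bit_le1 //; last first.
    by rewrite /vrail /vF; have := bit_le1 v' u; lia.
  have : 0 < vt vw5 (vrail u (1 - bit v u)).
    by apply: leq_trans (proj2 HF5 _); apply: leq_trans (proj2 HF1 _); apply: Hrail.
  have := bit_le1 v u; have := bit_le1 v' u.
  by case: (bit v u) => [|[|//]]; case: (bit v' u) => [|[|//]] _ _;
    rewrite ?subn0 ?subnn; lia.
apply: wp_seq; apply: wp_choice.
  apply: wp_assume_eq => [|E]; first by lia.
  apply: final => //; first exact: ext_refl.
  rewrite E in Hd4; move=> Hlt; move: Hd4; rewrite divn_small //.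
apply: wp_seq; apply: wp_assume_eq => // E; rewrite E in Hd4.
have HvP : v + P < K.
  by move: (Hd4) => /eqP; rewrite -leqn0 leqNgt divn_gt0 ?expn_gt0 // -ltnNge.
apply: wp_seq; rewrite {1}Ey; apply: (env_exact HvP) => //; first by lia.
  by move=> j Hj; rewrite Hb4 // Hj.
move=> W5 rv5 vw5 HE5 wf5 Hs5 Er5 HF5.
apply: wp_assume_same => Eyz; apply: (final _ _ _ HE5 HF5) => _; split=> //.
rewrite -Er5 Eyz (proj1 HF5) ?reg_small // Erz4.
by have [_ -> _] := ext_nth HE5 Hs1.
Qed.

Lemma env_wp : envp (cenv_sys) (fun _ _ _ => True) [::] [ffun=> ord0] [ffun=> 0].
Proof.
have wf0 : wfW [::] by split.
apply: wp_choice; first exact: env_leaf.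
rewrite /chs; apply: wp_chs.
  move=> rv; apply/val_inj; rewrite /= inordK //.
move=> i; rewrite size_iota => Hi d0; rewrite nth_iota //.
exact: env_node.
Qed.

Definition covall W vw :=
  forall k, k < size W -> wts W k <= vt vw (wvar W k).

Lemma nth_rconsW W x k :
  [/\ k < size W -> [/\ wvar (rcons W x) k = wvar W k, wval (rcons W x) k = wval W k
                      & wts (rcons W x) k = wts W k],
      wvar (rcons W x) (size W) = x.1.1, wval (rcons W x) (size W) = x.1.2
    & wts (rcons W x) (size W) = x.2].
Proof.
rewrite /wvar /wval /wts !nth_rcons ltnn eqxx.
by split=> // Hk; rewrite Hk.
Qed.

(** The writer's view covers the whole log, so a timestamp above it exceeds all earlier ones on the
    same variable. *)
Lemma wfW_rcons W r i (d : nat) vw vw' :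
  wfW W -> size W = r * L + i -> r < K -> i < L -> covall W vw ->
  (forall j, regof i = rbit j -> d = bit r j) ->
  vt vw (ordv i) < vt vw' (ordv i) ->
  wfW (rcons W (ordv i, d, vt vw' (ordv i))).
Proof.
set x := (_, _, _); case=> w1 w2 w3 w4 Hs Hr Hi Hc Hd Hlt.
have Em : size W %% L = i by rewrite Hs modnMDl modn_small.
split.
- by rewrite size_rcons Hs; clear - Hr Hi; nia.
- move=> k; rewrite size_rcons ltnS leq_eqVlt => /orP [/eqP ->|Hk].
    have [_ -> _ ->] := nth_rconsW W x 0; rewrite Em; split=> //=.
    exact: leq_ltn_trans Hlt.
  by have [/(_ Hk) [-> _ ->] _ _ _] := nth_rconsW W x k; apply: w2.
- move=> k k' Hkk; rewrite size_rcons ltnS leq_eqVlt => /orP [/eqP E|Hk'].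
    rewrite E in Hkk *; have [/(_ Hkk) [-> _ ->] -> _ ->] := nth_rconsW W x k.
    by rewrite /= => Ek; apply: leq_ltn_trans Hlt; rewrite -Ek; apply: Hc.
  have [/(_ Hk') [-> _ ->] _ _ _] := nth_rconsW W x k'.
  have [/(_ (ltn_trans Hkk Hk')) [-> _ ->] _ _ _] := nth_rconsW W x k.
  exact: w3.
- move=> r0 i0 j; rewrite size_rcons ltnS leq_eqVlt => /orP [/eqP E|Hk] Hi0 Er.
    have Ei : i0 = i by rewrite -Em -E modnMDl modn_small.
    have Err : r0 = r.
      apply/eqP; rewrite -(eqn_pmul2r rlen_gt0); apply/eqP.
      by move: E; rewrite Hs Ei => /addIn.
    rewrite E; have [_ _ -> _] := nth_rconsW W x 0.
    by rewrite /= Err; apply: Hd; rewrite -Ei.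
  have [/(_ Hk) [_ -> _] _ _ _] := nth_rconsW W x (r0 * L + i0).
  exact: w4.
Qed.

Lemma minv_dis W i (d : data D) vw vw' :
  let W' := rcons W (ordv i, nat_of_ord d, vt vw' (ordv i)) in
  wfW W' -> i < L -> covall W vw -> (forall x, vt vw x <= vt vw' x) ->
  minv W' (inord (ordv i), d, vw') /\ covall W' vw'.
Proof.
move=> W' wf Hi Hc Hle.
have Ex : nat_of_ord (inord (ordv i) : 'I_Vn.+1) = ordv i.
  by rewrite inordK // ltnS ordv_le.
have Hc' : covall W' vw'.
  move=> k; rewrite size_rcons ltnS leq_eqVlt => /orP [/eqP ->|Hk].
    by have [_ -> _ ->] := nth_rconsW W (ordv i, nat_of_ord d, vt vw' (ordv i)) 0.
  have [/(_ Hk) [-> _ ->] _ _ _] := nth_rconsW W (ordv i, nat_of_ord d, vt vw' (ordv i)) k.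
  by apply: leq_trans (Hle _); apply: Hc.
split=> //; split=> //=; rewrite Ex.
- move=> i' Hi' E; right; exists (size W).
  have [_ E1 E2 E3] := nth_rconsW W (ordv i, nat_of_ord d, vt vw' (ordv i)) 0.
  split=> //; first by rewrite size_rcons.
  by move=> k' Hk'; apply: Hc'; rewrite size_rcons ltnS.
- by move=> j b _ Hb /(ordv_rail Hi Hb).
- by move=> j _ /(ordv_F Hi).
Qed.

Lemma ext_rcons W x : wfW (rcons W x) -> ext W (rcons W x).
Proof. by move=> H; exists [:: x]; rewrite ?cats1. Qed.

Lemma dis_assign r (e : expr) (Q : asrt) W rv vw :
  Q W (upd rv (inord r) (eval rv e)) vw -> disp (assign r e) Q W rv vw.
Proof. by []. Qed.

Lemma dis_load x r (Q : asrt) W rv vw :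
  (forall (d : data D) vw', minv W (inord x, d, vw') ->
     Q W (upd rv (inord r) d) (join vw vw')) ->
  disp (load r x) Q W rv vw.
Proof. by move=> H /= W' d vw' <- Hm _; apply: H. Qed.

Lemma dis_round W0 r (rv0 : regval) vw0 (Q : asrt) :
  wfW W0 -> size W0 = r * L -> r < K -> covall W0 vw0 ->
  (forall i, i < N -> rd rv0 (rbit i) = bit r i) ->
  (forall W vw, ext W0 W -> wfW W -> size W = r.+1 * L -> covall W vw ->
     wval W (r * L + N) = rd rv0 ry -> wval W (r * L + N.+1) = rd rv0 rz ->
     Q W rv0 vw) ->
  disp (round) Q W0 rv0 vw0.
Proof.
move=> wf0 Hs0 Hr Hc0 Hb HQ.
pose I i W rv vw :=
  [/\ rv = rv0, ext W0 W, wfW W /\ covall W vw, size W = r * L + i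
    & forall i', i' < i -> wval W (r * L + i') = rd rv0 (regof i')].
rewrite /round; apply: (wp_mono (Q := I L)).
  move=> W rv vw [-> HE [wf Hc] Hs Hv]; apply: HQ => //.
  - by rewrite Hs mulSn addnC.
  - by rewrite Hv ?regofN //; apply: ltn_trans N_lt_L.
  - by rewrite Hv ?N_lt_L // regofN.
rewrite -[X in I X]add0n; apply: wp_seqs; last first.
  by split=> //; [exact: ext_refl|rewrite addn0].
move=> i W rv vw /andP [_ Hi] [-> HE [wf Hc] Hs Hv] _ vw' <- Hlt Hne.
rewrite add0n in Hi.
have Hxle := ordv_le Hi; have Hrle := regof_le Hi.
have Hle x : vt vw x <= vt vw' x.
  rewrite /vt; case: (eqVneq (inord x : 'I_Vn.+1) (inord (ordv i))) => [->|/Hne ->] //.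
  exact: ltnW.
have wf' : wfW (rcons W (ordv i, rd rv0 (regof i), vt vw' (ordv i))).
  apply: (wfW_rcons (r := r) (vw := vw)) => // j Ej.
  have [[E1|E1]|[j' Hj' Ej']] : (i = N \/ i = N.+1) \/ exists2 j', j' < N & regof i = rbit j'.
  - case: (eqVneq i N) => [|n1]; first by left; left.
    case: (eqVneq i N.+1) => [|n2]; first by left; right.
    by right; apply: regofE.
  - by move: Ej; rewrite E1 regofN.
  - by move: Ej; rewrite E1 regofN.
  - rewrite Ej' Hb //; congr bit; move: Ej; rewrite Ej'; exact: addnI.
have [Hm Hc'] := minv_dis wf' Hi Hc Hle.
exists (rcons W (ordv i, rd rv0 (regof i), vt vw' (ordv i))); split=> //.
- exact: ext_rcons.
- split=> //; first exact: ext_trans HE (ext_rcons wf').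
    by rewrite size_rcons Hs addnS.
  move=> i'; rewrite ltnS leq_eqVlt => /orP [/eqP ->|Hi'].
    by rewrite -Hs; case: (nth_rconsW W (ordv i, rd rv0 (regof i), vt vw' (ordv i)) 0).
  have Hlt' : r * L + i' < size W by rewrite Hs ltn_add2l.
  have [/(_ Hlt') [_ -> _] _ _ _] := nth_rconsW W (ordv i, rd rv0 (regof i), vt vw' (ordv i)) (r * L + i').
  exact: Hv.
Qed.

(** The letters of the run are recovered from the log. The control states are never stored, so their
    history [sg] is part of the invariant. *)
Definition dis_inv W rv vw : Prop :=
  exists r (sg : nat -> nat),
  [/\ r <= K /\ size W = r * L, wfW W /\ covall W vw,
      forall i, i < N -> rd rv (rbit i) = bit r i,
      rd rv rcarry = (r == K) /\ rd rv rflag = flag r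
    & [/\ sg 0 = 0, sg r = rd rv rstate & forall i, i < r ->
       (flag i, sg i, wval W (i * L + N), wval W (i * L + N.+1), sg i.+1) \in Delta]].

Lemma dis_incs (lo n r : nat) rv (Q : asrt) W vw :
  lo + n <= N -> inc_inv rv r.+1 r lo rv ->
  (forall rv', inc_inv rv r.+1 r (lo + n) rv' -> Q W rv' vw) ->
  disp (seqs [seq inc j | j <- iota lo n]) Q W rv vw.
Proof.
move=> Hn I0 HQ.
apply: (wp_mono (Q := fun W' rv' vw' => [/\ W' = W, vw' = vw & inc_inv rv r.+1 r (lo + n) rv'])).
  by move=> _ rv' _ [-> -> H]; apply: HQ.
apply: (@wp_seqs _ _ _ _ _ _ _ _ _ (fun j W' rv' vw' => [/\ W' = W, vw' = vw & inc_inv rv r.+1 r j rv'])) => //.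
move=> j W' rv' vw' /andP [_ Hj] [-> -> HI].
apply: wp_seq; apply dis_assign; apply dis_assign; split=> //.
by apply: inc_regP => //; apply: leq_trans Hj Hn.
Qed.

Lemma dis_body W rv vw :
  dis_inv W rv vw -> disp body dis_inv W rv vw.
Proof.
case=> r [sg [[HrK Hs] [wf Hc] Hb [Ec Ef] [sg0 sgr Hsg]]].
rewrite /body; apply: wp_seq; apply: wp_assume_eq => // Ec0.
have {}HrK : r < K.
  by rewrite ltn_neqAle HrK andbT; move: Ec; rewrite Ec0; case: eqP.
pose A1 (W' : world) rv' vw' := [/\ W' = W, vw' = vw,
  forall i, i < N -> rd rv' (rbit i) = bit r i
  & (flag r, sg r, rd rv' ry, rd rv' rz, rd rv' rstate) \in Delta].
apply: wp_seq; apply: (wp_mono (Q := A1)); last first.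
  rewrite /chs; apply: wp_chs.
    by move=> rv'; apply/val_inj; rewrite /= inordK.
  move=> i Hi d0; have := mem_nth d0 Hi.
  case: (nth d0 Delta i) => [[[[x s] o] w] s'] Hin.
  have [x1 sD oD wD s'D] := Delta_le Hin.
  apply: wp_seq; apply: wp_assume_eq => [|E1]; first exact: leq_trans x1 (ltnW D_ge2).
  apply: wp_seq; apply: wp_assume_eq => // E2.
  apply: wp_seq; apply dis_assign; apply: wp_seq; apply dis_assign; apply dis_assign.
  split=> //.
    by move=> j Hj; rewrite !rd_bit // Hb.
  by rewrite !rd_upd ?reg_small //= !inordK ?ltnS // -Ef E1 sgr E2.
move=> _ {Hb Ec Ef Ec0 sgr} rv1 _ [-> -> Hb HD].
apply: wp_seq; apply: (dis_round wf Hs HrK Hc Hb) => W2 vw2 HE2 wf2 Hs2 Hc2 Ey Ez.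
apply: wp_seq; apply dis_assign; set rv2 := upd _ _ _.
have I0 : inc_inv rv2 r.+1 r 0 rv2.
  split=> //; last first.
    by rewrite rd_upd // eqxx eval_const ?(ltnW D_ge2) // !divn1 addn1.
  by move=> i Hi /=; rewrite rd_bit // Hb.
have mN : 0 + m <= N by rewrite /nbits leq_addr.
apply: wp_seq; apply: (dis_incs mN I0) => rv3 [Hb3 [Hc3 Hd3] Hr3]; rewrite add0n in Hb3 Hd3.
apply: wp_seq; apply dis_assign; set rv4 := upd _ _ _.
have I4 : inc_inv rv4 r.+1 r m rv4.
  split=> //; last by rewrite rd_upd ?reg_small.
  by move=> i Hi /=; rewrite rd_bit // Hb3.
have mmN : m + m <= N by [].
apply: (dis_incs mmN I4) => rv5 [Hb5 [Hc5 Hd5] Hr5].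
have Est : rd rv5 rstate = rd rv1 rstate.
  by rewrite Hr5 // rd_upd ?reg_small //= Hr3 // rd_upd ?reg_small.
exists r.+1, (fun i => if i == r.+1 then rd rv5 rstate else sg i); split=> //.
- by move=> i Hi; rewrite Hb5 // Hi.
(* Both carries are divisibility statements about [r + 1], by [2 ^ m] for the flag and by [K] for
   the end; as [r < K], the latter forces [r + 1 = K]. *)
- rewrite (carry_dvd Hd5) Hr5 // rd_upd ?reg_small //= eval_reg (carry_dvd Hd3).
  split=> //; congr nat_of_bool; rewrite -/K; apply/idP/eqP => [|->] //.
  by move/dvdn_leq => /(_ isT) H; apply/eqP; rewrite eqn_leq HrK H.
- rewrite eqxx; split=> // i; rewrite ltnS leq_eqVlt => /orP [/eqP ->|Hi].
    by rewrite eqxx (ltn_eqF (leqnn _)) Ey Ez Est.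
  rewrite (ltn_eqF (leq_trans Hi (leqnSn r))) eqSS (ltn_eqF Hi).
  have Hlt : i * L + N.+1 < size W.
    have := N_lt_L; rewrite Hs; move: Hi; clear; nia.
  have [_ -> _] := ext_nth HE2 Hlt.
  have Hlt2 : i * L + N < size W by apply: leq_ltn_trans Hlt; rewrite leq_add2l.
  have [_ -> _] := ext_nth HE2 Hlt2.
  exact: Hsg.
Qed.

Lemma dis_wp : disp cdis_sys (fun _ _ _ => True) [::] [ffun=> ord0] [ffun=> 0].
Proof.
rewrite /cdis_sys; apply: wp_seq; exists dis_inv; split.
- by move=> W W' rv vw <-.
- exists 0, (fun _ => 0); split=> //.
  + by move=> i Hi; rewrite rd0 /bit div0n.
  + by rewrite !rd0 /horizon eq_sym expn_eq0.
  + by split=> //; rewrite rd0.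
- exact: dis_body.
move=> W rv vw [r [sg [[HrK Hs] [wf Hc] Hb [Ec Ef] [sg0 sgr Hsg]]]].
apply: wp_seq; apply: wp_assume_eq => [|Ec1]; first exact: ltnW.
have {HrK} Er : r = K by move: Ec; rewrite Ec1; case: eqP.
subst r.
apply: wp_seq; apply: wp_assume_eq => // Eacc.
apply: wp_seq; apply: dis_load => d1 vw1 /(minvF (leq0n _)) [_ c1].
apply: wp_seq; apply: wp_assume_eq => //; rewrite rd_upd ?reg_small // eqxx => E1.
apply: wp_seq; apply: dis_load => d2 vw2 /(minvF (leq0n _)) [_ c2].
apply: wp_seq; apply: wp_assume_eq => [|]; first exact: ltnW.
rewrite rd_upd ?reg_small // eqxx => E2.
rewrite E1 in c1; rewrite E2 in c2.
exists sg, (fun i => wval W (i * L + N)), (fun i => wval W (i * L + N.+1)).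
split=> //; first by rewrite sgr.
move=> i Hi; have Hi' : i < K by apply: leq_ltn_trans Hi; apply: leq_addr.
(* At level 0 there is no condition on rails, so the two results together cover every index. *)
suff Hg : good W i by case: (Hg Hi).
by case E: (bit i 0) (bit_le1 i 0) => [|[|//]] _; [apply: c1|apply: c2].
Qed.

Lemma sys_sound : unsafe sys -> queue_run.
Proof.
apply: (unsafe_wp ext_refl ext_trans minv_ext minv0 dis_wp env_wp).
Qed.

(** * Completeness of the system *)

Lemma can_assume_eq r d (Q : post) M rv vw :
  rd rv r = d -> Q M rv vw -> can (assume_eq r d) Q M rv vw.
Proof.
move=> Hd HQ; apply: can_assume => //; rewrite eval_eq //; apply/eqP/val_inj.
by rewrite /= -/(rd rv r) Hd inordK // ltnS -Hd rd_le.
Qed.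

Lemma can_assume_same r r' (Q : post) M rv vw :
  rd rv r = rd rv r' -> Q M rv vw -> can (assume_same r r') Q M rv vw.
Proof.
move=> Hd HQ; apply: can_assume => //; rewrite eval_eq //; apply/eqP/val_inj.
by rewrite /= -/(rd rv r) Hd.
Qed.

Lemma can_sassign r (e : expr) (Q : post) M rv vw :
  Q M (upd rv (inord r) (eval rv e)) vw -> can (assign r e) Q M rv vw.
Proof. exact: can_assign. Qed.

Lemma can_sload r x (d : data D) vw' (Q : post) M rv vw :
  (inord x, d, vw') \in M -> vt vw x <= vt vw' x ->
  Q M (upd rv (inord r) d) (join vw vw') -> can (load r x) Q M rv vw.
Proof. exact: can_load. Qed.

Lemma can_sstore x r n (Q : post) M rv vw :
  vt vw x < n -> (forall mm, mm \in M -> vt mm.2 x < n) ->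
  Q ((inord x, rv (inord r), upd vw (inord x) n) |` M)%fset rv (upd vw (inord x) n) ->
  can (store x r) Q M rv vw.
Proof.
by move=> Hv HM HQ; apply: (can_store (n := n)) => // mm Hin _; apply: HM.
Qed.

Lemma fresh M vw x :
  exists n, vt vw x < n /\ forall mm, mm \in M -> vt mm.2 x < n.
Proof.
exists (maxn (vt vw x) (\max_(mm <- M) vt mm.2 x)).+1.
split=> [|mm Hin]; rewrite ltnS leq_max ?leqnn //; apply/orP; right.
exact: (leq_bigmax_seq (F := fun mm : message => vt mm.2 x) mm Hin).
Qed.

Lemma can_incs (lo n u v : nat) M rv vw (Q : post) :
  lo + n <= N -> inc_inv rv u v lo rv ->
  (forall rv', inc_inv rv u v (lo + n) rv' -> Q M rv' vw) ->
  can (seqs [seq inc j | j <- iota lo n]) Q M rv vw.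
Proof.
move=> Hn I0 HQ.
apply: (can_mono (Q := fun M' rv' vw' => [/\ M' = M, vw' = vw & inc_inv rv u v (lo + n) rv'])).
  by move=> _ rv' _ [-> -> H]; apply: HQ.
apply: (can_seqs (I := fun j M' rv' vw' => [/\ M' = M, vw' = vw & inc_inv rv u v j rv'])) => //.
move=> j M' rv' vw' /andP [_ Hj] [-> -> HI].
apply: can_seq; apply: can_sassign; apply: can_sassign; split=> //.
by apply: inc_regP => //; apply: leq_trans Hj Hn.
Qed.

Section Complete.
Variables sg o w : nat -> nat.
Hypothesis sg0 : sg 0 = 0.
Hypothesis sgK : sg K = acc.
Hypothesis HDelta : forall i, i < K -> (flag i, sg i, o i, w i, sg i.+1) \in Delta.
Hypothesis Hqueue : forall i, i + P < K -> w i = o (i + P).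

Definition rval (r q : nat) : nat :=
  if q == ry then o r else if q == rz then w r else bit r (q - 6).

Definition nondis x := forall i, i < L -> x <> ordv i.

Lemma nondis_rail j b : b <= 1 -> nondis (vrail j b).
Proof. by move=> Hb i Hi E; apply: (ordv_rail (j := j) Hi Hb). Qed.

Lemma nondis_F j : nondis (vF j).
Proof. by move=> i Hi E; apply: (ordv_F (j := j) Hi). Qed.

(** In the chosen run all stores of round [r] have timestamp [r + 1]. Hence a thread whose view of
    these variables is at most [u + 1] can read the messages of round [u] in any order, and its view
    stays below that bound. *)
Definition dmsg M r i : Prop := exists vw' : view,
  [/\ (inord (ordv i), inord (rval r (regof i)), vw') \in M,
      vt vw' (ordv i) = r.+1, forall i', i' < L -> vt vw' (ordv i') <= r.+1
    & forall x, x <= Vn -> nondis x -> vt vw' x = 0].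

Definition imsg M : Prop :=
  forall x, x <= Vn -> (inord x, inord 2, [ffun=> 0]) \in M.

Definition dis_state r i M vw : Prop :=
  [/\ forall i', i' < L -> vt vw (ordv i') = r + (i' < i),
      forall x, x <= Vn -> nondis x -> vt vw x = 0,
      forall mm, mm \in M -> forall x, x <= Vn -> vt mm.2 x <= vt vw x,
      forall r' i', i' < L -> r' * L + i' < r * L + i -> dmsg M r' i'
    & imsg M].

Lemma dmsg_sub M M' r i : {subset M <= M'} -> dmsg M r i -> dmsg M' r i.
Proof. by move=> HM [vw' [/HM H1 H2 H3 H4]]; exists vw'. Qed.

Lemma imsg_sub M M' : {subset M <= M'} -> imsg M -> imsg M'.
Proof. by move=> HM H x /H /HM. Qed.

Lemma can_round r M rv vw (Q : post) :
  dis_state r 0 M vw ->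
  (forall i, i < L -> rd rv (regof i) = rval r (regof i)) ->
  (forall M' vw', dis_state r.+1 0 M' vw' -> Q M' rv vw') ->
  can (round) Q M rv vw.
Proof.
move=> H0 Hr HQ.
apply: (can_mono (Q := fun M' rv' vw' => rv' = rv /\ dis_state r L M' vw')).
  move=> M' _ vw' [-> [Ha Hb Hc Hd He]]; apply: HQ; split=> //.
    by move=> i' Hi'; rewrite Ha // Hi' ltn0 addn0 addn1.
  by move=> r' i' Hi'; rewrite addn0 mulSn [L + _]addnC; apply: Hd.
rewrite -[L]add0n; apply: (can_seqs (I := fun i M' rv' vw' => rv' = rv /\ dis_state r (0 + i) M' vw')) => //.
clear H0; move=> i {}M _ {}vw /andP [_ Hi] [-> [Ha Hb Hc Hd He]]; rewrite !add0n in Hi *.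
rewrite !add0n in Ha Hd.
have Hx := ordv_le Hi.
have Hvx : vt vw (ordv i) = r by rewrite Ha // ltnn addn0.
apply: (can_sstore (n := r.+1)).
- by rewrite Hvx.
- by move=> mm Hin; rewrite ltnS -Hvx; apply: Hc.
split=> //; set vw' := upd vw _ _; set mm0 := (_, _, vw').
have Hsub : {subset M <= (mm0 |` M)%fset} by move=> mm Hin; rewrite in_fset1U Hin orbT.
have Hv x : x <= Vn -> vt vw' x = if x == ordv i then r.+1 else vt vw x.
  by move=> ?; rewrite vt_upd.
have Ha' i' : i' < L -> vt vw' (ordv i') = r + (i' < i.+1).
  move=> Hi'; rewrite Hv ?ordv_le // Ha // ltnS.
  case: (eqVneq i' i) => [->|ne]; first by rewrite eqxx leqnn addn1.
  rewrite [i' <= i]leq_eqVlt (negPf ne).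
  by case: eqP => // /(ordv_inj Hi' Hi) E; rewrite E eqxx in ne.
have Hb' x : x <= Vn -> nondis x -> vt vw' x = 0.
  by move=> Hxn Hnd; rewrite Hv //; case: eqP => [/(Hnd _ Hi)|_] //; apply: Hb.
split=> //.
- move=> mm; rewrite in_fset1U => /orP [/eqP -> //|Hin] x Hxn.
  apply: leq_trans (Hc _ Hin _ Hxn) _; rewrite Hv //; case: eqP => // ->.
  by rewrite Hvx.
- move=> r' i' Hi'; rewrite addnS ltnS leq_eqVlt => /orP [/eqP E|Hlt]; last first.
    exact: dmsg_sub Hsub (Hd _ _ Hi' Hlt).
  have L0 : 0 < L by apply: leq_ltn_trans Hi.
  have Ei : i' = i.
    by have := congr1 (modn^~ L) E; rewrite !modnMDl !modn_small.
  have Er : r' = r.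
    by apply/eqP; rewrite -(eqn_pmul2r L0); apply/eqP; move: E; rewrite Ei => /addIn.
  rewrite {}Er {}Ei; exists vw'; split=> //.
  + rewrite in_fset1U /mm0; apply/orP; left; apply/eqP; congr (_, _, _).
    by apply/val_inj; rewrite /= inordK -Hr // ltnS rd_le.
  + by rewrite Ha' // leqnn addn1.
  + by move=> i'' Hi''; rewrite Ha' //; case: (i'' < i.+1); clear; lia.
- exact: imsg_sub Hsub He.
Qed.

Definition loop_state r M rv vw : Prop :=
  [/\ dis_state r 0 M vw, forall i, i < N -> rd rv (rbit i) = bit r i,
      rd rv rcarry = (r == K), rd rv rflag = flag r & rd rv rstate = sg r].

Lemma can_body r M rv vw : r < K ->
  loop_state r M rv vw -> can body (loop_state r.+1) M rv vw.
Proof.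
move=> HrK [Hs Hb Ec Ef Es].
apply: can_seq; apply: can_assume_eq; first by rewrite Ec ltn_eqF.
have [x1 sD oD wD s'D] := Delta_le (HDelta HrK).
apply: can_seq; apply: (can_chs _ (HDelta HrK)).
apply: can_seq; apply: can_assume_eq => //.
apply: can_seq; apply: can_assume_eq => //.
apply: can_seq; apply: can_sassign; apply: can_seq; apply: can_sassign; apply: can_sassign.
set rv1 := upd _ _ _.
have Hb1 i : i < N -> rd rv1 (rbit i) = bit r i.
  by move=> Hi; rewrite !rd_bit // Hb.
have Ey : rd rv1 ry = o r by rewrite !rd_upd ?reg_small //= inordK.
have Ez : rd rv1 rz = w r by rewrite !rd_upd ?reg_small //= inordK.
have Es1 : rd rv1 rstate = sg r.+1 by rewrite !rd_upd ?reg_small //= inordK.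
apply: can_seq; apply: (can_round (r := r)) => //.
  move=> i Hi; rewrite /rval; case: eqP => [-> //|ny]; case: eqP => [-> //|nz].
  have [||j Hj ->] := @regofE i Hi.
  - by apply/eqP => E; apply: ny; rewrite E regofN.
  - by apply/eqP => E; apply: nz; rewrite E regofN.
  by rewrite Hb1 // addKn.
move=> M2 vw2 Hs2; apply: can_seq; apply: can_sassign; set rv2 := upd _ _ _.
have I0 : inc_inv rv2 r.+1 r 0 rv2.
  split=> //; last by rewrite rd_upd // eqxx eval_const ?(ltnW D_ge2) // !divn1 addn1.
  by move=> i Hi /=; rewrite rd_bit // Hb1.
have mN : 0 + m <= N by rewrite /nbits leq_addr.
apply: can_seq; apply: (can_incs mN I0) => rv3 [Hb3 [Hc3 Hd3] Hr3]; rewrite add0n in Hb3 Hd3.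
apply: can_seq; apply: can_sassign; set rv4 := upd _ _ _.
have I4 : inc_inv rv4 r.+1 r m rv4.
  split=> //; last by rewrite rd_upd ?reg_small.
  by move=> i Hi /=; rewrite rd_bit // Hb3.
have mmN : m + m <= N by [].
apply: (can_incs mmN I4) => rv5 [Hb5 [Hc5 Hd5] Hr5].
split=> //.
- by move=> i Hi; rewrite Hb5 // Hi.
- rewrite (carry_dvd Hd5) -/K; congr nat_of_bool; apply/idP/eqP => [|->] //.
  by move/dvdn_leq => /(_ isT) H; apply/eqP; rewrite eqn_leq HrK H.
- by rewrite Hr5 // rd_upd ?reg_small //= eval_reg (carry_dvd Hd3).
- by rewrite Hr5 // rd_upd ?reg_small //= Hr3 // rd_upd ?reg_small.
Qed.

Definition dis_msgs M : Prop :=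
  imsg M /\ forall r i, r < K -> i < L -> dmsg M r i.

Lemma dis_msgs_sub M M' : {subset M <= M'} -> dis_msgs M -> dis_msgs M'.
Proof.
move=> HM [H1 H2]; split; first exact: imsg_sub HM H1.
by move=> r i Hr Hi; apply: dmsg_sub HM _; apply: H2.
Qed.

Lemma can_check u i M rv vw (Q : post) :
  dis_msgs M -> u < K -> i < L -> rval u (regof i) <= D ->
  rd rv (regof i) = rval u (regof i) -> regof i != rt ->
  (forall i', i' < L -> vt vw (ordv i') <= u.+1) ->
  (forall rv' vw', (forall q, q <= Rn -> q != rt -> rd rv' q = rd rv q) ->
     (forall i', i' < L -> vt vw' (ordv i') <= u.+1) ->
     (forall x, x <= Vn -> nondis x -> vt vw' x = vt vw x) -> Q M rv' vw') ->
  can (check i) Q M rv vw.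
Proof.
move=> [_ Hd] Hu Hi HD Er ne Hv HQ; have [vw' [Hin E1 H2 H3]] := Hd u i Hu Hi.
apply: can_seq; apply: (can_sload Hin); first by rewrite E1 Hv.
apply: can_assume_same.
  by rewrite !rd_upd ?(@reg_small rt) ?regof_le // eqxx (negPf ne) Er inordK.
apply: HQ.
- by move=> q Hq /negPf nq; rewrite rd_upd ?(@reg_small rt) // nq.
- by move=> i' Hi'; rewrite vt_join geq_max Hv // H2.
- by move=> x Hx Hnd; rewrite vt_join H3 // maxn0.
Qed.

Lemma can_exact u i r M rv vw (Q : post) :
  dis_msgs M -> u < K -> (i == N) && (r == ry) || (i == N.+1) && (r == rz) ->
  (forall j, j < N -> rd rv (rbit j) = bit u j) ->
  (forall i', i' < L -> vt vw (ordv i') <= u.+1) ->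
  (forall rv' vw',
     (forall q, q <= Rn -> q != rt -> q != r -> rd rv' q = rd rv q) ->
     rd rv' r = rval u r ->
     (forall i', i' < L -> vt vw' (ordv i') <= u.+1) ->
     (forall x, x <= Vn -> nondis x -> vt vw' x = vt vw x) -> Q M rv' vw') ->
  can (exact (ordv i) r) Q M rv vw.
Proof.
move=> HM Hu Hir Hb Hv HQ.
have bD j : bit u j <= D by apply: leq_trans (bit_le1 u j) (ltnW D_ge2).
have rvb j : rval u (rbit j) = bit u j by rewrite /rval /rbit addKn.
have [Hi Eri Hr4 rD] : [/\ i < L, regof i = r, r < 5 /\ r != rt & rval u r <= D].
  have [_ _ oD wD _] := Delta_le (HDelta Hu).
  have LN : N.+1 < L by rewrite /rlen -addnA -[N.+1]addn1 ltn_add2l.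
  by case/orP: Hir => /andP [/eqP -> /eqP ->]; rewrite regofN; split=> //; apply: ltnW.
have NL : N <= L by rewrite /rlen -addnA leq_addr.
pose I0 M' rv' vw' := [/\ M' = M,
  forall q, q <= Rn -> q != rt -> rd rv' q = rd rv q,
  forall i', i' < L -> vt vw' (ordv i') <= u.+1 &
  forall x, x <= Vn -> nondis x -> vt vw' x = vt vw x].
pose I1 M' rv' vw' := [/\ M' = M,
  forall q, q <= Rn -> q != rt -> q != r -> rd rv' q = rd rv q, rd rv' r = rval u r,
  forall i', i' < L -> vt vw' (ordv i') <= u.+1 &
  forall x, x <= Vn -> nondis x -> vt vw' x = vt vw x].
apply: can_seq; apply: (can_mono (Q := I0)); last first.
  apply: (can_seqs (I := fun _ => I0)); last by split.
  move=> j _ rv' vw' /andP [_ Hj] [-> H1 H2 H3]; rewrite add0n in Hj.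
  have Hlt : L.-1 - j < L by clear -Hj NL; lia.
  have Hlt' : N.-1 - j < N by clear -Hj; lia.
  apply: (can_check (u := u)) => //; rewrite ?regof_bitA ?rvb //.
  - by rewrite H1 ?rbit_le // Hb.
  - move=> rv2 vw2 G1 G2 G3; split=> //.
    + by move=> q Hq nq; rewrite G1 // H1.
    + by move=> x Hx Hnd; rewrite G3 // H3.
move=> _ rv1 vw1 [-> H1 H2 H3].
have [vw' [Hin E1 H2' H3']] := (proj2 HM) u i Hu Hi.
have rn : r <= Rn by apply: reg_small; case: Hr4 => /ltnW.
apply: can_seq; apply: (can_sload Hin); first by rewrite E1 H2.
apply: (can_mono (Q := I1)); first by move=> _ rv2 vw2 [-> *]; apply: HQ.
apply: (can_seqs (I := fun _ => I1)); last first.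
  split=> //.
  - by move=> q Hq nq /negPf nr; rewrite rd_upd // nr H1.
  - by rewrite rd_upd // eqxx Eri inordK.
  - by move=> i' Hi'; rewrite vt_join geq_max H2 // H2'.
  - by move=> x Hx Hnd; rewrite vt_join H3' // maxn0 H3.
move=> j _ rv2 vw2 /andP [_ Hj] [-> G1 Gr G2 G3]; rewrite add0n in Hj.
have Hlt : N.-1 - j < L by apply: leq_trans NL; clear -Hj; lia.
apply: (can_check (u := u)) => //; rewrite ?regof_bitB ?rvb //.
- rewrite G1 ?rbit_le ?Hb //.
  by case: Hr4; rewrite /rbit; clear; lia.
- move=> rv3 vw3 F1 F2 F3; split=> //.
  + by move=> q Hq nq nr; rewrite F1 // G1.
  + by rewrite F1 //; case: Hr4.
  + by move=> x Hx Hnd; rewrite F3 // G3.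
Qed.

(** The last clause asks for a timestamp above all those in [M], so that results produced one after
    the other can be read in this order. *)
Definition certified j v M M' : Prop :=
  {subset M <= M'} /\ exists vw : view,
  [/\ (inord (vF j), inord (bit v j), vw) \in M',
      forall u, u <= j -> vt vw (vrail u (bit v u)) = 0
    & forall mm, mm \in M -> vt mm.2 (vF j) < vt vw (vF j)].

Lemma store_certified j v r (M M1 : memory) rv vw :
  {subset M <= M1} -> j < N -> rd rv r = bit v j -> r <= Rn ->
  (forall u, u <= j -> vt vw (vrail u (bit v u)) = 0) ->
  can (store (vF j) r) (fun M' _ _ => certified j v M M') M1 rv vw.
Proof.
move=> Hsub Hj Er Hr Hu; have [n [Hn1 Hn2]] := fresh M1 vw (vF j).
apply: (can_sstore Hn1 Hn2).
have HF : vF j <= Vn by rewrite vF_le // ltnW.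
split; first by move=> mm /Hsub H; rewrite in_fset1U H orbT.
exists (upd vw (inord (vF j)) n); split.
- rewrite in_fset1U; apply/orP; left; apply/eqP; congr (_, _, _).
  by apply/val_inj; rewrite /= -/(rd rv r) Er inordK // ltnS -Er rd_le.
- move=> u Huj; rewrite vt_upd ?vrail_le ?bit_le1 //; last exact: leq_ltn_trans Hj.
  have -> : (vrail u (bit v u) == vF j) = false; last exact: Hu.
  by have := bit_le1 v u; rewrite /vrail /vF; clear; lia.
- by move=> mm /Hsub Hin; rewrite vt_upd // eqxx; apply: Hn2.
Qed.

Lemma can_leaf v M : v < K -> dis_msgs M ->
  can (leaf) (fun M' _ _ => certified N.-1 v M M') M [ffun=> ord0] [ffun=> 0].
Proof.
move=> Hv HM.
have N0 : 0 < N by rewrite /nbits addn_gt0 m_gt0.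
pose G j M' rv vw := [/\ {subset M <= M'},
  rd rv rcarry = 0, forall u, u < j -> rd rv (rbit u) = bit v u,
  forall i, i < L -> vt vw (ordv i) = 0 &
  forall u, u < N -> vt vw (vrail u (bit v u)) = 0].
apply: can_seq; apply: (can_mono (Q := G N)); last first.
  rewrite -[X in G X]add0n; apply: (can_seqs (I := G)); last first.
    by split=> //; rewrite ?rd0 // => *; rewrite vt0.
  move=> j M1 rv vw /andP [_ Hj] [H1 H2 H3 H4 H5]; rewrite add0n in Hj.
  have main b : bit v j = b -> can (Seq (assign (rbit j) (econst b)) (store (vrail j (1 - b)) rcarry))
     (G j.+1) M1 rv vw.
    move=> Hb; have b1 : b <= 1 by rewrite -Hb bit_le1.
    apply: can_seq; apply: can_sassign.
    have [n [Hn1 Hn2]] := fresh M1 vw (vrail j (1 - b)).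
    have Hle : vrail j (1 - b) <= Vn by rewrite vrail_le // leq_subr.
    apply: (can_sstore Hn1 Hn2); split=> //.
    - by move=> mm /H1 Hin; rewrite in_fset1U Hin orbT.
    - by rewrite rd_upd ?rbit_le ?(@reg_small rcarry).
    - move=> u; rewrite ltnS leq_eqVlt => /orP [/eqP ->|Hu].
        by rewrite rd_upd ?rbit_le // eqxx eval_const // (leq_trans b1) // ltnW.
      rewrite rd_upd ?rbit_le //; last exact: ltn_trans Hj.
      by rewrite /rbit eqn_add2l ltn_eqF // H3.
    - move=> i Hi; rewrite vt_upd ?ordv_le //; case: eqP => [|_]; last exact: H4.
      by move/(ordv_rail Hi); rewrite leq_subr => /(_ isT).
    - move=> u Hu; rewrite vt_upd ?vrail_le ?bit_le1 ?leq_subr //.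
      case: eqP => [E|_]; last exact: H5.
      have Eu : u = j by move: E; rewrite /vrail; have := bit_le1 v u; clear -b1; lia.
      by move: E; rewrite Eu Hb /vrail; clear -b1; lia.
  rewrite /guess; case E: (bit v j) (bit_le1 v j) => [|[|//]] _.
  - by apply: can_choice_l; apply: (main 0).
  - by apply: can_choice_r; apply: (main 1).
move=> M1 rv vw [Hsub _ Hb Hdis Hrail].
have HM1 := dis_msgs_sub Hsub HM.
apply: can_seq; apply: can_sassign; set rv1 := upd _ _ _.
have Hb1 u : u < N -> rd rv1 (rbit u) = bit v u by move=> Hu; rewrite rd_bit // Hb.
have Ef : rd rv1 rflag = bit v N.-1.
  by rewrite rd_upd ?reg_small // eqxx eval_reg Hb // prednK.
have Ez : vz = ordv N.+1 by rewrite ordvN.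
have Ey : vy = ordv N by rewrite ordvN.
apply: can_seq; rewrite {1}Ez; apply: (can_exact (u := v)) => //.
- by rewrite !eqxx orbT.
- by move=> i Hi; rewrite Hdis.
move=> rv2 vw2 G1 Gz G2 G3.
apply: can_seq; apply: can_sassign; set rv3 := upd _ _ _.
have H3 r : r <= Rn -> r != 0 -> r != rz -> r != rt -> rd rv3 r = rd rv1 r.
  by move=> Hr n0 nz nt; rewrite rd_upd //= (negPf n0) G1.
have I0 : inc_inv rv3 (v + P) v m rv3.
  split=> //; last first.
    rewrite rd_upd //= inordK ?ltnS ?(ltnW D_ge2) //.
    by split=> //; rewrite divnDr ?divnn ?expn_gt0.
  move=> i Hi; rewrite H3 ?rbit_le // Hb1 //.
  by case: ifP => // Him; rewrite bit_addP.
have mmN : m + m <= N by [].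
apply: can_seq; apply: (can_incs mmN I0) => rv4 [Hb4 [Hc4 Hd4] Hr4].
have vsm : v %/ 2 ^ (m + m) = 0 by rewrite divn_small.
rewrite vsm add0n in Hd4.
have Ef4 : rd rv4 rflag = bit v N.-1 by rewrite Hr4 // H3 ?reg_small.
have Erz4 : rd rv4 rz = w v by rewrite Hr4 // rd_upd ?reg_small //= Gz.
have Hvr u : u <= N.-1 -> vt vw2 (vrail u (bit v u)) = 0.
  move=> Hu; have Hu' : u < N by rewrite -(prednK N0).
  by rewrite G3 ?Hrail ?vrail_le ?bit_le1 //; apply: nondis_rail; apply: bit_le1.
have HN1 : N.-1 < N by rewrite prednK.
apply: can_seq; case: (ltnP (v + P) K) => HvP; last first.
  apply: can_choice_l; apply: can_assume_eq; last exact: store_certified (reg_small _) _.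
  rewrite -Hd4; apply/eqP; rewrite eqn_leq Hd4 Hc4 /= -Hd4 divn_gt0 ?expn_gt0 //.
apply: can_choice_r; apply: can_seq; apply: can_assume_eq.
  by rewrite -Hd4 divn_small.
apply: can_seq; rewrite {1}Ey; apply: (can_exact (u := v + P)) => //.
- by rewrite !eqxx.
- by move=> j Hj; rewrite Hb4 // Hj.
(* After round [v] the view is still low enough for the later round [v + P]; this is why a leaf
   reads the pushed letter before the popped one. *)
- by move=> i Hi; apply: leq_trans (G2 _ Hi) _; rewrite ltnS leq_addr.
move=> rv5 vw5 F1 Fy F2 F3; apply: can_assume_same.
  by rewrite Fy F1 ?reg_small // Erz4 Hqueue.
apply: store_certified => //; first by rewrite F1 ?reg_small.
  exact: reg_small.
move=> u Hu; have Hu' : u < N by rewrite -(prednK N0).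
by rewrite F3 ?Hvr ?vrail_le ?bit_le1 //; apply: nondis_rail; apply: bit_le1.
Qed.

Lemma can_node j v M vw0 vw1 : j.+1 < N -> imsg M ->
  (inord (vF j.+1), inord 0, vw0) \in M -> (inord (vF j.+1), inord 1, vw1) \in M ->
  vt vw0 (vF j.+1) <= vt vw1 (vF j.+1) ->
  (forall u, u <= j -> vt vw0 (vrail u (bit v u)) = 0 /\ vt vw1 (vrail u (bit v u)) = 0) ->
  can (node j) (fun M' _ _ => certified j v M M') M [ffun=> ord0] [ffun=> 0].
Proof.
move=> Hj HM in0 in1 Hle Hu.
apply: can_seq; apply: (can_sload in0); first by rewrite vt0.
apply: can_seq; apply: can_assume_eq; first by rewrite rd_upd ?reg_small // eqxx inordK.
apply: can_seq; apply: (can_sload in1); first by rewrite vt_join vt0 max0n.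
apply: can_seq; apply: can_assume_eq.
  by rewrite rd_upd ?reg_small // eqxx inordK // ltnS ltnW.
set rv := upd _ _ _; set vw := join _ vw1.
have Hvw u : u <= j -> vt vw (vrail u (bit v u)) = 0.
  by move=> /Hu [E0 E1]; rewrite !vt_join vt0 E0 E1.
have jN : j < N by apply: ltnW.
have main b : bit v j = b -> can (nodeb j b) (fun M' _ _ => certified j v M M') M rv vw.
  move=> Hb; have b1 : b <= 1 by rewrite -Hb bit_le1.
  have inr := HM _ (vrail_le jN b1).
  apply: can_seq; apply: (can_sload inr); first by rewrite -Hb Hvw.
  apply: can_seq; apply: can_assume_eq; first by rewrite rd_upd ?reg_small // eqxx inordK.
  apply: can_seq; apply: can_sassign; apply: store_certified => //.
  - by rewrite rd_upd ?reg_small // eqxx eval_const // (leq_trans b1) // ltnW.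
  - exact: reg_small.
  - by move=> u Huj; rewrite vt_join vt0 maxn0 Hvw.
case E: (bit v j) (bit_le1 v j) => [|[|//]] _.
- by apply: can_choice_l; apply: main.
- by apply: can_choice_r; apply: main.
Qed.

Definition env0 : lconf := LConf (cenv_sys) [ffun=> ord0] [ffun=> 0].

Lemma run_env M (th : nat -> lconf) t (Q : memory -> Prop) :
  (forall t', t <= t' -> th t' = env0) ->
  can (cenv_sys) (fun M' _ _ => Q M') M [ffun=> ord0] [ffun=> 0] ->
  exists M' th', [/\ greach (Conf M th) (Conf M' th'), Q M',
    forall t', t.+1 <= t' -> th' t' = env0 & forall t', t' < t -> th' t' = th t'].
Proof.
move=> Hth [M' [rv [vw [Hr HQ]]]].
have := @greach_lreach _ _ _ M th t M' _; rewrite (Hth t (leqnn t)) => /(_ _ Hr) [th' [H1 H2 H3]].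
exists M', th'; split=> // t' Ht.
- by rewrite H3 ?Hth ?(ltnW Ht) // gtn_eqF.
- by rewrite H3 // ltn_eqF.
Qed.

(** Post-order evaluation of the tree whose root is at level [N - 1 - n], with a fresh thread for
    every node. Only the bits of [v] up to that level matter. *)
Lemma run_tree n v M (th : nat -> lconf) t :
  n < N -> v < K -> dis_msgs M -> (forall t', t <= t' -> th t' = env0) ->
  exists M' th' t1, [/\ greach (Conf M th) (Conf M' th'), certified (N.-1 - n) v M M',
    t <= t1, forall t', t1 <= t' -> th' t' = env0 & forall t', t' < t -> th' t' = th t'].
Proof.
elim: n v M th t => [|n IH] v M th t Hn Hv HM Hth.
  rewrite subn0.
  have ce : can (cenv_sys) (fun M' _ _ => certified N.-1 v M M') M
      [ffun=> ord0] [ffun=> 0] by apply: can_choice_l; apply: can_leaf.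
  have [M' [th' [H1 H2 H3 H4]]] := run_env Hth ce.
  by exists M', th', t.+1.
have Hn' : n < N by apply: ltnW.
set j := N.-1 - n.+1; have Ej : N.-1 - n = j.+1 by rewrite /j; clear -Hn; lia.
have Hj : j.+1 < N by rewrite /j; clear -Hn; lia.
(* The index that represents a child follows [v] down to level [j] and continues with [b]; its lower
   levels are arbitrary. *)
have child b : b <= 1 -> exists v', [/\ v' < K, bit v' j.+1 = b & forall u, u <= j -> bit v' u = bit v u].
  move=> Hb; have [|v' [H1 H2]] := @bits_exist N (fun u => if u <= j then bit v u else b).
    by move=> u _; case: ifP => // _; apply: bit_le1.
  exists v'; split=> //; first by rewrite H2 // ltnn.
  by move=> u Hu; rewrite H2 ?Hu //; apply: leq_ltn_trans Hu _; apply: ltnW.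
have [v0 [Hv0 B0 U0]] := child 0 isT; have [v1 [Hv1 B1 U1]] := child 1 isT.
have [M0 [th0 [t0 [R0 [S0 [vw0 [C1 C2 C3]]] T0 I0 F0]]]] := IH v0 M th t Hn' Hv0 HM Hth.
have HM0 := dis_msgs_sub S0 HM.
have [M1 [th1 [t1 [R1 [S1 [vw1 [D1 D2 D3]]] T1 I1 F1]]]] := IH v1 M0 th0 t0 Hn' Hv1 HM0 I0.
have HM1 := dis_msgs_sub S1 HM0.
rewrite Ej B0 B1 in C1 C2 C3 D1 D2 D3.
have ce : can (cenv_sys) (fun M' _ _ => certified j v M1 M') M1
    [ffun=> ord0] [ffun=> 0].
  apply: can_choice_r; have jin : j \in iota 0 N by rewrite mem_iota /= add0n ltnW.
  apply: (can_chs _ jin).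
  apply: (can_node Hj (proj1 HM1) (S1 _ C1) D1).
    by apply: ltnW; apply: D3 C1.
  by move=> u Hu; rewrite -{1}U0 // -U1 // C2 ?D2 //; exact: leqW.
have [M2 [th2 [R2 [S2 HQ] I2 F2]]] := run_env I1 ce.
exists M2, th2, t1.+1; split=> //.
- exact: greach_trans R0 (greach_trans R1 R2).
- split; first by move=> mm /S0 /S1 /S2.
  case: HQ => vw [Q1 Q2 Q3]; exists vw; split=> // mm /S0 /S1; exact: Q3.
- exact: leqW (leq_trans T0 T1).
- move=> t' Ht'; rewrite F2 ?F1 ?F0 //; first exact: leq_trans Ht' T0.
  exact: leq_trans Ht' (leq_trans T0 T1).
Qed.

Lemma sys_complete_run : unsafe sys.
Proof.
have N0 : 0 < N by rewrite /nbits addn_gt0 m_gt0.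
have K0 : 0 < K by rewrite /horizon expn_gt0.
rewrite /unsafe /unsafe_from /ginit /=.
set M0 := [fset _ | x in _]%fset.
set th := fun t => LConf _ _ _.
have L0 : loop_state 0 M0 [ffun=> ord0] [ffun=> 0].
  split; rewrite ?rd0 ?sg0 //; last 2 first.
  - by move=> i Hi; rewrite rd0 /bit div0n.
  - by rewrite eq_sym (negPf (lt0n_neq0 K0)).
  split=> //.
  - by move=> i' Hi'; rewrite vt0.
  - by move=> x Hx _; rewrite vt0.
  - by move=> mm /imfsetP [x _ ->] y Hy; rewrite /= vt0.
  - by move=> x Hx; apply/imfsetP; exists (inord x).
pose fin : cmd := Seq (load rt (vF 0)) (Seq (assume_eq rt 0)
      (Seq (load rt (vF 0)) (Seq (assume_eq rt 1) (@AssertFalse _ _ _)))).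
have [M1 [l1 [R1 [rv1 [vw1 [El1 Hs]]]]]] : leads cdis_sys (fun l M =>
    exists rv vw, l = LConf fin rv vw /\ loop_state K M rv vw) M0 [ffun=> ord0] [ffun=> 0].
  apply: leads_seq; apply: (can_mono (Q := loop_state K)) => [M rv vw Hs|]; last first.
    rewrite -[K]add0n; apply: (can_star (I := loop_state)) => // j M rv vw /andP [_ Hj].
    exact: can_body.
  case: (Hs) => _ _ Ec _ Est.
  apply: leads_seq; apply: can_assume_eq; first by rewrite Ec eqxx.
  apply: leads_seq; apply: can_assume_eq; first by rewrite Est.
  by apply: leads_here; exists rv, vw.
have [th1 [G1 E1 F1]] := @greach_lreach _ _ _ M0 th 0 M1 _ R1.
case: Hs => Hs Hb Hc Hf Hst.
have HB : dis_msgs M1.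
  case: Hs => _ _ _ Hd Hi; split=> // r i Hr HiL; apply: Hd => //.
  by rewrite addn0; clear - Hr HiL; nia.
have I1 t' : 1 <= t' -> th1 t' = env0.
  by move=> Ht; rewrite F1 ?/th; case: t' Ht.
have nN : N.-1 < N by rewrite prednK.
have v1K : 1 < K by rewrite /horizon -{1}(expn0 2) ltn_exp2l.
(* The indices 0 and 1 stand for the two values of bit 0, the only bit that matters at the root. *)
have [M2 [th2 [t2 [R3 [S3 [vw2 [C1 C2 C3]]] T2 I2 F2]]]] := run_tree nN K0 HB I1.
have [M3 [th3 [t3 [R4 [S4 [vw3 [D1 D2 D3]]] T3 I3 F3]]]] := run_tree nN v1K (dis_msgs_sub S3 HB) I2.
rewrite subnn in C1 C2 C3 D1 D2 D3.
have Hvw1 : vt vw1 (vF 0) = 0.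
  by case: Hs => _ H _ _ _; rewrite H ?vF_le //; apply: nondis_F.
have [M4 [l4 [R5 [rv4 [vw4 E4]]]]] : leads fin (fun l _ =>
    exists rv vw, l = LConf (@AssertFalse _ _ _) rv vw) M3 rv1 vw1.
  apply: leads_seq; apply: (can_sload (S4 _ C1)); first by rewrite Hvw1.
  apply: leads_seq; apply: can_assume_eq; first by rewrite rd_upd ?reg_small // eqxx inordK.
  apply: leads_seq; apply: (can_sload D1).
    by rewrite vt_join Hvw1 max0n; apply: ltnW; exact: D3 C1.
  apply: leads_seq; apply: can_assume_eq; first by rewrite rd_upd ?reg_small // eqxx inordK // ltnS ltnW.
  by apply: leads_here; do 2!eexists.
have Eth : th3 0 = l1 by rewrite F3 // F2 // E1.
rewrite -El1 -Eth in R5.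
have [th4 [G5 E5 F5]] := greach_lreach R5.
exists (Conf M4 th4), 0; split; last by rewrite /= E5 E4; apply: af_here.
exact: greach_trans G1 (greach_trans R3 (greach_trans R4 G5)).
Qed.

End Complete.

End System.

(** * Turing machines as queue automata *)

Section Control.
Context (C Q : finType).

Definition letter : finType := (C + Q)%type.

(** [CI] pushes the blanks before the initial configuration and [CJE] those after it; [CR] copies
    letters. A move rewrites a window: [CE c o] still has to pop [c] and push [o], and [CL b q c c']
    is a left move that has popped [b] and expects [q] and [c]. [CH c] checks that [c] follows an
    accepting state, and [CAcc] copies to the end. *)
Inductive ctl :=
| CI | CJE | CR | CAcc
| CE of C & letter | CH of C | CL of C & Q & C & C.

Definition ctl_code (s : ctl) : option (option (option (option
    (C * letter + C + C * Q * C * C)))) :=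
  match s with
  | CI => None | CJE => Some None | CR => Some (Some None)
  | CAcc => Some (Some (Some None))
  | CE c o => Some (Some (Some (Some (inl (inl (c, o))))))
  | CH c => Some (Some (Some (Some (inl (inr c)))))
  | CL b q c c' => Some (Some (Some (Some (inr (b, q, c, c')))))
  end.
Definition ctl_decode x : ctl :=
  match x with
  | None => CI | Some None => CJE | Some (Some None) => CR
  | Some (Some (Some None)) => CAcc
  | Some (Some (Some (Some (inl (inl (c, o)))))) => CE c o
  | Some (Some (Some (Some (inl (inr c))))) => CH c
  | Some (Some (Some (Some (inr (b, q, c, c'))))) => CL b q c c'
  end.
Lemma ctl_codeK : cancel ctl_code ctl_decode. Proof. by case. Qed.
HB.instance Definition _ := Finite.copy ctl (can_type ctl_codeK).

End Control.

Arguments CI {C Q}.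
Arguments CJE {C Q}.
Arguments CR {C Q}.
Arguments CAcc {C Q}.
Arguments CE {C Q}.
Arguments CH {C Q}.
Arguments CL {C Q}.

Section Machine.
Context (M : tm 0).
Local Notation C := (cell (sym M)).
Local Notation Q := (state M).
Local Notation letter := (letter C Q).
Local Notation ctl := (ctl C Q).

Definition acts (q : Q) (c : C) := trans q [ffun=> c].

(** The window [q c] becomes [q' c'] or [c' q'], and [b q c] becomes [q' b c']. A left move must be
    guessed at [b], one letter before the state is seen. Only [CJE], [CR] and [CAcc] have
    transitions with [x] set, all of them copying, so no window crosses a row boundary. *)
Definition okM (x : bool) (s : ctl) (o w : letter) (s' : ctl) : bool :=
  match s with
  | CI => [&& ~~ x, o == inl None, w == inl None & s' == CI]
  | CJE => if x then [&& (if o is inl _ then true else false), w == o & s' == CR]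
           else [&& o == inl None, w == inl None & s' == CJE]
  | CR =>
      match o with
      | inl a => (w == o) && (s' == CR) ||
          ~~ x && match s', w with
                  | CL b q c c', inr q' =>
                      (b == a) && ((q', [ffun=> (c', MoveLeft)]) \in acts q c)
                  | _, _ => false
                  end
      | inr q => ~~ x && match s' with
                  | CE c o' => match w, o' with
                     | inr q', inl c' => (q', [ffun=> (c', Stay)]) \in acts q c
                     | inl c', inr q' => (q', [ffun=> (c', MoveRight)]) \in acts q c
                     | _, _ => false
                     end
                  | CH c => [&& w == o, q \in accepting M & acts q c == set0]
                  | _ => false
                  end
      end
  | CAcc => (w == o) && (s' == CAcc)
  | CE c o' => [&& ~~ x, o == inl c, w == o' & s' == CR]
  | CH c => [&& ~~ x, o == inl c, w == o & s' == CAcc]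
  | CL b q c c' => [&& ~~ x, o == inr q, w == inl b & s' == CE c (inl c')]
  end.

Definition lc (l : letter) : nat := enum_rank l.
(** [CI] gets the code 0, the state in which a queue run starts. *)
Definition cc (s : ctl) : nat := if s == CI then 0 else (enum_rank s).+1.
Definition blank : nat := lc (inl None).

Lemma lc_inj : injective lc.
Proof. by move=> a b /ord_inj /enum_rank_inj. Qed.

Lemma cc_inj : injective cc.
Proof.
move=> a b; rewrite /cc; case: eqP => [->|_]; case: eqP => [->|_] //.
by case=> /ord_inj /enum_rank_inj.
Qed.

(** The summand 3 makes room for the shift in [cc] and guarantees the values 0, 1 and 2 in the
    domain. *)
Definition code_base : nat := #|{: ctl}| + #|{: letter}| + 3.
Local Notation base := code_base.

Lemma lc_lt l : lc l < base.
Proof.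
apply: leq_trans (ltn_ord (enum_rank l)) _.
by rewrite /code_base -addnA addnCA leq_addr.
Qed.

Lemma cc_lt s : cc s < base.
Proof.
rewrite /cc /code_base; case: ifP => [_|_]; first by rewrite addn3.
apply: leq_ltn_trans (ltn_ord (enum_rank s)) _.
by rewrite -addnA -[X in X < _]addn0 ltn_add2l addn3.
Qed.

Definition code5 (d : bool * ctl * letter * letter * ctl) : nat * nat * nat * nat * nat :=
  let: (x, s, o, w, s') := d in (nat_of_bool x, cc s, lc o, lc w, cc s').

Definition DeltaM : seq (nat * nat * nat * nat * nat) :=
  [seq code5 d | d <- enum [pred d : bool * ctl * letter * letter * ctl |
     let: (x, s, o, w, s') := d in okM x s o w s']].

Definition lcin (b : bool) : nat := lc (inl (Some (inl b))).

(* The control state [base + i] has pushed the first [i] input symbols. *)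
Definition Delta (w : word) : seq (nat * nat * nat * nat * nat) :=
  DeltaM ++ (0, 0, blank, lc (inr (start M)), base) ::
  [seq (0, base + i, blank, lcin (nth false w i), base + i.+1) | i <- iota 0 (size w)]
  ++ [:: (0, base + size w, blank, blank, cc CJE)].

Lemma DeltaP (w : word) x s o p s' : (x, s, o, p, s') \in Delta w ->
  [\/ exists a c l l' c', [/\ okM a c l l' c', x = nat_of_bool a, s = cc c, o = lc l
                         & p = lc l' /\ s' = cc c'],
      [/\ x = 0, s = 0, o = blank, p = lc (inr (start M)) & s' = base],
      (exists i, [/\ i < size w, x = 0 /\ s = base + i, o = blank,
           p = lcin (nth false w i) & s' = base + i.+1])
    | [/\ x = 0, s = base + size w, o = blank, p = blank & s' = cc CJE]].
Proof.
rewrite mem_cat in_cons mem_cat => /or4P [/mapP [d]|/eqP [-> -> -> -> ->]|/mapP [i]|].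
- case: d => [[[[a c] l] l'] c']; rewrite mem_enum inE => H [-> -> -> -> ->].
  by apply: Or41; exists a, c, l, l', c'.
- exact: Or42.
- rewrite mem_iota add0n => /= Hi [-> -> -> -> ->]; apply: Or43; exists i; split=> //.
- by rewrite inE => /eqP [-> -> -> -> ->]; apply: Or44.
Qed.

Lemma Delta_okM (w : word) a c l l' c' : okM a c l l' c' ->
  (nat_of_bool a, cc c, lc l, lc l', cc c') \in Delta w.
Proof.
move=> H; rewrite mem_cat; apply/orP; left; apply/mapP.
by exists (a, c, l, l', c'); rewrite ?mem_enum.
Qed.

Lemma Delta_start (w : word) : (0, 0, blank, lc (inr (start M)), base) \in Delta w.
Proof. by rewrite mem_cat in_cons eqxx orbT. Qed.

Lemma Delta_input (w : word) i : i < size w ->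
  (0, base + i, blank, lcin (nth false w i), base + i.+1) \in Delta w.
Proof.
move=> Hi; rewrite mem_cat in_cons mem_cat; apply/or4P; apply: Or43.
by apply/mapP; exists i; rewrite ?mem_iota.
Qed.

Lemma Delta_last (w : word) : (0, base + size w, blank, blank, cc CJE) \in Delta w.
Proof. by rewrite mem_cat in_cons mem_cat inE eqxx !orbT. Qed.

Lemma Delta_bound (w : word) x s o p s' : (x, s, o, p, s') \in Delta w ->
  [/\ x <= 1, s <= base + size w, o <= base + size w, p <= base + size w
    & s' <= base + size w].
Proof.
have B n : n < base -> n <= base + size w by move=> /ltnW H; apply: leq_trans H (leq_addr _ _).
case/DeltaP => [[a [c [l [l' [c' [_ -> -> -> [-> ->]]]]]]]|[-> -> -> -> ->]|
  [i [Hi [-> ->] -> -> ->]]|[-> -> -> -> ->]]; split;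
  rewrite ?leq_addr ?leq_add2l //; try exact: B (lc_lt _);
  try exact: B (cc_lt _); try exact: ltnW.
by case: a.
Qed.

Definition accepts (w : word) : Prop := exists n cf,
  [/\ run n (init_conf M w) cf, halted cf & cstate cf \in accepting M].

Definition reach (w : word) (cf : tmconf M) := exists n, run n (init_conf M w) cf.

Lemma run_rcons n (c c' : tmconf M) a :
  run n c c' -> a \in actions c' -> run n.+1 c (act c' a).
Proof.
elim=> [{}c|{}n c0 b c1 Hb _ IH] Ha; first by apply: runS Ha (run0 _).
by apply: runS Hb (IH Ha).
Qed.

Lemma reach_act w cf a : reach w cf -> a \in actions cf -> reach w (act cf a).
Proof. by case=> n H Ha; exists n.+1; apply: run_rcons. Qed.

Lemma ffun_I1 (T : Type) (f : {ffun 'I_1 -> T}) : f = [ffun=> f ord0].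
Proof. by apply/ffunP => i; rewrite ffunE (ord1 i). Qed.

Definition lsame (s t : seq C) := forall i, nth None s i = nth None t i.

Lemma lsame_cons c s t : lsame s t -> lsame (c :: s) (c :: t).
Proof. by move=> H [|i] //=; apply: H. Qed.

Lemma lsame_behead s t : lsame s t -> lsame (behead s) (behead t).
Proof. by move=> H i; rewrite !nth_behead. Qed.

Lemma lsame_head s t : lsame s t -> head None s = head None t.
Proof. by move=> /(_ 0); rewrite !nth0. Qed.

(* The letter of the state stands just before the scanned cell; the blanks at
   both ends are not represented faithfully. *)
Definition conf_word (l : seq C) (q : Q) (r : seq C) : seq letter :=
  map inl l ++ inr q :: map inl r.

(** [l] is in reading order, whereas a tape lists its left part from the head outwards; [lsame]
    absorbs the blank padding. *)
Definition tape_lr (cf : tmconf M) (l r : seq C) :=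
  lsame (rev l) (ctapes cf ord0).1 /\ lsame r (ctapes cf ord0).2.

Definition encodes (cf : tmconf M) (u : seq letter) : Prop :=
  exists l r, u = conf_word l (cstate cf) r /\ tape_lr cf l r.

Lemma actionsE cf l c r : tape_lr cf l (c :: r) -> actions cf = acts (cstate cf) c.
Proof.
case=> _ H; rewrite /actions /acts; congr (trans _ _); apply/ffunP => i.
by rewrite !ffunE (ord1 i) /read_tape -(lsame_head H).
Qed.

Lemma tape_stay cf l c r q' c' : tape_lr cf l (c :: r) ->
  tape_lr (act cf (q', [ffun=> (c', Stay)])) l (c' :: r).
Proof.
case=> H1 H2; split; rewrite /= !ffunE /act_tape /= ?ffunE //=.
exact: lsame_cons (lsame_behead H2).
Qed.

Lemma tape_right cf l c r q' c' : tape_lr cf l (c :: r) ->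
  tape_lr (act cf (q', [ffun=> (c', MoveRight)])) (rcons l c') r.
Proof.
case=> H1 H2; split; rewrite /= !ffunE /act_tape /= ?ffunE //=.
- by rewrite rev_rcons; apply: lsame_cons.
- exact: lsame_behead H2.
Qed.

Lemma tape_left cf l b c r q' c' : tape_lr cf (rcons l b) (c :: r) ->
  tape_lr (act cf (q', [ffun=> (c', MoveLeft)])) l (b :: c' :: r).
Proof.
case=> H1 H2; split; rewrite /= !ffunE /act_tape /= ?ffunE //=.
- by move/lsame_behead: H1; rewrite rev_rcons.
- rewrite -(lsame_head H1) rev_rcons /=; do 2!apply: lsame_cons.
  exact: lsame_behead H2.
Qed.

(** A configuration word contains a single state letter, which therefore determines how the word
    splits. *)
Lemma conf_word_split (d r : seq letter) q l q' rr :
  d ++ inr q :: r = conf_word l q' rr ->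
  [/\ d = map inl l, q = q' & r = map inl rr].
Proof.
elim: l d => [|a l IH] [|b d] //=.
- by case=> -> ->.
- case=> _ E; exfalso; elim: rr d E => [|x rr IH] [|y d] //=.
  by case=> _ /IH.
- by case=> -> /IH [-> -> ->].
Qed.

(** * From queue runs to accepting computations *)

Section QueueSound.
Context (m : nat) (w : word).
Hypothesis m_gt0 : 0 < m.
Local Notation P := (period m).
Local Notation K := (horizon m).

Lemma horizonE : K = P * P. Proof. by rewrite /horizon /period /nbits expnD. Qed.
Lemma period_gt1 : 1 < P. Proof. by rewrite /period -{1}(expn0 2) ltn_exp2l. Qed.

Definition stuck (s : nat) := forall o p s', (1, s, o, p, s') \notin Delta w.

Lemma stuck_base k : stuck (base + k).
Proof.
move=> o p s'; apply/negP => /DeltaP [[a [c [l [l' [c' [_ _ E _ _]]]]]]|[]|[i [_ [] //]]|[]] //.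
by have := cc_lt c; rewrite -E ltnNge leq_addr.
Qed.

Lemma stuck_cc c : c != CJE -> c != CR -> c != CAcc -> stuck (cc c).
Proof.
move=> n1 n2 n3 o p s'; apply/negP => /DeltaP [[a [c0 [l [l' [c' [H E1 /cc_inj E _ _]]]]]]|[]|[i [_ [] //]]|[]] //.
by subst c0; case: a E1 H => // _; case: c n1 n2 n3.
Qed.

(* [d ++ r] is the content of a circular tape on which the control is
   about to replace the first letter of [r]. *)
Definition sem (c : ctl) (d r : seq letter) : Prop :=
  match c with
  | CI => False
  | CJE => d = [::] /\ exists2 cf, reach w cf & encodes cf (d ++ r)
  | CR => exists2 cf, reach w cf & encodes cf (d ++ r)
  | CAcc => accepts w
  | CE c o => forall r', r = inl c :: r' ->
      exists2 cf, reach w cf & encodes cf (d ++ o :: r')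
  | CH c => forall r', r = inl c :: r' -> accepts w
  | CL b q c c' => forall r', r = inr q :: inl c :: r' ->
      exists2 cf, reach w cf & encodes cf (d ++ inl b :: inl c' :: r')
  end.

(** Inside a window [sem] speaks of the word as it will be when the window is finished, provided
    that the expected letters follow. So the machine step is taken when the window is opened, and
    the remaining letters just discharge the proviso. An empty [d] is a row boundary. *)
Lemma sem_step a c o p c' d r : okM a c o p c' -> (d = [::] -> a) ->
  sem c d (o :: r) -> sem c' (rcons d p) r.
Proof.
case: c => [||||c1 o1|c1|b q c1 c2] //=.
- case: a => /=.
    case/and3P => _ /eqP -> /eqP -> _ [-> [cf H1 H2]]; exists cf => //=.
  by move=> _ H [/H].
- move=> Hok Hd [cf Hr [l [rr [Ew Ht]]]]; case: o Ew Hok => [b|q] Ew.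
    case/orP => [/andP [/eqP -> /eqP ->] /=|/andP [_]].
      by exists cf => //; exists l, rr; rewrite cat_rcons.
    case: c' => // b' q c1 c2; case: p => // q' /andP [/eqP -> Ha] /= r' Er.
    move: Ew; rewrite Er -cat_rcons => /conf_word_split [E1 E2 E3].
    case: rr E3 Ht => //= c0 rr [<- E3] Ht.
    case/lastP: l E1 Ht => [|l b0]; first by case: (d).
    rewrite map_rcons => /rcons_inj [Ed Eb] Ht.
    move: Eb => [Eb]; rewrite -{b0}Eb in Ht.
    rewrite E2 -(actionsE Ht) in Ha.
    exists (act cf (q', [ffun=> (c2, MoveLeft)])); first exact: reach_act Hr Ha.
    exists l, (b :: c2 :: rr); split; last exact: tape_left Ht.
    by rewrite /conf_word /= -E3 -Ed cat_rcons.
  case/andP => _; case/conf_word_split: Ew => Ed Eq Er.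
  case: c' => // [c1 o1|c1].
    case: p => [c2|q']; case: o1 => [c3|q3] // Ha /= r' Er'.
      case: rr Er Ht => [|c0 rr]; rewrite Er' //= => -[<- E3] Ht.
      rewrite Eq -(actionsE Ht) in Ha.
      exists (act cf (q3, [ffun=> (c2, MoveRight)])); first exact: reach_act Hr Ha.
      exists (rcons l c2), rr; split; last exact: tape_right Ht.
      by rewrite /conf_word /= -E3 map_rcons -Ed.
    case: rr Er Ht => [|c0 rr]; rewrite Er' //= => -[<- E3] Ht.
    rewrite Eq -(actionsE Ht) in Ha.
    exists (act cf (q', [ffun=> (c3, Stay)])); first exact: reach_act Hr Ha.
    exists l, (c3 :: rr); split; last exact: tape_stay Ht.
    by rewrite /conf_word /= -E3 cat_rcons -Ed.
  case/and3P => /eqP -> Hacc Hh /= r' Er'.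
  case: rr Er Ht => [|c0 rr]; rewrite Er' //= => -[<- E3] Ht.
  case: Hr => n Hr; exists n, cf; split=> //; last by rewrite -Eq.
  by rewrite /halted (actionsE Ht) -Eq.
- by case/andP => _ /eqP -> _ H.
- by case/and4P => _ /eqP -> /eqP -> /eqP -> _ H; rewrite /= cat_rcons; apply: H.
- by case/and4P => _ /eqP -> _ /eqP -> _ H; apply: H.
- case/and4P => _ /eqP -> /eqP -> /eqP -> _ H /= r' Er.
  by rewrite cat_rcons; apply: H; rewrite Er.
Qed.

Section Run.
Variables sg o p : nat -> nat.
Hypothesis sg0 : sg 0 = 0.
Hypothesis HDelta : forall i, i < K -> (flag m i, sg i, o i, p i, sg i.+1) \in Delta w.
Hypothesis Hqueue : forall i, i + P < K -> p i = o (i + P).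

Definition wl : seq C := [seq Some (inl b) | b <- w].

(** The three stages of row 0: leading blanks, start state with a prefix of the input, and trailing
    blanks. *)
Definition row0 i : Prop :=
  [\/ sg i = 0 /\ mkseq p i = nseq i blank,
      (exists a k, [/\ k <= size w, sg i = base + k &
         mkseq p i = nseq a blank ++ lc (inr (start M)) :: map lc (map inl (take k wl))])
    | (exists a b, sg i = cc CJE /\
         mkseq p i = nseq a blank ++ lc (inr (start M)) :: map lc (map inl (wl ++ nseq b None)))].

Lemma mkseqSr (f : nat -> nat) n : mkseq f n.+1 = rcons (mkseq f n) (f n).
Proof. by rewrite /mkseq -[n.+1]addn1 iotaD map_cat /= cats1 add0n. Qed.

Lemma row0P i : i <= P -> row0 i.
Proof.
have PK : P < K by rewrite horizonE -{1}[P]muln1 ltn_pmul2l ?period_gt1 ?period_gt0.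
elim: i => [|i IH] Hi; first by apply: Or31.
have {IH} := IH (ltnW Hi).
have f0 : flag m i = 0.
  rewrite /flag; case: (posnP i) => //= i0; apply/eqP.
  by rewrite eqb0; apply: contraL Hi => /(dvdn_leq i0); rewrite -leqNgt.
have := HDelta (ltn_trans Hi PK); rewrite f0 /row0 !mkseqSr => HD.
have cI : cc CI = 0 by rewrite /cc eqxx.
have cJ0 : cc CJE <> 0 by rewrite /cc.
case=> [[E1 E2]|[a [k [Hk E1 E2]]]|[a [b [E1 E2]]]].
- rewrite E1 in HD; rewrite E2.
  case/DeltaP: HD => [[x [c [l [l' [c' [H E3 E4 _ [E5 E6]]]]]]]|[_ _ _ E5 E6]|[j [_ [_ E] _ _ _]]|[_ E _ _ _]].
  + have {}E4 : CI = c by apply: cc_inj; rewrite cI.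
    subst c.
    move: H => /and4P [_ _ /eqP E7 /eqP E8]; apply: Or31.
    rewrite E6 E8 cI E5 E7; split=> //.
    by rewrite -cats1 -[[:: _]]/(nseq 1 blank) -nseqD addn1.
  + apply: Or32; exists i, 0; rewrite E5 E6 addn0; split=> //.
    by rewrite take0 /= cats1.
  + by move: E; rewrite /code_base; lia.
  + by move: E; rewrite /code_base; lia.
- rewrite E1 in HD; rewrite E2.
  case/DeltaP: HD => [[x [c [l [l' [c' [H E3 E4 _ _]]]]]]|[_ E _ _ _]|[j [Hj [_ E] _ E5 E6]]|[_ E _ E5 E6]].
  + by have := cc_lt c; rewrite -E4 ltnNge leq_addr.
  + by move: E; rewrite /code_base; lia.
  + move: E => /addnI E; subst j; apply: Or32; exists a, k.+1; split=> //.
    rewrite E5 rcons_cat /= (take_nth None) ?size_map // !map_rcons.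
    by rewrite (nth_map false).
  + move: E => /addnI E; apply: Or33; exists a, 1; split=> //.
    rewrite E5 E take_oversize ?size_map // rcons_cat /= !map_cat /=.
    by rewrite cats1.
- rewrite E1 in HD; rewrite E2.
  case/DeltaP: HD => [[x [c [l [l' [c' [H E3 /cc_inj E4 _ [E5 E6]]]]]]]|[_ E _ _ _]|[j [Hj [_ E] _ _ _]]|[_ E _ _ _]].
  + subst c; case: x H E3 => //= /and3P [_ /eqP E7 /eqP E8] _.
    apply: Or33; exists a, b.+1; rewrite E6 E8; split=> //.
    have -> : wl ++ nseq b.+1 None = (wl ++ nseq b None) ++ [:: None].
      by rewrite -[b.+1]addn1 nseqD catA.
    by set X := wl ++ _; rewrite E5 E7 rcons_cat /= !map_cat /= cats1.
  + by [].
  + by have := cc_lt CJE; rewrite E ltnNge leq_addr.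
  + by have := cc_lt CJE; rewrite E ltnNge leq_addr.
Qed.

(** The queue as a circular tape: [d] holds the letters pushed in the current row, and [r] those of
    the previous row that are still to be popped. The alternative is a row boundary at which the
    control has no transition. *)
Definition circ i : Prop := exists d r : seq letter,
  [/\ size d = i %% P, size d + size r = P,
      (forall k, k < size d -> lc (nth (inl None) d k) = p (i - i %% P + k)),
      (forall k, k < size r -> lc (nth (inl None) r k) = p (i - P + k))
    & (exists2 c, sg i = cc c & sem c d r) \/ d = [::] /\ stuck (sg i)].

Lemma circP i : P <= i <= K -> circ i.
Proof.
have P0 := period_gt0 m.
have PK : P < K by rewrite horizonE -{1}[P]muln1 ltn_pmul2l ?period_gt1 ?period_gt0.
elim: i => [|i IH]; first by rewrite leqNgt P0.
rewrite leq_eqVlt ltnS => /andP [/orP [/eqP <-|HPi] HiK].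
  have mP : P %% P = 0 by rewrite modnn.
  case: (row0P (leqnn P)) => [[E1 E2]|[a [k [Hk E1 E2]]]|[a [b [E1 E2]]]].
  (* In this case and the next, row 0 ends before the initial configuration is complete, and the
     control is stuck at the boundary. *)
  - exists [::], (nseq P (inl None)); rewrite mP subnn size_nseq; split=> //.
      by move=> k Hk; rewrite nth_nseq Hk add0n -(nth_mkseq 0 p Hk) E2 nth_nseq Hk.
    right; split=> //; rewrite E1; have : stuck (cc CI) by apply: stuck_cc.
    by rewrite /cc eqxx.
  - exists [::], (nseq a (inl None) ++ inr (start M) :: map inl (take k wl)).
    set r := _ ++ _; have Er : map lc r = mkseq p P.
      by rewrite E2 /r map_cat /= map_nseq.
    have Sr : size r = P by have := congr1 size Er; rewrite size_map size_mkseq.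
    rewrite mP subnn add0n; split=> //; last by right; rewrite E1; split=> //; apply: stuck_base.
    by move=> j Hj; rewrite add0n -(nth_map _ 0) // Er nth_mkseq // -Sr.
  - exists [::], (conf_word (nseq a None) (start M) (wl ++ nseq b None)).
    set r := conf_word _ _ _; have Er : map lc r = mkseq p P.
      by rewrite E2 /r /conf_word !map_cat /= !map_nseq !map_cat !map_nseq.
    have Sr : size r = P by have := congr1 size Er; rewrite size_map size_mkseq.
    rewrite mP subnn add0n; split=> //.
      by move=> j Hj; rewrite add0n -(nth_map _ 0) // Er nth_mkseq // -Sr.
    left; exists CJE => //; split=> //; exists (init_conf M w); first by exists 0; apply: run0.
    exists (nseq a None), (wl ++ nseq b None); split=> //; split; rewrite /= ffunE /= => j.
      by rewrite rev_nseq nth_nseq nth_nil; case: ifP.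
    rewrite nth_cat; case: ltnP => // Hj; rewrite nth_nseq [RHS]nth_default //.
    by case: ifP.
have [|d [r [Sd Sr Hd Hr Hs]]] := IH; first by rewrite HPi ltnW.
have HD := HDelta HiK.
have i0 : 0 < i by apply: leq_trans HPi.
have Ef : flag m i = (d == [::]) by rewrite /flag i0 /= -size_eq0 Sd.
case: Hs => [[c Ec Hsem]|[Ed Hst]]; last first.
  by move: HD; rewrite Ef Ed /= => HD; have := Hst (o i) (p i) (sg i.+1); rewrite HD.
case: r Sr Hr Hsem => [|a r] /= Sr Hr Hsem.
  by have := ltn_pmod i P0; rewrite -Sd -Sr addn0 ltnn.
have Eo : o i = lc a.
  have := Hr 0 isT => /= ->; rewrite addn0 Hqueue ?subnK //.
have /DeltaP [] := HD.
- case=> [x [c0 [l [l' [c' [H Ex E4 El [Ep Ec']]]]]]].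
  have {E4} E4 : c0 = c by apply: cc_inj; rewrite -E4.
  have {El} El : l = a by apply: lc_inj; rewrite -El.
  subst c0 l; have Hdx : d = [::] -> x by move=> E; move: Ex; rewrite Ef E; case: x {H}.
  have Hsem' := sem_step H Hdx Hsem.
  have Em : i.+1 %% P = if r is [::] then 0 else (i %% P).+1.
    case: r Sr {Hr Hsem Hsem'} => [|a' r] /= Sr.
      by apply/eqP; rewrite -/(dvdn P i.+1) -addn1 (divn_eq i P) -addnA -Sd addn1 -[(size d).+1]addn1 Sr
        -[X in _ %| _ + X]mul1n -mulnDl dvdn_mull.
    rewrite -addn1 -modnDml addn1 modn_small // -Sd -Sr. by rewrite !addnS !ltnS leq_addr.
  have [Hmod1 Hmod2] : i - i %% P + i %% P = i /\ i - P + P = i.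
    by rewrite !subnK // leq_mod.
  case: r Sr Hr Hsem Hsem' Em => [|a' r] Sr Hr Hsem Hsem' Em.
    (* The row is complete, and what was pushed in it becomes the part to be popped. A control
       inside a window is stuck now. *)
    exists [::], (rcons d l'); rewrite Em size_rcons; split=> //.
    + by rewrite -Sr /= addn1.
    + move=> k; rewrite ltnS nth_rcons => Hk; case: ltngtP Hk => // [Hk _|-> _].
        by rewrite Hd // -Sd -Sr addn1 subSS.
      by rewrite -Ep -Sr addn1 subSS subnK // Sd leq_mod.
    + case E1: (c' == CJE) => //.
        by left; exists c' => //; move/eqP: E1 Hsem' => -> /= [] ; case: (d).
      case E2: (c' == CR).
        by left; exists c' => //; move/eqP: E2 Hsem' => -> /=; rewrite cats0.
      case E3: (c' == CAcc).
        by left; exists c' => //; move/eqP: E3 Hsem' => ->.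
      by right; split=> //; rewrite Ec'; apply: stuck_cc; rewrite ?E1 ?E2 ?E3.
  exists (rcons d l'), (a' :: r); rewrite Em size_rcons Sd; split=> //.
  + by rewrite addSnnS -Sd; exact: Sr.
  + move=> k; rewrite ltnS nth_rcons => Hk; rewrite Sd.
    rewrite subSS.
    case: ltngtP Hk => // [Hk _|-> _]; first by rewrite Hd // Sd.
    by rewrite Hmod1.
  + move=> k Hk; have -> : i.+1 - P + k = i - P + k.+1 by rewrite subSn // addnS.
    by have := Hr k.+1 Hk.
  + by left; exists c'.
- case=> _ E _ _ _; have : cc c = cc CI by rewrite -Ec E /cc eqxx.
  by move/cc_inj => Ec0; move: Hsem; rewrite Ec0.
- case=> j [_ [_ E] _ _ _]; have := cc_lt c; by rewrite -Ec E ltnNge leq_addr.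
- case=> _ E _ _ _; have := cc_lt c; by rewrite -Ec E ltnNge leq_addr.
Qed.

Lemma run_accepts : sg K = cc CAcc -> accepts w.
Proof.
move=> HK; have [|d [r [_ _ _ _ [[c Ec Hs]|[_ Hst]]]]] := @circP K.
- by rewrite leqnn horizonE leq_pmulr ?period_gt0.
- by move: Ec Hs; rewrite HK => /cc_inj <-.
- have := Hst (lc (inl None)) (lc (inl None)) (cc CAcc); rewrite HK.
  have H : okM true CAcc (inl None) (inl None) CAcc by rewrite /= !eqxx.
  by rewrite (Delta_okM w H).
Qed.

End Run.

Lemma queue_sound : queue_run m (cc CAcc) (Delta w) -> accepts w.
Proof. by case=> sg [o [p [H1 H2 H3 H4]]]; apply: (run_accepts H1 H3 H4 H2). Qed.

End QueueSound.

(** * From accepting computations to queue runs *)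

Section QueueComplete.
Context (m : nat) (w : word).
Hypothesis m_gt0 : 0 < m.
Local Notation P := (period m).
Local Notation K := (horizon m).
Local Notation lnth := (nth (inl None : letter)).

Section Paths.
Variables o p : nat -> nat.

Definition qpath i j s s' : Prop := exists sg : nat -> nat,
  [/\ sg i = s, sg j = s' &
      forall u, i <= u < j -> (flag m u, sg u, o u, p u, sg u.+1) \in Delta w].

Lemma qpath_const s i j : i <= j ->
  (forall u, i <= u < j -> (flag m u, s, o u, p u, s) \in Delta w) -> qpath i j s s.
Proof. by exists (fun _ => s). Qed.

Lemma qpath_step s s' i : (flag m i, s, o i, p i, s') \in Delta w -> qpath i i.+1 s s'.
Proof.
move=> H; exists (fun u => if u == i then s else s'); rewrite eqxx; split=> //.
  by rewrite gtn_eqF.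
move=> u; rewrite ltnS -eqn_leq => /eqP <-; by rewrite eqxx gtn_eqF.
Qed.

Lemma qpath_trans i j k s s' s'' : i <= j -> j <= k ->
  qpath i j s s' -> qpath j k s' s'' -> qpath i k s s''.
Proof.
move=> Hij Hjk [f [f1 f2 f3]] [g [g1 g2 g3]].
exists (fun u => if u < j then f u else g u); split.
- case: ltnP => // H; have Eij : i = j by apply/eqP; rewrite eqn_leq Hij H.
  by rewrite Eij g1 -f2 -Eij f1.
- by rewrite ltnNge Hjk.
- move=> u /andP [Hiu Huk]; case: (ltngtP u.+1 j) => Huj.
  + by apply: f3; rewrite Hiu (ltnW Huj).
  + by apply: g3; rewrite Huk andbT.
  + by rewrite Huj g1 -f2 -Huj; apply: f3; rewrite Hiu -Huj leqnn.
Qed.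

End Paths.

(* The [flag] is 0, so a [pass] does not contain the beginning of a row. *)
Inductive pass : nat -> seq nat -> seq nat -> nat -> Prop :=
| pass_nil s : pass s [::] [::] s
| pass_cons s a b s1 u v s' : (0, s, a, b, s1) \in Delta w -> pass s1 u v s' ->
    pass s (a :: u) (b :: v) s'.

Lemma pass_cat s u v s1 u' v' s' : pass s u v s1 -> pass s1 u' v' s' ->
  pass s (u ++ u') (v ++ v') s'.
Proof. by elim=> //= s0 a b s2 {}u {}v s3 Hd _ IH /IH; apply: pass_cons. Qed.

Lemma pass_okM s a b s1 u v s' : okM false s a b s1 -> pass (cc s1) u v s' ->
  pass (cc s) (lc a :: u) (lc b :: v) s'.
Proof. by move/(Delta_okM w); apply: pass_cons. Qed.

Lemma pass_loop s n a : (0, s, a, a, s) \in Delta w -> pass s (nseq n a) (nseq n a) s.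
Proof. by move=> H; elim: n => [|n IH]; [apply: pass_nil|apply: pass_cons IH]. Qed.

Lemma pass_keep s (u : seq letter) : (forall a, a \in u -> okM false s a a s) ->
  pass (cc s) (map lc u) (map lc u) (cc s).
Proof.
elim: u => [|a u IH] H; first exact: pass_nil.
apply: pass_okM; first by apply: H; rewrite mem_head.
by apply: IH => b Hb; apply: H; rewrite inE Hb orbT.
Qed.

Definition agree (f : nat -> nat) i (u : seq nat) := forall k, k < size u -> f (i + k) = nth 0 u k.

Lemma pass_path o p i s u v s' : pass s u v s' -> (forall k, k < size u -> flag m (i + k) = 0) ->
  agree o i u -> agree p i v -> qpath o p i (i + size u) s s'.
Proof.
move=> H; elim: H i => {s u v s'} [s|s a b s1 u v s' Hd _ IH] i Hf Ho Hp.
  by rewrite addn0; apply: qpath_const => // k; rewrite ltnNge andbN.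
have Hf0 := Hf 0 isT; have Ho0 := Ho 0 isT; have Hp0 := Hp 0 isT; rewrite !addn0 /= in Hf0 Ho0 Hp0.
apply: (@qpath_trans _ _ _ i.+1 _ _ s1) => //.
- by rewrite addnS ltnS leq_addr.
- by apply: qpath_step; rewrite Hf0 Ho0 Hp0.
rewrite addnS -addSn; apply: IH => k Hk; rewrite addSnnS; [exact: Hf|exact: (Ho k.+1)|exact: (Hp k.+1)].
Qed.

(** Quantifying over the position and over all letter sequences that agree with [u] and [v] there
    allows single rows to be treated before the sequences of the whole run exist. *)
Definition row_ok (u v : seq letter) (s s' : ctl) : Prop := forall o p t,
  0 < t -> agree o (t * P) (map lc u) -> agree p (t * P) (map lc v) ->
  qpath o p (t * P) (t * P + P) (cc s) (cc s').

Lemma flag_row t k : k < P -> flag m (t * P + k) = (0 < t) && (k == 0).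
Proof.
move=> Hk; rewrite /flag addn_gt0 muln_gt0 period_gt0 andbT; congr nat_of_bool.
rewrite dvdn_addr ?dvdn_mull //; case: (eqVneq k 0) => [->|k0].
  by rewrite dvdn0 ltnn orbF.
rewrite andbF; apply/negbTE/negP => /andP [_ Hdvd].
have k1 : 0 < k by rewrite lt0n.
by have := dvdn_leq k1 Hdvd; rewrite leqNgt Hk.
Qed.

Lemma row_first a b (u v : seq letter) s s1 s' : (size u).+1 = P -> okM true s a b s1 ->
  pass (cc s1) (map lc u) (map lc v) (cc s') -> row_ok (a :: u) (b :: v) s s'.
Proof.
move=> Es Hok Hu o p t Ht Ho Hp.
have Ho0 := Ho 0 isT; have Hp0 := Hp 0 isT; rewrite !addn0 /= in Ho0 Hp0.
have F0 : flag m (t * P) = 1 by rewrite -[t * P]addn0 flag_row ?period_gt0 // Ht.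
apply: (@qpath_trans _ _ _ (t * P).+1 _ _ (cc s1)) => //.
- by rewrite -Es addnS ltnS leq_addr.
- by apply: qpath_step; rewrite F0 Ho0 Hp0; apply: Delta_okM Hok.
have -> : t * P + P = (t * P).+1 + size (map lc u) by rewrite size_map -Es addSnnS.
apply: (pass_path Hu) => k Hk; rewrite addSnnS; [|exact: (Ho k.+1)|exact: (Hp k.+1)].
by rewrite size_map in Hk; rewrite flag_row ?andbF // -Es.
Qed.

(** The window [u] must not touch the first letter of the row, which can only be copied; hence [l]
    is nonempty. *)
Lemma row_pass (l r : seq C) (u v : seq letter) s0 s' :
  0 < size l -> size l + size u + size r = P ->
  s0 \in [:: CJE; CR] -> s' \in [:: CR; CAcc] -> pass (cc CR) (map lc u) (map lc v) (cc s') ->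
  row_ok (map inl l ++ u ++ map inl r) (map inl l ++ v ++ map inl r) s0 s'.
Proof.
have keep s (x : seq C) : s \in [:: CR; CAcc] ->
    pass (cc s) (map lc (map inl x)) (map lc (map inl x)) (cc s).
  move=> Hs; apply: pass_keep => a /mapP [c _ ->].
  by move: Hs; rewrite !inE => /orP [/eqP ->|/eqP ->] /=; rewrite !eqxx.
case: l => // b l _ Es H0 H' Hu; apply: (row_first (s1 := CR)).
- by rewrite -Es !size_cat !size_map /= addSn addnA.
- by move: H0; rewrite !inE => /orP [/eqP ->|/eqP ->] /=; rewrite !eqxx.
- by rewrite !map_cat; apply: pass_cat (keep CR l isT) (pass_cat Hu (keep s' r H')).
Qed.

Lemma row_acc (u : seq letter) : size u = P -> row_ok u u CAcc CAcc.
Proof.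
case: u => [|a u] Es; first by have := period_gt0 m; rewrite -Es.
apply: (row_first (s1 := CAcc) Es); first by rewrite /= !eqxx.
by apply: pass_keep => b _; rewrite /= !eqxx.
Qed.

(** A step moves the head by at most one cell, so [n] steps use up at most [n] cells on either side.
    The margin of 2 keeps the scanned cell inside the word and the window off the first letter. *)
Lemma run_rows n (c cf : tmconf M) l r :
  run n c cf -> halted cf -> cstate cf \in accepting M ->
  tape_lr c l r -> n + 2 <= size l -> n + 2 <= size r -> size l + (size r).+1 = P ->
  exists ws : nat -> seq letter, [/\ ws 0 = conf_word l (cstate c) r,
    forall t, t <= n -> size (ws t) = P,
    forall t s0, t < n -> s0 \in [:: CJE; CR] -> row_ok (ws t) (ws t.+1) s0 CR
    & forall s0, s0 \in [:: CJE; CR] -> row_ok (ws n) (ws n) s0 CAcc].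
Proof.
move=> H; elim: H l r => [{}c|{}n {}c a {}cf Ha _ IH] l [|c0 r] Hh Hacc Ht Hl //= Hr Hs.
  exists (fun _ => conf_word l (cstate c) (c0 :: r)); split=> //.
    by move=> t _; rewrite /conf_word size_cat /= !size_map.
  move=> s0 H0; rewrite /conf_word.
  apply: (@row_pass l r [:: inr (cstate c); inl c0] [:: inr (cstate c); inl c0] s0 CAcc) => //.
  - by apply: leq_trans Hl.
  - by rewrite -Hs /= !addnS addn0 !addSn.
  - cbn [map]; apply: (pass_okM (s1 := CH c0)); first by rewrite /= eqxx Hacc -(actionsE Ht).
    by apply: pass_okM (pass_nil _); rewrite /= !eqxx.
case: a Ha IH => q' f; rewrite (ffun_I1 f); case: (f ord0) => c' mv {f} Ha IH.
have Ha' := Ha; rewrite (actionsE Ht) in Ha'.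
have {IH} next l2 r2 : tape_lr (act c (q', [ffun=> (c', mv)])) l2 r2 ->
  n + 2 <= size l2 -> n + 2 <= size r2 -> size l2 + (size r2).+1 = P ->
  (forall s0, s0 \in [:: CJE; CR] ->
     row_ok (conf_word l (cstate c) (c0 :: r)) (conf_word l2 q' r2) s0 CR) ->
  exists ws : nat -> seq letter, [/\ ws 0 = conf_word l (cstate c) (c0 :: r),
    forall t, t <= n.+1 -> size (ws t) = P,
    forall t s0, t < n.+1 -> s0 \in [:: CJE; CR] -> row_ok (ws t) (ws t.+1) s0 CR
    & forall s0, s0 \in [:: CJE; CR] -> row_ok (ws n.+1) (ws n.+1) s0 CAcc].
  move=> Ht2 Hl2 Hr2 Hs2 Hrow.
  have [ws [w0 w1 w2 w3]] := IH l2 r2 Hh Hacc Ht2 Hl2 Hr2 Hs2.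
  exists (fun t => if t is t'.+1 then ws t' else conf_word l (cstate c) (c0 :: r)).
  split=> //.
  - case=> [_|t]; last exact: w1.
    by rewrite /conf_word size_cat /= !size_map.
  - case=> [|t] s0 Hlt H0; last exact: w2.
    by rewrite w0; apply: Hrow.
have Hl2 : n + 2 < size l by [].
have Hr2 : n + 2 <= size r by [].
have l0 : 0 < size l by apply: leq_ltn_trans Hl2.
case: mv Ha Ha' next => Ha Ha' next.
- case/lastP: l l0 Hl Hl2 Hs Ht next => // l b _ Hl Hl2 Hs Ht next.
  rewrite size_rcons ltnS in Hl2; rewrite size_rcons in Hs.
  apply: (next l (b :: c' :: r)) => //; first exact: tape_left Ht.
  + by rewrite /= !leqW.
  + by rewrite /= -Hs addSnnS.
  move=> s0 H0; rewrite /conf_word map_rcons cat_rcons /=.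
  apply: (@row_pass l r [:: inl b; inr (cstate c); inl c0] [:: inr q'; inl b; inl c'] s0 CR) => //.
  + by apply: leq_trans Hl2; rewrite addn2.
  + by rewrite -Hs /= !addnS !addSn addn0.
  + cbn [map]; apply: (pass_okM (s1 := CL b (cstate c) c0 c')); first by rewrite /= eqxx Ha'.
    apply: (pass_okM (s1 := CE c0 (inl c'))); first by rewrite /= !eqxx.
    by apply: pass_okM (pass_nil _); rewrite /= !eqxx.
- apply: (next l (c' :: r)) => //; first exact: tape_stay Ht.
  + exact: ltnW.
  + exact: leqW.
  move=> s0 H0; rewrite /conf_word /=.
  apply: (@row_pass l r [:: inr (cstate c); inl c0] [:: inr q'; inl c'] s0 CR) => //.
  + by rewrite -Hs /= !addnS addn0 !addSn.
  + cbn [map]; apply: (pass_okM (s1 := CE c0 (inl c'))) => //.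
    by apply: pass_okM (pass_nil _); rewrite /= !eqxx.
- apply: (next (rcons l c') r) => //; first exact: tape_right Ht.
  + by rewrite size_rcons leqW // ltnW.
  + by rewrite size_rcons -Hs addSnnS.
  move=> s0 H0; rewrite /conf_word map_rcons cat_rcons /=.
  apply: (@row_pass l r [:: inr (cstate c); inl c0] [:: inl c'; inr q'] s0 CR) => //.
  + by rewrite -Hs /= !addnS addn0 !addSn.
  + cbn [map]; apply: (pass_okM (s1 := CE c0 (inr q'))) => //.
    by apply: pass_okM (pass_nil _); rewrite /= !eqxx.
Qed.

Lemma pass_input j : j <= size w -> pass (base + (size w - j)) (nseq j blank)
  (map lc (map inl (wl (drop (size w - j) w)))) (base + size w).
Proof.
elim: j => [|j IH] Hj; first by rewrite subn0 drop_size; apply: pass_nil.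
have Hlt : size w - j.+1 < size w by clear -Hj; lia.
have E : size w - j = (size w - j.+1).+1 by rewrite subnSK.
rewrite (drop_nth false Hlt); apply: pass_cons (Delta_input Hlt) _.
by rewrite -E; apply: IH; apply: ltnW.
Qed.

(** There is at least one trailing blank, since it is the transition out of the input states that
    pushes the first one. *)
Lemma row_init (a b : nat) o p : a + (size w + b.+1).+1 = P ->
  (forall k, k < P -> o k = blank) ->
  agree p 0 (map lc (conf_word (nseq a None) (start M) (wl w ++ nseq b.+1 None))) ->
  qpath o p 0 P 0 (cc CJE).
Proof.
move=> Es Ho Hp.
have H : pass 0 (nseq P blank)
    (map lc (conf_word (nseq a None) (start M) (wl w ++ nseq b.+1 None))) (cc CJE).
  have -> : map lc (conf_word (nseq a None) (start M) (wl w ++ nseq b.+1 None)) =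
      nseq a blank ++ lc (inr (start M)) :: map lc (map inl (wl w)) ++ nseq b.+1 blank.
    by rewrite /conf_word; move: b.+1 => b1; rewrite !map_cat /= !map_cat !map_nseq.
  rewrite -Es nseqD -[nseq _.+1 _]/(blank :: nseq (size w + b.+1) blank) nseqD; apply: pass_cat.
    apply: pass_loop; have := @Delta_okM w false CI (inl None) (inl None) CI.
    by rewrite (_ : cc CI = 0) ?/cc ?eqxx //; apply; rewrite /= !eqxx.
  apply: pass_cons (Delta_start w) _; apply: pass_cat.
    by have := pass_input (leqnn (size w)); rewrite subnn drop0 addn0; apply.
  apply: pass_cons (Delta_last w) _; apply: pass_loop.
  by apply: (@Delta_okM w false CJE (inl None) (inl None) CJE); rewrite /= !eqxx.
have := pass_path (i := 0) H; rewrite size_nseq; apply=> // k.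
  by move=> Hk; have := flag_row 0 Hk; rewrite mul0n add0n.
by rewrite size_nseq => Hk; rewrite nth_nseq Hk; apply: Ho.
Qed.

Lemma queue_complete n cf :
  run n (init_conf M w) cf -> halted cf -> cstate cf \in accepting M ->
  2 * n + size w + 5 <= P -> queue_run m (cc CAcc) (Delta w).
Proof.
move=> Hrun Hh Hacc Hsize.
(* A row consists of [n + 2] blanks, the state, the input and [b + 1] blanks; the bound on [P] makes
   the right part long enough even for an empty input. *)
pose b := P - (n + size w + 4).
have Es : n + 2 + (size w + b.+1).+1 = P by rewrite /b; clear -Hsize; lia.
have Hb : n + 2 <= size w + b.+1 by rewrite /b; clear -Hsize; lia.
have P0 : 0 < P by apply: period_gt0.
have [||||ws [w0 w1 w2 w3]] := @run_rows n _ cf (nseq (n + 2) None) (wl w ++ nseq b.+1 None) Hrun Hh Hacc.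
- split; rewrite /= ffunE /= => j.
    by rewrite rev_nseq nth_nseq nth_nil; case: ifP.
  rewrite nth_cat; case: ltnP => // Hj; rewrite -[None :: _]/(nseq b.+1 None) nth_nseq [RHS]nth_default //.
  by case: ifP.
- by rewrite size_nseq.
- by rewrite size_cat size_map size_nseq.
- by rewrite size_nseq size_cat size_map size_nseq.
(* Once the machine has halted, its last configuration is repeated: row [n + 1] verifies acceptance,
   and the later rows are copied in state [CAcc]. *)
pose Ws t := ws (minn t n).
pose o v := if v < P then blank else lc (lnth (Ws (v %/ P).-1) (v %% P)).
pose p v := lc (lnth (Ws (v %/ P)) (v %% P)).
have SW t : size (Ws t) = P by apply: w1; apply: geq_minr.
have Ap t : agree p (t * P) (map lc (Ws t)).
  move=> k; rewrite size_map SW => Hk; rewrite (nth_map (inl None)) ?SW // /p divnMDl // divn_small // addn0.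
  by rewrite modnMDl modn_small.
have Ao t : agree o (t.+1 * P) (map lc (Ws t)).
  move=> k; rewrite size_map SW => Hk; rewrite (nth_map (inl None)) ?SW // /o ltnNge mulSn -addnA leq_addr /=.
  by rewrite addnA -mulSn divnMDl // divn_small // addn0 modnMDl modn_small.
pose st t : ctl := if t == 0 then CJE else if t <= n then CR else CAcc.
have Hst t : t <= n -> st t \in [:: CJE; CR].
  by rewrite /st => ->; case: ifP; rewrite !inE eqxx ?orbT.
have path t : qpath o p 0 (t.+1 * P) 0 (cc (st t)).
  elim: t => [|t IH].
    rewrite mul1n; apply: (row_init Es) => //.
      by move=> k Hk; rewrite /o Hk.
    by have := Ap 0; rewrite mul0n /Ws min0n w0.
  apply: (@qpath_trans _ _ _ (t.+1 * P) _ _ (cc (st t))) => //.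
    by rewrite leq_mul2r leqnSn orbT.
  rewrite [t.+2 * P]mulSn addnC.
  have row : row_ok (Ws t) (Ws t.+1) (st t) (st t.+1).
    rewrite /Ws; case: (ltngtP t n) => Htn.
    - rewrite ?(minn_idPl Htn) ?(minn_idPl (ltnW Htn)).
      have -> : st t.+1 = CR by rewrite /st /= Htn.
      by apply: w2 => //; apply: Hst; apply: ltnW.
    - rewrite ?(minn_idPr (ltnW Htn)) ?(minn_idPr (leqW (ltnW Htn))).
      have -> : st t.+1 = CAcc by rewrite /st /= ltnNge (ltnW Htn).
      have -> : st t = CAcc by rewrite /st leqNgt Htn /= gtn_eqF // (leq_ltn_trans _ Htn).
      by apply: row_acc; apply: w1.
    - rewrite Htn ?minnn ?(minn_idPr (leqnSn n)).
      have -> : st n.+1 = CAcc by rewrite /st /= ltnn.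
      by apply: w3; apply: Hst.
  exact: row (Ao t) (Ap t.+1).
have := path P.-1; rewrite prednK // -horizonE.
have -> : st P.-1 = CAcc.
  have Hn : n < P.-1 by clear -Hsize; lia.
  by rewrite /st gtn_eqF ?(leq_ltn_trans _ Hn) // leqNgt Hn.
case=> sg [s1 s2 s3]; exists sg, o, p; split=> //.
move=> i Hi; rewrite /p /o ltnNge leq_addl /= -{3}[P]mul1n divnDMl // addn1 /=.
by rewrite modnDr.
Qed.

End QueueComplete.

Theorem queueP m w : 0 < m ->
  (forall n cf, run n (init_conf M w) cf -> 2 * n + size w + 5 <= period m) ->
  queue_run m (cc CAcc) (Delta w) <-> accepts w.
Proof.
move=> m0 Hb; split; first exact: queue_sound.
by case=> n [cf [H1 H2 H3]]; apply: (queue_complete H1 H2 H3); apply: Hb H1.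
Qed.

End Machine.

(** * Structured programs for Turing machines *)

Section Compile.
Context (k : nat).
Local Notation C := (cell void).
Local Notation reads := {ffun 'I_k.+1 -> C}.
Local Notation writes := {ffun 'I_k.+1 -> C * move}.
Local Notation tapes := {ffun 'I_k.+1 -> tape void}.

Inductive prog :=
| PAct of reads -> writes
| PSeq of prog & prog
| PIf of reads -> bool & prog & prog
| PWhile of reads -> bool & prog.

(** For [PIf] and [PWhile], [None] is the additional state in which the test is made. *)
Fixpoint pstate (p : prog) : finType :=
  match p with
  | PAct _ => unit
  | PSeq p q => (pstate p + pstate q)%type
  | PIf _ p q => option (pstate p + pstate q)
  | PWhile _ p => option (pstate p)
  end.

Fixpoint entry (p : prog) : pstate p :=
  match p return pstate p with
  | PAct _ => tt
  | PSeq p q => inl (entry p)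
  | PIf _ p q => None
  | PWhile _ p => None
  end.

Definition idle (r : reads) : writes := [ffun i => (r i, Stay)].

(* A step to [None] leaves the program. *)
Fixpoint pstep (p : prog) : pstate p -> reads -> option (pstate p) * writes :=
  match p return pstate p -> reads -> option (pstate p) * writes with
  | PAct f => fun _ r => (None, f r)
  | PSeq p q => fun s r =>
      match s with
      | inl s => let: (s', a) := pstep s r in
          (Some (if s' is Some s1 then inl s1 else inr (entry q)), a)
      | inr s => let: (s', a) := pstep s r in (omap inr s', a)
      end
  | PIf b p q => fun s r =>
      match s with
      | None => (Some (Some (if b r then inl (entry p) else inr (entry q))), idle r)
      | Some (inl s) => let: (s', a) := pstep s r in (omap (fun s => Some (inl s)) s', a)
      | Some (inr s) => let: (s', a) := pstep s r in (omap (fun s => Some (inr s)) s', a)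
      end
  | PWhile b p => fun s r =>
      match s with
      | None => (if b r then Some (Some (entry p)) else None, idle r)
      | Some s => let: (s', a) := pstep s r in (Some s', a)
      end
  end.

(** The outer [None] has no action, so leaving the program means halting. *)
Definition tm_of (p : prog) : tm k :=
  @TM k (option (pstate p)) void (Some (entry p)) set0
    (fun s r => if s is Some s then [set pstep s r] else set0).

Lemma tm_of_deterministic p : deterministic (tm_of p).
Proof. by case=> [s|] a /=; rewrite ?cards1 ?cards0. Qed.

Definition readt (T : tapes) : reads := [ffun i => read_tape (T i)].
Definition applyt (a : writes) (T : tapes) : tapes := [ffun i => act_tape (T i) (a i)].

Inductive pexit (p : prog) : pstate p -> tapes -> nat -> tapes -> Prop :=
| pexit1 s T a : pstep s (readt T) = (None, a) -> pexit s T 1 (applyt a T)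
| pexitS s s' T a n T' : pstep s (readt T) = (Some s', a) ->
    pexit s' (applyt a T) n T' -> pexit s T n.+1 T'.

Inductive exec : prog -> tapes -> tapes -> nat -> Prop :=
| exec_act f T : exec (PAct f) T (applyt (f (readt T)) T) 1
| exec_seq p q T T1 T2 n1 n2 : exec p T T1 n1 -> exec q T1 T2 n2 ->
    exec (PSeq p q) T T2 (n1 + n2)
| exec_if (b : reads -> bool) p q T T' n :
    exec (if b (readt T) then p else q) (applyt (idle (readt T)) T) T' n ->
    exec (PIf b p q) T T' n.+1
| exec_exit (b : reads -> bool) p T : ~~ b (readt T) ->
    exec (PWhile b p) T (applyt (idle (readt T)) T) 1
| exec_iter (b : reads -> bool) p T T1 T2 n1 n2 : b (readt T) ->
    exec p (applyt (idle (readt T)) T) T1 n1 -> exec (PWhile b p) T1 T2 n2 ->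
    exec (PWhile b p) T T2 (n1 + n2).+1.

Lemma pexit_seq_r p q (s : pstate q) T n T' : pexit s T n T' -> @pexit (PSeq p q) (inr s) T n T'.
Proof.
elim=> {s T n T'} [s T a E|s s' T a n T' E _ IH].
  by apply: pexit1; rewrite /= E.
by apply: pexitS IH; rewrite /= E.
Qed.

Lemma pexit_seq_l p q (s : pstate p) T n T1 n2 T2 : pexit s T n T1 ->
  pexit (entry q) T1 n2 T2 -> @pexit (PSeq p q) (inl s) T (n + n2) T2.
Proof.
move=> H H2; elim: H H2 => {s T n T1} [s T a E|s s' T a n T' E _ IH] H2.
  by apply: pexitS (pexit_seq_r _ H2); rewrite /= E.
by apply: pexitS (IH H2); rewrite /= E.
Qed.

Lemma pexit_if_l b p q (s : pstate p) T n T' : pexit s T n T' ->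
  @pexit (PIf b p q) (Some (inl s)) T n T'.
Proof.
elim=> {s T n T'} [s T a E|s s' T a n T' E _ IH].
  by apply: pexit1; rewrite /= E.
by apply: pexitS IH; rewrite /= E.
Qed.

Lemma pexit_if_r b p q (s : pstate q) T n T' : pexit s T n T' ->
  @pexit (PIf b p q) (Some (inr s)) T n T'.
Proof.
elim=> {s T n T'} [s T a E|s s' T a n T' E _ IH].
  by apply: pexit1; rewrite /= E.
by apply: pexitS IH; rewrite /= E.
Qed.

Lemma pexit_while b p (s : pstate p) T n T1 n2 T2 : pexit s T n T1 ->
  @pexit (PWhile b p) None T1 n2 T2 -> @pexit (PWhile b p) (Some s) T (n + n2) T2.
Proof.
move=> H H2; elim: H H2 => {s T n T1} [s T a E|s s' T a n T' E _ IH] H2.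
  by apply: pexitS H2; rewrite /= E.
by apply: pexitS (IH H2); rewrite /= E.
Qed.

Lemma exec_pexit p T T' n : exec p T T' n -> pexit (entry p) T n T'.
Proof.
elim=> {p T T' n}.
- by move=> f T; apply: pexit1.
- by move=> p q T T1 T2 n1 n2 _ IH1 _ IH2; apply: pexit_seq_l IH1 IH2.
- move=> b p q T T' n _; case E: (b _) => IH.
  + by apply: pexitS (pexit_if_l _ _ IH); rewrite /= E.
  + by apply: pexitS (pexit_if_r _ _ IH); rewrite /= E.
- by move=> b p T /negPf E; apply: pexit1; rewrite /= E.
- move=> b p T T1 T2 n1 n2 E _ IH1 _ IH2.
  by apply: pexitS (pexit_while IH1 IH2); rewrite /= E.
Qed.

Lemma pexit_run p (s : pstate p) T n T' : pexit s T n T' ->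
  run n (@TMConf k (tm_of p) (Some s) T) (@TMConf k (tm_of p) None T').
Proof.
elim=> {s T n T'} [s T a E|s s' T a n T' E _ IH].
- apply: (@runS k (tm_of p) 0 (@TMConf k (tm_of p) (Some s) T) (None, a)); last exact: run0.
  by rewrite /actions /= E inE.
- apply: (@runS k (tm_of p) n (@TMConf k (tm_of p) (Some s) T) (Some s', a)); last exact: IH.
  by rewrite /actions /= E inE.
Qed.

(** A step on an empty right part writes an explicit blank, so tapes can be compared only up to
    trailing blanks. *)
Definition teq (t u : tape void) : Prop :=
  (forall i, nth None t.1 i = nth None u.1 i) /\
  (forall i, nth None t.2 i = nth None u.2 i).

Lemma teq_trans t u v : teq t u -> teq u v -> teq t v.
Proof. by move=> [H1 H2] [H3 H4]; split=> i; rewrite ?H1 ?H2. Qed.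

Lemma teq_read t u : teq t u -> read_tape t = read_tape u.
Proof. by case=> _ H; rewrite /read_tape -!nth0 H. Qed.

Lemma teq_act t u a : teq t u -> teq (act_tape t a) (act_tape u a).
Proof.
case: t u => [l r] [l' r'] [/= H1 H2]; rewrite /act_tape; case: a => c [] /=; split=> /=.
- by move=> i; rewrite !nth_behead.
- by move=> [|[|i]] //=; rewrite ?nth_behead // -!nth0.
- exact: H1.
- by move=> [|i] //=; rewrite !nth_behead.
- by move=> [|i] /=.
- by move=> i; rewrite !nth_behead.
Qed.

Lemma teq_idle t : teq (act_tape t (read_tape t, Stay)) t.
Proof. by case: t => l [|c r]; split=> //= -[|[|i]]. Qed.

Definition hoare (p : prog) (T T' : 'I_k.+1 -> tape void) (c : nat) : Prop :=
  forall tp : tapes, (forall i, teq (tp i) (T i)) ->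
  exists n (tp' : tapes), [/\ n <= c, exec p tp tp' n & forall i, teq (tp' i) (T' i)].

Definition readT (T : 'I_k.+1 -> tape void) : reads := [ffun i => read_tape (T i)].

Lemma readT_teq (tp : tapes) T : (forall i, teq (tp i) (T i)) -> readt tp = readT T.
Proof. by move=> H; apply/ffunP => i; rewrite !ffunE (teq_read (H i)). Qed.

Lemma idle_teq (tp : tapes) T : (forall i, teq (tp i) (T i)) ->
  forall i, teq (applyt (idle (readt tp)) tp i) (T i).
Proof. by move=> H i; rewrite !ffunE; apply: teq_trans (teq_idle _) (H i). Qed.

Lemma hoare_act (f : reads -> writes) T T' :
  (forall i, teq (act_tape (T i) (f (readT T) i)) (T' i)) -> hoare (PAct f) T T' 1.
Proof.
move=> H tp Htp; exists 1, (applyt (f (readt tp)) tp); split=> //; first exact: exec_act.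
by move=> i; rewrite ffunE (readT_teq Htp); apply: teq_trans (teq_act _ (Htp i)) (H i).
Qed.

Lemma hoare_seq p q T T1 T2 c1 c2 :
  hoare p T T1 c1 -> hoare q T1 T2 c2 -> hoare (PSeq p q) T T2 (c1 + c2).
Proof.
move=> Hp Hq tp /Hp [n1 [tp1 [H1 E1 /Hq [n2 [tp2 [H2 E2 H]]]]]].
by exists (n1 + n2), tp2; split=> //; [apply: leq_add|apply: exec_seq E1 E2].
Qed.

Lemma hoare_if b p q T T' c :
  hoare (if b (readT T) then p else q) T T' c -> hoare (PIf b p q) T T' c.+1.
Proof.
move=> Hp tp Htp; have [n [tp' [H E Ht]]] := Hp _ (idle_teq Htp).
by exists n.+1, tp'; split=> //; apply: exec_if; rewrite (readT_teq Htp) in E *.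
Qed.

Lemma hoare_weaken p T T' c c' : c <= c' -> hoare p T T' c -> hoare p T T' c'.
Proof.
move=> Hc Hp tp /Hp [n [tp' [H E Ht]]]; exists n, tp'; split=> //; exact: leq_trans H Hc.
Qed.

(** Every iteration pays one step for its test, and the failing test is the final step. *)
Lemma hoare_while (b : reads -> bool) p (F : nat -> 'I_k.+1 -> tape void) n c :
  (forall i, i < n -> b (readT (F i))) -> ~~ b (readT (F n)) ->
  (forall i, i < n -> hoare p (F i) (F i.+1) c) ->
  hoare (PWhile b p) (F 0) (F n) (n * c.+1).+1.
Proof.
elim: n F => [|n IH] F Hb Hn Hp.
  move=> tp Htp; exists 1, (applyt (idle (readt tp)) tp); split=> //.
    by apply: exec_exit; rewrite (readT_teq Htp).
  exact: idle_teq.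
move=> tp Htp; have [n1 [tp1 [H1 E1 Ht1]]] := Hp 0 isT _ (idle_teq Htp).
have [|||n2 [tp2 [H2 E2 Ht2]]] := IH (fun i => F i.+1) _ _ _ tp1 Ht1.
- by move=> i Hi; apply: Hb.
- exact: Hn.
- by move=> i Hi; apply: Hp.
exists (n1 + n2).+1, tp2; split=> //.
- by rewrite ltnS mulSn addSn; apply: leq_trans (leq_add H1 H2) _; rewrite addnS.
- by apply: exec_iter E1 E2; rewrite (readT_teq Htp); apply: Hb.
Qed.

Definition act1 (x : nat) (g : C -> C * move) : prog :=
  PAct (fun r => [ffun j : 'I_k.+1 => if j == x :> nat then g (r j) else (r j, Stay)]).

Lemma hoare_act1 x g T T' :
  (forall i : 'I_k.+1, i = x :> nat ->
     teq (act_tape (T i) (g (read_tape (T i)))) (T' i)) ->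
  (forall i : 'I_k.+1, i <> x :> nat -> T' i = T i) ->
  hoare (act1 x g) T T' 1.
Proof.
move=> Hx Hn; apply: hoare_act => i; rewrite !ffunE.
case: eqP => [E|/Hn ->]; [exact: Hx|exact: teq_idle].
Qed.

End Compile.

(** The base [n + 2] is at least 2 for all [n], so constants and sums can be absorbed in the
    exponent. *)
Definition polyb (f : nat -> nat) : Prop := exists c, forall n, f n <= (n + 2) ^ c.

Lemma polyb_le f g : (forall n, f n <= g n) -> polyb g -> polyb f.
Proof. by move=> H [c Hc]; exists c => n; apply: leq_trans (H n) (Hc n). Qed.

Lemma polyb_const a : polyb (fun _ => a).
Proof.
exists a => n; apply: leq_trans (ltnW (ltn_expl a (isT : 1 < 2))) _.
by case: a => // a; rewrite leq_exp2r // leq_addl.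
Qed.

Lemma polyb_id : polyb (fun n => n).
Proof. by exists 1 => n; rewrite expn1 leq_addr. Qed.

Lemma polyb_mul f g : polyb f -> polyb g -> polyb (fun n => f n * g n).
Proof. by case=> a Ha [b Hb]; exists (a + b) => n; rewrite expnD leq_mul. Qed.

Lemma polyb_add f g : polyb f -> polyb g -> polyb (fun n => f n + g n).
Proof.
case=> a Ha [b Hb]; exists (a + b).+1 => n.
have n2 : 0 < n + 2 by rewrite addn2.
have E : 2 * (n + 2) ^ (a + b) <= (n + 2) ^ (a + b).+1.
  by rewrite expnS leq_mul2r leq_addl orbT.
apply: leq_trans E; rewrite mul2n -addnn; apply: leq_add.
  by apply: leq_trans (Ha n) _; rewrite leq_pexp2l // leq_addr.
by apply: leq_trans (Hb n) _; rewrite leq_pexp2l // leq_addl.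
Qed.

Lemma polyb_exp f e : polyb f -> polyb (fun n => f n ^ e).
Proof.
move=> Hf; elim: e => [|e IH]; first exact: polyb_const.
by apply: (polyb_le (g := fun n => f n * f n ^ e)) => [n|]; [rewrite expnS|apply: polyb_mul].
Qed.

Lemma polyb_bound f : polyb f -> exists c, forall n, f n <= poly_bound c n.
Proof.
(* For [n] at most 1 the constant [3 ^ c] suffices; for larger [n] the base [n + 2] is at most
   [n ^ 2]. *)
case=> c Hc; exists (2 * c + 3 ^ c) => n; apply: leq_trans (Hc n) _; rewrite /poly_bound.
case: (ltnP n 2) => Hn.
  apply: leq_trans (leq_addl _ _); apply: leq_trans (leq_addl _ _).
  by case: c {Hc} => // c; rewrite leq_exp2r // ; lia.
apply: leq_trans (leq_addr _ _).
have n0 : 0 < n by apply: leq_trans Hn.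
apply: (@leq_trans (n ^ (2 * c))); last by rewrite leq_pexp2l // leq_addr.
rewrite expnM; case: c {Hc} => // c; rewrite leq_exp2r //.
by rewrite -mulnn; nia.
Qed.

(** * Polynomial-time generators *)

Definition setc (f : nat -> nat) (x v : nat) : nat -> nat :=
  fun y => if y == x then v else f y.

Ltac setc_ext := apply: functional_extensionality => ?; rewrite /setc;
  repeat (case: eqP => ?; subst); try by []; try lia.

(* Tape 0 is the input, tape 9 the output; tapes 1 to 8 hold unary counters
   with the head on the last symbol.  Tapes 0 and 9 are given as the word left
   of the head, nearest symbol first, and the word from the head on. *)
Record gstate := GState { gin : word * word; cnt : nat -> nat; gout : word * word }.

Definition one : cell void := Some (inl true).
Definition ctape (v : nat) : tape void :=
  if v is v'.+1 then (nseq v' one, [:: one]) else ([::], [::]).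
Definition wtape (lr : word * word) : tape void :=
  ([seq Some (inl b) | b <- lr.1], [seq Some (inl b) | b <- lr.2]).

Definition tapes (s : gstate) (i : 'I_10) : tape void :=
  if i == 0 :> nat then wtape (gin s) else
  if i == 9 :> nat then wtape (gout s) else ctape (cnt s i).

Definition setcnt s x v := GState (gin s) (setc (cnt s) x v) (gout s).
Definition setin s lr := GState lr (cnt s) (gout s).
Definition setout s lr := GState (gin s) (cnt s) lr.

Definition cinc x : prog 9 :=
  PSeq (act1 _ x (fun c => (c, MoveRight))) (act1 _ x (fun _ => (one, Stay))).
Definition dec x : prog 9 := act1 _ x (fun _ => (None, MoveLeft)).
Definition emit b : prog 9 := act1 _ 9 (fun _ => (Some (inl b), MoveRight)).
Definition outl : prog 9 := act1 _ 9 (fun c => (c, MoveLeft)).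
Definition inl_ : prog 9 := act1 _ 0 (fun c => (c, MoveLeft)).
Definition inr_ : prog 9 := act1 _ 0 (fun c => (c, MoveRight)).
Definition pos x : {ffun 'I_10 -> cell void} -> bool := fun r => r (inord x) != None.
Definition bit1 : {ffun 'I_10 -> cell void} -> bool := fun r => r ord0 == one.

Definition Hs (p : prog 9) s s' c := hoare p (tapes s) (tapes s') c.

Lemma Hs_seq p q s s1 s2 c1 c2 : Hs p s s1 c1 -> Hs q s1 s2 c2 -> Hs (PSeq p q) s s2 (c1 + c2).
Proof. exact: hoare_seq. Qed.

Lemma Hs_weaken p s s' c c' : Hs p s s' c -> c <= c' -> Hs p s s' c'.
Proof. by move=> H Hc; apply: hoare_weaken Hc H. Qed.

Lemma tapes_setcnt s x v (i : 'I_10) : 0 < x < 9 ->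
  tapes (setcnt s x v) i = if i == x :> nat then ctape v else tapes s i.
Proof.
move=> Hx; rewrite /tapes /= /setc; case: (eqVneq (i : nat) x) => [->|//].
by have [-> ->] : (x == 0) = false /\ (x == 9) = false by split; apply/eqP; lia.
Qed.

Lemma Hs_inc x s : 0 < x < 9 -> Hs (cinc x) s (setcnt s x (cnt s x).+1) 2.
Proof.
move=> Hx; pose T (i : 'I_10) : tape void := if i == x :> nat then
   (if cnt s x is v.+1 then nseq v.+1 one else [::], [::]) else tapes s i.
have Ex (i : 'I_10) : i = x :> nat -> tapes s i = ctape (cnt s x).
  move=> E; rewrite /tapes E.
  by have [-> ->] : (x == 0) = false /\ (x == 9) = false by split; apply/eqP; lia.
apply: (hoare_seq (T1 := T) (c1 := 1) (c2 := 1)); apply: hoare_act1 => i Hi.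
- rewrite Ex // /T Hi eqxx; case: (cnt s x) => [|v] //=.
  by split=> //= -[|j] //=; rewrite nth_nil.
- by rewrite /T; case: eqP.
- rewrite tapes_setcnt // /T Hi eqxx /=; case: (cnt s x) => [|v] //=.
- by rewrite tapes_setcnt // /T; case: eqP.
Qed.

Lemma Hs_dec x s v : 0 < x < 9 -> cnt s x = v.+1 -> Hs (dec x) s (setcnt s x v) 1.
Proof.
move=> Hx Ev; apply: hoare_act1 => i Hi; last by rewrite tapes_setcnt //; case: eqP.
rewrite tapes_setcnt // Hi eqxx /tapes Hi.
have [-> ->] : (x == 0) = false /\ (x == 9) = false by split; apply/eqP; lia.
by rewrite Ev; case: v {Ev} => [|v] /=; split=> //= -[|[|[|j]]] //=; rewrite ?nth_nil.
Qed.

Lemma Hs_emit b s l : gout s = (l, [::]) -> Hs (emit b) s (setout s (b :: l, [::])) 1.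
Proof.
move=> E; apply: hoare_act1 => i Hi; last by rewrite /tapes /=; case: ifP => // _; case: eqP.
by rewrite /tapes Hi /= E.
Qed.

Lemma Hs_outl s b l r : gout s = (b :: l, r) -> Hs outl s (setout s (l, b :: r)) 1.
Proof.
move=> E; apply: hoare_act1 => i Hi; last by rewrite /tapes /=; case: ifP => // _; case: eqP.
by rewrite /tapes Hi /= E /wtape /=; case: r {E} => [|c r]; split=> //= -[|[|j]] //=; rewrite ?nth_nil.
Qed.

Lemma Hs_inl s b l r : gin s = (b :: l, r) -> Hs inl_ s (setin s (l, b :: r)) 1.
Proof.
move=> E; apply: hoare_act1 => i Hi; last by rewrite /tapes /=; case: eqP.
by rewrite /tapes Hi /= E /wtape /=; case: r {E} => [|c r]; split=> //= -[|[|j]] //=; rewrite ?nth_nil.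
Qed.

Lemma Hs_inr s b l r : gin s = (l, b :: r) -> Hs inr_ s (setin s (b :: l, r)) 1.
Proof.
move=> E; apply: hoare_act1 => i Hi; last by rewrite /tapes /=; case: eqP.
by rewrite /tapes Hi /= E.
Qed.

Lemma pos_cnt x s : 0 < x < 9 -> pos x (readT (tapes s)) = (0 < cnt s x).
Proof.
move=> Hx; rewrite /pos ffunE /tapes inordK; last by lia.
have [-> ->] : (x == 0) = false /\ (x == 9) = false by split; apply/eqP; lia.
by case: (cnt s x).
Qed.

Lemma pos_in s : pos 0 (readT (tapes s)) = (0 < size (gin s).2).
Proof. by rewrite /pos ffunE /tapes inordK //= /wtape; case: (gin s).2. Qed.

Lemma bit_in s b r : (gin s).2 = b :: r -> bit1 (readT (tapes s)) = b.
Proof. by move=> E; rewrite /bit1 ffunE /tapes /= /wtape E; case: b E. Qed.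

Definition drain x (p : prog 9) : prog 9 := PWhile (pos x) (PSeq (dec x) p).

Lemma Hs_drain x p (F : nat -> gstate) n c : 0 < x < 9 ->
  (forall i, i <= n -> cnt (F i) x = n - i) ->
  (forall i, i < n -> Hs p (setcnt (F i) x (n - i.+1)) (F i.+1) c) ->
  Hs (drain x p) (F 0) (F n) (n * c.+2).+1.
Proof.
move=> Hx Hc Hp; apply: (hoare_while (F := fun i => tapes (F i)) (c := c.+1)) => [i Hi||i Hi].
- by rewrite pos_cnt // Hc ?subn_gt0 // ltnW.
- by rewrite pos_cnt // Hc // subnn.
- rewrite -[c.+1]add1n; apply: (Hs_seq (c1 := 1) _ (Hp i Hi)); apply: Hs_dec => //.
  by rewrite Hc ?(ltnW Hi) // subnSK.
Qed.

(* [cnt 8] counts the output, for the final rewinding. *)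
Definition mk (f : nat -> nat) (L R out : word) : gstate :=
  GState (L, R) (setc f 8 (size out)) (out, [::]).

Definition emitb b : prog 9 := PSeq (emit b) (cinc 8).

Lemma Hs_emitb b f L R out : Hs (emitb b) (mk f L R out) (mk f L R (b :: out)) 3.
Proof.
apply: (Hs_seq (c1 := 1) (c2 := 2)); first exact: Hs_emit.
have -> : mk f L R (b :: out) = setcnt (setout (mk f L R out) (b :: out, [::])) 8
   (cnt (setout (mk f L R out) (b :: out, [::])) 8).+1.
  by rewrite /mk /setcnt /=; congr GState; setc_ext.
exact: Hs_inc.
Qed.

Lemma Hs_mkinc x f L R out : 0 < x < 8 ->
  Hs (cinc x) (mk f L R out) (mk (setc f x (f x).+1) L R out) 2.
Proof.
move=> Hx; have Hx' : 0 < x < 9 by lia.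
have -> : mk (setc f x (f x).+1) L R out = setcnt (mk f L R out) x (cnt (mk f L R out) x).+1.
  by rewrite /mk /setcnt /=; congr GState; setc_ext.
exact: Hs_inc.
Qed.

Lemma Hs_mkdrain x p (F : nat -> nat -> nat) (A B out : nat -> word) n c : 0 < x < 8 ->
  (forall i, i <= n -> F i x = n - i) ->
  (forall i, i < n -> Hs p (mk (setc (F i) x (n - i.+1)) (A i) (B i) (out i))
                           (mk (F i.+1) (A i.+1) (B i.+1) (out i.+1)) c) ->
  Hs (drain x p) (mk (F 0) (A 0) (B 0) (out 0)) (mk (F n) (A n) (B n) (out n)) (n * c.+2).+1.
Proof.
move=> Hx HF Hp; have Hx' : 0 < x < 9 by lia.
apply: (Hs_drain (F := fun i => mk (F i) (A i) (B i) (out i)) Hx') => i Hi.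
  rewrite /= /setc; case: eqP => [E|_]; last exact: HF.
  by move: Hx; rewrite E.
have -> : setcnt (mk (F i) (A i) (B i) (out i)) x (n - i.+1)
        = mk (setc (F i) x (n - i.+1)) (A i) (B i) (out i).
  by rewrite /mk /setcnt /=; congr GState; setc_ext.
exact: Hp.
Qed.

Lemma setc_eq f x v : setc f x v x = v. Proof. by rewrite /setc eqxx. Qed.

Lemma mk_eq f f' L L' R R' o o' : f = f' -> L = L' -> R = R' -> o = o' ->
  mk f L R o = mk f' L' R' o'.
Proof. by move=> -> -> -> ->. Qed.

Lemma Hs_eq p s s' t t' c c' : Hs p s s' c -> t = s -> t' = s' -> c <= c' -> Hs p t t' c'.
Proof. by move=> H -> ->; apply: Hs_weaken. Qed.

Lemma Hs_mkinr w f o i : i < size w ->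
  Hs inr_ (mk f (rev (take i w)) (drop i w) o) (mk f (rev (take i.+1 w)) (drop i.+1 w) o) 1.
Proof.
move=> Hi; rewrite /mk (take_nth false) // rev_rcons (drop_nth false Hi).
exact: (@Hs_inr (GState _ _ _)).
Qed.

Lemma Hs_mkinl w f o i : i < size w ->
  Hs inl_ (mk f (rev (take i.+1 w)) (drop i.+1 w) o) (mk f (rev (take i w)) (drop i w) o) 1.
Proof.
move=> Hi; rewrite /mk (take_nth false) // rev_rcons (drop_nth false Hi).
exact: (@Hs_inl (GState _ _ _)).
Qed.

(** Draining [z] destroys it, but [x] has counted the iterations, and the second drain restores [z]
    from it. *)
Definition pfor z x p : prog 9 := PSeq (drain z (PSeq p (cinc x))) (drain x (cinc z)).

(* [h i] gives the counters other than [z] and [x] before iteration [i]. *)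
Lemma Hs_for z x p (h : nat -> nat -> nat) (A B out : nat -> word) n c f f' :
  0 < z < 8 -> 0 < x < 8 -> z <> x ->
  f = setc (setc (h 0) z n) x 0 -> f' = setc (setc (h n) z n) x 0 ->
  (forall i, i < n -> Hs p (mk (setc (setc (h i) z (n - i.+1)) x i) (A i) (B i) (out i))
     (mk (setc (setc (h i.+1) z (n - i.+1)) x i) (A i.+1) (B i.+1) (out i.+1)) c) ->
  Hs (pfor z x p) (mk f (A 0) (B 0) (out 0)) (mk f' (A n) (B n) (out n)) (n * (c + 8) + 2).
Proof.
move=> Hz Hx nzx -> -> Hp; have nxz : x <> z by move/esym.
pose F i := setc (setc (h i) z (n - i)) x i.
pose G i := setc (setc (h n) z i) x (n - i).
apply: (@Hs_weaken _ _ _ ((n * (c + 2).+2).+1 + (n * 4).+1)); last by lia.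
apply: (Hs_seq (s1 := mk (F n) (A n) (B n) (out n))).
  have -> : setc (setc (h 0) z n) x 0 = F 0 by rewrite /F subn0.
  apply: (@Hs_mkdrain z _ F A B out n _ Hz) => i Hi; first by rewrite /F /setc; do 2?case: eqP.
  have -> : setc (F i) z (n - i.+1) = setc (setc (h i) z (n - i.+1)) x i by rewrite /F; setc_ext.
  apply: Hs_seq (Hp i Hi) _; apply: Hs_eq (@Hs_mkinc x _ _ _ _ Hx) erefl _ (leqnn _).
  by apply: mk_eq => //; rewrite setc_eq /F; setc_ext.
have -> : F n = G 0 by rewrite /F /G subn0 subnn; setc_ext.
have -> : setc (setc (h n) z n) x 0 = G n by rewrite /G subnn.
apply: (@Hs_mkdrain x _ G (fun _ => A n) (fun _ => B n) (fun _ => out n) n 2 Hx) => i Hi.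
  by rewrite /G /setc eqxx.
apply: Hs_eq (@Hs_mkinc z _ _ _ _ Hz) erefl _ (leqnn _).
apply: mk_eq => //; have -> : setc (G i) x (n - i.+1) z = i by rewrite /G /setc eqxx; case: eqP.
by rewrite /G; setc_ext.
Qed.

Lemma iota0S n : iota 0 n.+1 = iota 0 n ++ [:: n].
Proof. by rewrite -addn1 iotaD add0n. Qed.

Lemma rev_flattenS (d : nat -> word) i o : rev (flatten [seq d j | j <- iota 0 i.+1]) ++ o =
  rev (d i) ++ (rev (flatten [seq d j | j <- iota 0 i]) ++ o).
Proof. by rewrite iota0S map_cat flatten_cat /= cats0 rev_cat catA. Qed.

Definition skip : prog 9 := PAct (@idle 9).

Lemma Hs_skip s : Hs skip s s 1.
Proof. by apply: hoare_act => i; rewrite /idle !ffunE; exact: teq_idle. Qed.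

Definition pinput x p : prog 9 := PWhile (pos 0) (PSeq p (PSeq inr_ (cinc x))).

Lemma Hs_input w x p f (out : nat -> word) c : 0 < x < 8 ->
  (forall i, i < size w -> Hs p (mk (setc f x i) (rev (take i w)) (drop i w) (out i))
     (mk (setc f x i) (rev (take i w)) (drop i w) (out i.+1)) c) ->
  Hs (pinput x p) (mk (setc f x 0) [::] w (out 0))
     (mk (setc f x (size w)) (rev w) [::] (out (size w))) (size w * (c + 4)).+1.
Proof.
move=> Hx Hp; pose F i := mk (setc f x i) (rev (take i w)) (drop i w) (out i).
have -> : mk (setc f x 0) [::] w (out 0) = F 0 by rewrite /F take0 drop0.
have -> : mk (setc f x (size w)) (rev w) [::] (out (size w)) = F (size w).
  by rewrite /F take_size drop_size.
rewrite [c + 4]addnS; apply: (hoare_while (F := fun i => tapes (F i))) => [i Hi||i Hi].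
- by rewrite pos_in /= size_drop subn_gt0.
- by rewrite pos_in /= size_drop subnn.
rewrite -[3]/(1 + 2); apply: (Hs_seq (Hp i Hi)); apply: (Hs_seq (@Hs_mkinr w _ _ i Hi)).
apply: Hs_eq (@Hs_mkinc x _ _ _ _ Hx) erefl _ (leqnn _).
by apply: mk_eq => //; rewrite setc_eq; setc_ext.
Qed.

(** A scratch counter, kept out of the reach of generators by [valid]. *)
Definition ct := 1.

Inductive gen :=
| GEmit of word
| GOnes of nat
| GSeq of gen & gen
| GFor of nat & nat & gen
| GInput of nat & gen & gen.

(* Inside a loop [z] counts down and [x] counts up. *)
Fixpoint den (w : word) (g : gen) (f : nat -> nat) : word :=
  match g with
  | GEmit s => s
  | GOnes x => nseq (f x) true
  | GSeq g h => den w g f ++ den w h f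
  | GFor z x g => flatten [seq den w g (setc (setc f z (f z - i.+1)) x i) | i <- iota 0 (f z)]
  | GInput x g0 g1 => flatten [seq den w (if nth false w i then g1 else g0) (setc f x i)
                                | i <- iota 0 (size w)]
  end.

Definition valid x := 1 < x < 8.

(* Loops start with their upward counter at zero, and the input is read from its
   first symbol. *)
Fixpoint okg (w L R : word) (g : gen) (f : nat -> nat) : Prop :=
  match g with
  | GEmit s => True
  | GOnes x => valid x
  | GSeq g h => okg w L R g f /\ okg w L R h f
  | GFor z x g => [/\ valid z, valid x, z != x, f x = 0
      & forall i, i < f z -> okg w L R g (setc (setc f z (f z - i.+1)) x i)]
  | GInput x g0 g1 => [/\ valid x, f x = 0, L = [::] /\ R = w
      & forall i, i < size w -> okg w (rev (take i w)) (drop i w)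
             (if nth false w i then g1 else g0) (setc f x i)]
  end.

(** The last loop of [GInput] resets its counter and brings the input head back to the first
    symbol. *)
Fixpoint compile (g : gen) : prog 9 :=
  match g with
  | GEmit s => foldr (fun b p => PSeq (emitb b) p) skip s
  | GOnes x => pfor x ct (emitb true)
  | GSeq g h => PSeq (compile g) (compile h)
  | GFor z x g => pfor z x (compile g)
  | GInput x g0 g1 =>
      PSeq (pinput x (PIf bit1 (compile g1) (compile g0))) (drain x inl_)
  end.

(** [S] is meant to bound the input length and all counters. *)
Fixpoint gcost (g : gen) (S : nat) : nat :=
  match g with
  | GEmit s => 3 * size s + 1
  | GOnes x => 11 * S + 2
  | GSeq g h => gcost g S + gcost h S
  | GFor z x g => S * (gcost g S + 8) + 2
  | GInput x g0 g1 => S * (gcost g0 S + gcost g1 S + 8) + 2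
  end.

Lemma gcost_poly g f : polyb f -> polyb (fun n => gcost g (f n)).
Proof.
move=> Hf; elim: g => [s|x|g IHg h IHh|z x g IH|x g IHg h IHh] /=;
  by do ![apply: polyb_add|apply: polyb_mul|apply: polyb_const|exact: IH|exact: IHg|exact: IHh].
Qed.

(** Each construct returns the counters and the input head to where they were, so constructs compose
    freely; the output lies reversed to the left of its head. *)
Lemma comp_correct w g S : size w <= S -> forall f L R out, okg w L R g f ->
  f ct = 0 -> (forall x, valid x -> f x <= S) ->
  Hs (compile g) (mk f L R out) (mk f L R (rev (den w g f) ++ out)) (gcost g S).
Proof.
move=> HwS; elim: g => [s|x|g IHg h IHh|z x g IH|x g0 IH0 g1 IH1] f L R out /= Hok Ht HS.
- elim: s out {Hok} => [|b s IHs] out.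
    exact: Hs_skip.
  rewrite rev_cons cat_rcons [3 * _ + 1](_ : _ = 3 + (3 * size s + 1)); last by rewrite /=; lia.
  exact: (Hs_seq (@Hs_emitb b f L R out) (IHs _)).
- have Hx8 : 0 < x < 8 by move: Hok; rewrite /valid; lia.
  have nx : x <> ct by move: Hok; rewrite /valid /ct; lia.
  apply: Hs_eq (@Hs_for x ct _ (fun _ => f) (fun _ => L) (fun _ => R)
    (fun i => nseq i true ++ out) (f x) 3 f f _ _ _ _ _ _) _ _ _ => //; try by setc_ext.
  + by move=> i _; exact: (@Hs_emitb true _ L R (nseq i true ++ out)).
  + by rewrite rev_nseq.
  + by have := HS x Hok; lia.
- case: Hok => Hg Hh; rewrite rev_cat -catA; apply: (Hs_seq (IHg _ _ _ _ Hg Ht HS)).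
  exact: IHh Hh Ht HS.
- case: Hok => Hz Hx /eqP nzx fx Hb.
  have Hz8 : 0 < z < 8 by move: Hz; rewrite /valid; lia.
  have Hx8 : 0 < x < 8 by move: Hx; rewrite /valid; lia.
  have nS := HS z Hz; set d := fun i => den w g _.
  apply: Hs_eq (@Hs_for z x _ (fun _ => f) (fun _ => L) (fun _ => R)
    (fun i => rev (flatten [seq d j | j <- iota 0 i]) ++ out) (f z) (gcost g S) f f _ _ _ _ _ _) _ _ _ => //;
    try by setc_ext.
  + move=> i Hi; rewrite rev_flattenS; apply: IH => //; first exact: Hb.
      by move: Hz Hx; rewrite /setc /valid /ct; do 2?case: eqP => [<-|_].
    move=> y Hy; rewrite /setc; case: eqP => _; first exact: leq_trans (ltnW Hi) nS.
    by case: eqP => _; [apply: leq_trans (leq_subr _ _) nS|apply: HS].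
  + by rewrite leq_add2r leq_mul2r nS orbT.
- case: Hok => Hx fx [-> ->] Hb.
  have Hx8 : 0 < x < 8 by move: Hx; rewrite /valid; lia.
  have nx : ct <> x by move: Hx; rewrite /valid /ct; lia.
  set n := size w; set d := fun i => den w _ _.
  pose O i := rev (flatten [seq d j | j <- iota 0 i]) ++ out.
  apply: (@Hs_weaken _ _ _ ((n * ((gcost g0 S + gcost g1 S).+1 + 4)).+1 + (n * 3).+1)); last first.
    rewrite [X in X <= _]addSn [X in X.+1 <= _]addnS [X in _ <= X]addn2 !ltnS -mulnDr.
    by apply: leq_mul => //; clear; lia.
  have f0 : setc f x 0 = f by setc_ext.
  rewrite -{1}f0; apply: (Hs_seq (@Hs_input w x _ f O _ Hx8 _)) => [i Hi|].
    have Edrop : drop i w = nth false w i :: drop i.+1 w by rewrite (drop_nth false).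
    apply: hoare_if; rewrite (bit_in (b := nth false w i) (r := drop i.+1 w)) //.
    have Hd := Hb i Hi; have Ht' : setc f x i ct = 0 by rewrite /setc; case: eqP.
    have HS' y : valid y -> setc f x i y <= S.
      by move=> Hy; rewrite /setc; case: eqP => _; [apply: leq_trans (ltnW Hi) HwS|apply: HS].
    rewrite /O rev_flattenS /d; case: (nth false w i) Hd => Hd.
      by apply: Hs_weaken (IH1 _ _ _ _ Hd Ht' HS') _; rewrite leq_addl.
    by apply: Hs_weaken (IH0 _ _ _ _ Hd Ht' HS') _; rewrite leq_addr.
  apply: Hs_eq (@Hs_mkdrain x _ (fun i => setc f x (n - i)) (fun i => rev (take (n - i) w))
    (fun i => drop (n - i) w) (fun _ => O n) n 1 Hx8 _ _) _ _ (leqnn _).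
  + by move=> i Hi; rewrite /setc eqxx.
  + move=> i Hi; have Ei : n - i = (n - i.+1).+1 by rewrite subnSK.
    rewrite Ei; apply: Hs_eq (@Hs_mkinl w _ _ (n - i.+1) _) _ erefl (leqnn _); first by rewrite -/n; lia.
    by apply: mk_eq => //; setc_ext.
  + by rewrite subn0 take_size drop_size.
  + by rewrite subnn take0 drop0 f0.
Qed.

(** * Computing the parameters and rewinding the output *)

Definition zN := 2.
Definition xN := 3.
Definition zm := 4.
Definition xm := 5.
Definition cn := 6.
Definition xi := 7.

Definition zero : nat -> nat := fun _ => 0.

Definition scan : prog 9 := PSeq (pinput cn skip) (pfor cn ct inl_).

Lemma Hs_scan w : Hs scan (mk zero [::] w [::]) (mk (setc zero cn (size w)) [::] w [::])
  (14 * size w + 3).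
Proof.
set n := size w; set f := setc zero cn n.
apply: (@Hs_weaken _ _ _ ((n * 5).+1 + (n * 9 + 2))); last by lia.
have -> : zero = setc zero cn 0 by setc_ext.
apply: (Hs_seq (@Hs_input w cn _ zero (fun _ => [::]) 1 isT (fun i _ => @Hs_skip _))).
apply: Hs_eq (@Hs_for cn ct inl_ (fun _ => zero) (fun i => rev (take (n - i) w))
  (fun i => drop (n - i) w) (fun _ => [::]) n 1 f f _ _ _ _ _ _) _ _ (leqnn _) => //;
  try by rewrite /f; setc_ext.
- move=> i Hi; have Ei : n - i = (n - i.+1).+1 by rewrite subnSK.
  by rewrite Ei; apply: (@Hs_mkinl w); rewrite -/n; lia.
- by rewrite subn0 take_size drop_size.
- by rewrite subnn take0 drop0.
Qed.

Definition addto : prog 9 := pfor cn ct (cinc xm).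

Lemma Hs_addto f L R o : f ct = 0 ->
  Hs addto (mk f L R o) (mk (setc f xm (f xm + f cn)) L R o) (10 * f cn + 2).
Proof.
move=> Ht; rewrite mulnC.
apply: (@Hs_for cn ct _ (fun i => setc f xm (f xm + i)) (fun _ => L) (fun _ => R) (fun _ => o)
  (f cn) 2) => //; try by setc_ext.
move=> i Hi; apply: Hs_eq (@Hs_mkinc xm _ _ _ _ isT) erefl _ (leqnn _).
by apply: mk_eq => //; setc_ext.
Qed.

(** Every unit of [zm] contributes [cn + 2] to [xm]; iterating this yields the powers of [n + 2]. *)
Definition mult : prog 9 :=
  PSeq (drain zm (PSeq (cinc xm) (PSeq (cinc xm) addto))) (drain xm (cinc zm)).

Lemma Hs_mult f L R o a n : f ct = 0 -> f xm = 0 -> f zm = a -> f cn = n ->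
  Hs mult (mk f L R o) (mk (setc f zm (a * (n + 2))) L R o)
     (a * (10 * n + 8) + a * (n + 2) * 4 + 2).
Proof.
move=> Ht Hxm Hzm Hcn; set b := a * (n + 2).
pose G i := setc (setc f zm (a - i)) xm (i * (n + 2)).
pose H i := setc (setc f zm i) xm (b - i).
apply: (@Hs_weaken _ _ _ ((a * (2 + (2 + (10 * n + 2))).+2).+1 + (b * 4).+1)); last by rewrite /b; lia.
apply: (Hs_seq (s1 := mk (G a) L R o)).
  have -> : f = G 0 by rewrite /G mul0n subn0; setc_ext.
  apply: (@Hs_mkdrain zm _ G (fun _ => L) (fun _ => R) (fun _ => o) a) => // i Hi.
  apply: (Hs_seq (@Hs_mkinc xm _ _ _ _ isT)); apply: (Hs_seq (@Hs_mkinc xm _ _ _ _ isT)).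
  apply: Hs_eq (@Hs_addto _ L R o _) erefl _ _ => //; last by rewrite /G /setc /= Hcn.
  apply: mk_eq => //; rewrite /G; apply: functional_extensionality => u; rewrite /setc /= Hcn mulSn.
  by case: (u == xm); [clear; lia|case: (u == zm)].
have -> : G a = H 0 by rewrite /G /H subnn subn0.
have -> : setc f zm b = H b by rewrite /H subnn; setc_ext.
apply: (@Hs_mkdrain xm _ H (fun _ => L) (fun _ => R) (fun _ => o) b) => // i Hi.
apply: Hs_eq (@Hs_mkinc zm _ _ _ _ isT) erefl _ (leqnn _).
by apply: mk_eq => //; rewrite /H; setc_ext.
Qed.

Fixpoint powp (e : nat) : prog 9 :=
  if e is e'.+1 then PSeq (powp e') mult else skip.

Fixpoint powcost (e n : nat) : nat :=
  if e is e'.+1 then powcost e' n +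
    ((n + 2) ^ e' * (10 * n + 8) + (n + 2) ^ e' * (n + 2) * 4 + 2) else 1.

Lemma Hs_pow e n L R o :
  Hs (powp e) (mk (setc (setc zero cn n) zm 1) L R o)
     (mk (setc (setc zero cn n) zm ((n + 2) ^ e)) L R o) (powcost e n).
Proof.
elim: e => [|e IH] /=.
  exact: Hs_skip.
apply: (Hs_seq IH); apply: Hs_eq (@Hs_mult _ _ _ _ ((n + 2) ^ e) n _ _ _ _) erefl _ _ => //.
by apply: mk_eq => //; rewrite expnSr; setc_ext.
Qed.

Definition params (e n : nat) : nat -> nat :=
  setc (setc (setc zero cn n) zm ((n + 2) ^ e)) zN (2 * (n + 2) ^ e).

Definition dbl : prog 9 := pfor zm ct (PSeq (cinc zN) (cinc zN)).

Lemma Hs_dbl e n L R o :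
  Hs dbl (mk (setc (setc zero cn n) zm ((n + 2) ^ e)) L R o) (mk (params e n) L R o)
     (12 * (n + 2) ^ e + 2).
Proof.
rewrite /params; set a := (n + 2) ^ e; set f := setc (setc zero cn n) zm a; rewrite [12 * _]mulnC.
apply: (@Hs_for zm ct _ (fun i => setc f zN (2 * i)) (fun _ => L) (fun _ => R) (fun _ => o) a 4) => //;
  try by rewrite /f; setc_ext.
move=> i Hi; apply: (Hs_seq (c1 := 2) (c2 := 2) (@Hs_mkinc zN _ _ _ _ isT)).
apply: Hs_eq (@Hs_mkinc zN _ _ _ _ isT) erefl _ (leqnn _).
apply: mk_eq => //; apply: functional_extensionality => u; rewrite /setc /=.
by case: (eqVneq u zN) => [->|_] /=; [clear; lia|].
Qed.

Lemma Hs_rewind f L R o : Hs (drain 8 outl) (mk f L R o)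
  (GState (L, R) (setc f 8 0) ([::], rev o)) (3 * size o + 1).
Proof.
set n := size o.
pose F i := GState (L, R) (setc f 8 (n - i)) (drop i o, rev (take i o)).
have -> : mk f L R o = F 0 by rewrite /F subn0 drop0 take0.
have -> : GState (L, R) (setc f 8 0) ([::], rev o) = F n.
  by rewrite /F subnn drop_size take_size.
apply: (@Hs_weaken _ _ _ (n * 3).+1); last by lia.
apply: (Hs_drain (F := F)) => // i Hi.
have -> : F i.+1 = setout (setcnt (F i) 8 (n - i.+1)) (drop i.+1 o, nth false o i :: rev (take i o)).
  rewrite /F /setout /setcnt /= (take_nth false) // rev_rcons; congr GState.
  by setc_ext.
by apply: Hs_outl; rewrite /= (drop_nth false).
Qed.

Lemma size_flatten_le (F : nat -> word) n c : (forall i, i < n -> size (F i) <= c) ->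
  size (flatten [seq F i | i <- iota 0 n]) <= n * c.
Proof.
elim: n => // n IH H; rewrite iota0S map_cat flatten_cat /= cats0 size_cat mulSn addnC.
by apply: leq_add (H n (leqnn _)) (IH _) => i Hi; apply: H; apply: ltnW.
Qed.

(** The final rewinding takes time linear in the output, so the length of the output must be
    polynomial too. *)
Lemma den_size w g S : size w <= S -> forall f L R, okg w L R g f ->
  (forall x, valid x -> f x <= S) -> size (den w g f) <= gcost g S.
Proof.
move=> HwS; elim: g => [s|x|g IHg h IHh|z x g IH|x g0 IH0 g1 IH1] f L R /= Hok HS.
- by lia.
- by rewrite size_nseq; have := HS x Hok; lia.
- by case: Hok => /IHg H1 /IHh H2; rewrite size_cat leq_add // ?H1 ?H2.
- case: Hok => Hz Hx nzx fx Hb.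
  have nS := HS z Hz; apply: (@leq_trans (f z * gcost g S)); last first.
    by apply: (@leq_trans (S * (gcost g S + 8))); [apply: leq_mul; lia|lia].
  apply: size_flatten_le => i Hi.
  apply: IH (Hb i Hi) _ => y Hy; rewrite /setc; case: eqP => _; first by lia.
  by case: eqP => _; [lia|apply: HS].
- case: Hok => Hx fx _ Hb.
  apply: (@leq_trans (size w * (gcost g0 S + gcost g1 S))); last first.
    by apply: (@leq_trans (S * (gcost g0 S + gcost g1 S + 8))); [apply: leq_mul; lia|lia].
  apply: size_flatten_le => i Hi.
  have HS' y : valid y -> setc f x i y <= S.
    by move=> Hy; rewrite /setc; case: eqP => _; [lia|apply: HS].
  have := Hb i Hi; case: (nth false w i) => Hok.
    by apply: leq_trans (IH1 _ _ _ Hok HS') _; rewrite leq_addl.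
  by apply: leq_trans (IH0 _ _ _ Hok HS') _; rewrite leq_addr.
Qed.

Lemma bits_prefix_nth (M : tm 9) (s : seq (cell (sym M))) (u : word) :
  (forall i, nth None s i = nth None [seq Some (inl b) | b <- u] i) -> bits_prefix s = u.
Proof.
elim: u s => [|b u IH] [|c s] //= H.
- by have := H 0 => /= ->.
- by have := H 0.
- have := H 0 => /= ->; congr cons; apply: IH => i; exact: (H i.+1).
Qed.

Definition generator e g : prog 9 :=
  PSeq scan (PSeq (cinc zm) (PSeq (powp e) (PSeq dbl (PSeq (compile g) (drain 8 outl))))).

Theorem gen_polytime e g :
  (forall w, okg w [::] w g (params e (size w))) ->
  polytime_computable (fun w => den w g (params e (size w))).
Proof.
(* [Sb n] bounds the input length and each of the counters of [params]. *)
move=> Hok; pose Sb n := n + 2 * (n + 2) ^ e.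
pose cost n := (14 * n + 3) + (2 + (powcost e n + ((12 * (n + 2) ^ e + 2) +
   (gcost g (Sb n) + (3 * gcost g (Sb n) + 1))))).
have pS : polyb Sb.
  apply: polyb_add polyb_id _; apply: polyb_mul (polyb_const 2) _.
  by apply: polyb_exp; apply: polyb_add polyb_id (polyb_const 2).
have pP e' : polyb (fun n => (n + 2) ^ e').
  by apply: polyb_exp; apply: polyb_add polyb_id (polyb_const 2).
have pc : polyb cost.
  have pg := gcost_poly g pS.
  apply: polyb_add; first by do ![apply: polyb_add|apply: polyb_mul|apply: polyb_const|apply: polyb_id].
  apply: polyb_add; first exact: polyb_const.
  apply: polyb_add; last first.
    by do ![apply: polyb_add|apply: polyb_mul|apply: polyb_const|exact: pP|exact: pg].
  elim: (e) => [|e' IH] /=; first exact: polyb_const.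
  by do ![exact: IH|exact: pP|exact: polyb_id|apply: polyb_add|apply: polyb_mul|apply: polyb_const].
have [c Hc] := polyb_bound pc.
exists 9, (tm_of (generator e g)), c; split; first exact: tm_of_deterministic.
move=> w; set n := size w; set f := params e n.
have Hf x : valid x -> f x <= Sb n.
  move=> _; rewrite /f /params /setc /zero /Sb.
  by do ?(case: eqP => _); rewrite ?leq_addl ?leq_addr //; lia.
have Hn : size w <= Sb n by rewrite leq_addr.
have Hsz := den_size Hn (Hok w) Hf.
have H : Hs (generator e g) (mk zero [::] w [::])
    (GState ([::], w) (setc f 8 0) ([::], den w g f)) (cost n).
  apply: (Hs_seq (@Hs_scan w)).
  apply: (Hs_seq (s1 := mk (setc (setc zero cn n) zm 1) [::] w [::])).
    exact: (@Hs_mkinc zm (setc zero cn n)).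
  apply: (Hs_seq (@Hs_pow e n [::] w [::])).
  apply: (Hs_seq (@Hs_dbl e n [::] w [::])).
  apply: (Hs_seq (@comp_correct w g (Sb n) Hn f [::] w [::] (Hok w) erefl Hf)).
  rewrite cats0 -[X in GState _ _ (_, X)]revK.
  apply: Hs_weaken (@Hs_rewind f [::] w (rev (den w g f))) _.
  by rewrite size_rev leq_add2r leq_mul2l Hsz orbT.
have [|N [T [HN HE HT]]] := H (ctapes (init_conf (tm_of (generator e g)) w)).
  move=> i; rewrite ffunE /tapes /= -val_eqE /=; case: eqP => // _.
  case: eqP => // Hi; rewrite /setc; case: eqP => //= _.
exists N, (@TMConf 9 (tm_of (generator e g)) None T); split.
- exact: leq_trans HN (Hc n).
- exact: pexit_run (exec_pexit HE).
- by rewrite /halted /actions /=.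
- rewrite /output; apply: bits_prefix_nth => i /=.
  by have [_ ->] := HT ord_max.
Qed.

(** * The code of the system *)

(* [(a, xs)] stands for [a] plus the values of the counters [xs]. *)
Definition num := (nat * seq nat)%type.
Definition nv (f : nat -> nat) (x : num) := x.1 + sumn [seq f y | y <- x.2].

(** Locked, so that simplification leaves numerals folded. *)
Definition gn (x : num) : gen := locked
  (GSeq (GEmit (nseq x.1 true)) (foldr (fun y => GSeq (GOnes y)) (GEmit [:: false]) x.2)).

Lemma den_gn w f x : den w (gn x) f = enc_nat (nv f x).
Proof.
case: x => a xs; rewrite /gn -lock /nv /=.
have -> : den w (foldr (fun y => GSeq (GOnes y)) (GEmit [:: false]) xs) f =
   enc_nat (sumn [seq f y | y <- xs]).
  elim: xs => //= y xs ->; rewrite /enc_nat nseqD rcons_cat //.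
by rewrite /enc_nat nseqD rcons_cat.
Qed.

Lemma okg_gn w L R f x : all valid x.2 -> okg w L R (gn x) f.
Proof.
by case: x => a xs /= H; rewrite /gn -lock; split=> //; elim: xs H => //= y xs IH /andP [Hy /IH Hs].
Qed.

Definition gc (a : nat) : gen := gn (a, [::]).

Lemma den_gc w f a : den w (gc a) f = enc_nat a.
Proof. by rewrite den_gn /nv addn0. Qed.

Lemma denS w f a b : den w (GSeq a b) f = den w a f ++ den w b f.
Proof. by []. Qed.

Lemma denFor w f z x g : den w (GFor z x g) f =
  flatten [seq den w g (setc (setc f z (f z - i.+1)) x i) | i <- iota 0 (f z)].
Proof. by []. Qed.

Lemma denInput w f x g0 g1 : den w (GInput x g0 g1) f =
  flatten [seq den w (if nth false w i then g1 else g0) (setc f x i) | i <- iota 0 (size w)].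
Proof. by []. Qed.

Definition g_reg r := GSeq (gc 1) (gn r).
Definition g_const d := GSeq (gc 0) (gn d).
Definition g_cond a b c d := GSeq (gc 2) (GSeq a (GSeq b (GSeq c d))).
Definition g_assume e := GSeq (gc 1) e.
Definition g_assign r e := GSeq (gc 3) (GSeq (gn r) e).
Definition g_seq a b := GSeq (gc 4) (GSeq a b).
Definition g_choice a b := GSeq (gc 5) (GSeq a b).
Definition g_star a := GSeq (gc 6) a.
Definition g_load r x := GSeq (gc 7) (GSeq (gn r) (gn x)).
Definition g_store x r := GSeq (gc 8) (GSeq (gn x) (gn r)).
(** Without the closing [Skip], several loops can be chained into one sequence, as [g_round]
    does. *)
Definition g_items z x g := GFor z x (GSeq (gc 4) g).
Definition g_seqs z x g := GSeq (g_items z x g) (gc 0).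
Definition g_const0 a := g_const (a, [::]).
Definition g_assume_eq r d := g_assume (g_cond (g_reg r) (g_const d) (g_const0 1) (g_const0 0)).
Definition g_assume_same r r' :=
  g_assume (g_cond (g_reg r) (g_reg r') (g_const0 1) (g_const0 0)).

Definition k0 (a : nat) : num := (a, [::]).
Definition times5 (a x : nat) : num := (a, [:: x; x; x; x; x]).

Section Denote.
Context (m D : nat) (w : word) (f : nat -> nat).
Local Notation cmd := (cmd (regmax m).+1 (varmax m).+1 D).

Lemma enc_inord n k : k <= n -> enc_nat (@inord n k) = enc_nat k.
Proof. by move=> Hk; rewrite inordK. Qed.

Lemma den_reg x r : nv f x = r -> r <= regmax m -> den w (g_reg x) f = enc_expr (ereg m D r).
Proof. by move=> E Hr; rewrite denS den_gc den_gn E /ereg; cbn [enc_expr]; rewrite enc_inord. Qed.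

Lemma den_const x d : nv f x = d -> d <= D -> den w (g_const x) f = enc_expr (econst m D d).
Proof. by move=> E Hr; rewrite denS den_gc den_gn E /econst; cbn [enc_expr]; rewrite enc_inord. Qed.

Lemma den_cond a b c d (e1 e2 e3 e4 : expr (regmax m).+1 D) :
  den w a f = enc_expr e1 -> den w b f = enc_expr e2 ->
  den w c f = enc_expr e3 -> den w d f = enc_expr e4 ->
  den w (g_cond a b c d) f = enc_expr (ECond e1 e2 e3 e4).
Proof. by move=> E1 E2 E3 E4; rewrite !denS den_gc E1 E2 E3 E4. Qed.

Lemma den_assume g (e : expr (regmax m).+1 D) : den w g f = enc_expr e ->
  den w (g_assume g) f = enc_cmd (assume e).
Proof. by move=> E; rewrite denS den_gc E. Qed.

Lemma den_assign x r g (e : expr (regmax m).+1 D) : nv f x = r -> r <= regmax m ->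
  den w g f = enc_expr e -> den w (g_assign x g) f = enc_cmd (assign r e).
Proof.
by move=> E Hr Eg; rewrite !denS den_gc den_gn E Eg /assign; cbn [enc_cmd]; rewrite enc_inord.
Qed.

Lemma den_seq a b (c1 c2 : cmd) : den w a f = enc_cmd c1 -> den w b f = enc_cmd c2 ->
  den w (g_seq a b) f = enc_cmd (Seq c1 c2).
Proof. by move=> E1 E2; rewrite !denS den_gc E1 E2. Qed.

Lemma den_choice a b (c1 c2 : cmd) : den w a f = enc_cmd c1 -> den w b f = enc_cmd c2 ->
  den w (g_choice a b) f = enc_cmd (Choice c1 c2).
Proof. by move=> E1 E2; rewrite !denS den_gc E1 E2. Qed.

Lemma den_star a (c : cmd) : den w a f = enc_cmd c -> den w (g_star a) f = enc_cmd (Star c).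
Proof. by move=> E1; rewrite !denS den_gc E1. Qed.

Lemma den_load x y r v : nv f x = r -> r <= regmax m -> nv f y = v -> v <= varmax m ->
  den w (g_load x y) f = enc_cmd (load m D r v).
Proof.
move=> E Hr E' Hv; rewrite !denS den_gc !den_gn E E' /load; cbn [enc_cmd].
by rewrite !enc_inord.
Qed.

Lemma den_store x y r v : nv f x = r -> r <= regmax m -> nv f y = v -> v <= varmax m ->
  den w (g_store y x) f = enc_cmd (store m D v r).
Proof.
move=> E Hr E' Hv; rewrite !denS den_gc !den_gn E E' /store; cbn [enc_cmd].
by rewrite !enc_inord.
Qed.

Definition enc_items (cs : seq cmd) : word := flatten [seq enc_nat 4 ++ enc_cmd c | c <- cs].

Lemma enc_seqs (cs : seq cmd) : enc_cmd (seqs cs) = enc_items cs ++ enc_nat 0.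
Proof.
elim: cs => // c cs IH; change (@seqs m D (c :: cs)) with (Seq c (seqs cs)); cbn [enc_cmd].
by rewrite IH /enc_items [in RHS]/= -!catA.
Qed.

Lemma enc_chs (cs : seq cmd) : enc_cmd (chs cs) =
  flatten [seq enc_nat 5 ++ enc_cmd c | c <- cs] ++ enc_cmd (assume (econst m D 0) : cmd).
Proof.
elim: cs => // c cs IH; change (@chs m D (c :: cs)) with (Choice c (chs cs)); cbn [enc_cmd].
by rewrite IH [in RHS]/= -!catA.
Qed.

Lemma den_items z x g (F : nat -> cmd) n : f z = n ->
  (forall i, i < n -> den w g (setc (setc f z (n - i.+1)) x i) = enc_cmd (F i)) ->
  den w (g_items z x g) f = enc_items [seq F i | i <- iota 0 n].
Proof.
move=> En H; rewrite /g_items denFor En /enc_items -map_comp.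
congr flatten; apply/eq_in_map => i; rewrite mem_iota add0n => /andP [_ Hi].
by rewrite denS den_gc H.
Qed.

Lemma den_seqs z x g (F : nat -> cmd) n : f z = n ->
  (forall i, i < n -> den w g (setc (setc f z (n - i.+1)) x i) = enc_cmd (F i)) ->
  den w (g_seqs z x g) f = enc_cmd (seqs [seq F i | i <- iota 0 n]).
Proof. by move=> En H; rewrite enc_seqs -(den_items En H) denS den_gc. Qed.

Lemma den_assume_eq x y r d : 0 < D -> nv f x = r -> r <= regmax m -> nv f y = d -> d <= D ->
  den w (g_assume_eq x y) f = enc_cmd (assume_eq m D r d).
Proof.
by move=> *; apply: den_assume; apply: den_cond; [apply: den_reg|apply: den_const|apply: den_const|apply: den_const].
Qed.

Lemma den_assume_same x y r r' : 0 < D -> nv f x = r -> r <= regmax m -> nv f y = r' -> r' <= regmax m ->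
  den w (g_assume_same x y) f = enc_cmd (assume_same m D r r').
Proof.
by move=> *; apply: den_assume; apply: den_cond; [apply: den_reg|apply: den_reg|apply: den_const|apply: den_const].
Qed.

End Denote.

Definition g_inc (j : num) : gen :=
  g_seq (g_assign j (g_cond (g_reg j) (g_reg (k0 0)) (g_const0 0) (g_const0 1)))
        (g_assign (k0 0) (g_cond (g_reg j) (g_const0 1) (g_const0 0) (g_reg (k0 0)))).

Definition g_branch (x s o p s' : num) : gen :=
  g_seq (g_assume_eq (k0 1) x) (g_seq (g_assume_eq (k0 2) s)
    (g_seq (g_assign (k0 3) (g_const o)) (g_seq (g_assign (k0 4) (g_const p))
      (g_assign (k0 2) (g_const s'))))).

(** In iteration [i] the downward counter [zN] is [N - i - 1]. It supplies the descending indices of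
    [ordv], and [xN] supplies the ascending ones. *)
Definition g_round : gen :=
  GSeq (g_items zN xN (g_store (times5 3 zN) (6, [:: zN])))
  (GSeq (GSeq (gc 4) (g_store (k0 0) (k0 3)))
  (GSeq (GSeq (gc 4) (g_store (k0 1) (k0 4)))
  (GSeq (g_items zN xN (g_store (times5 2 xN) (6, [:: xN]))) (gc 0)))).

Definition g_check (x r : num) : gen := g_seq (g_load (k0 5) x) (g_assume_same (k0 5) r).

Definition g_exact (x r : nat) : gen :=
  g_seq (g_seqs zN xN (g_check (times5 2 zN) (6, [:: zN])))
    (g_seq (g_load (k0 r) (k0 x)) (g_seqs zN xN (g_check (times5 3 xN) (6, [:: xN])))).

Definition g_guess : gen :=
  g_choice (g_seq (g_assign (6, [:: xN]) (g_const0 0)) (g_store (times5 5 xN) (k0 0)))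
           (g_seq (g_assign (6, [:: xN]) (g_const0 1)) (g_store (times5 4 xN) (k0 0))).

(** In iteration [i] the sum [7 + zm + 2 * xm] is [7 + (m - i - 1) + 2 * i = 6 + (m + i)], the
    register of bit [m + i]. *)
Definition g_high : gen := g_seqs zm xm (g_inc (7, [:: zm; xm; xm])).

Definition g_leaf : gen :=
  g_seq (g_seqs zN xN g_guess)
  (g_seq (g_assign (k0 1) (g_reg (5, [:: zN])))
  (g_seq (g_exact 1 4)
  (g_seq (g_assign (k0 0) (g_const0 1))
  (g_seq g_high
  (g_seq (g_choice (g_assume_eq (k0 0) (k0 1))
     (g_seq (g_assume_eq (k0 0) (k0 0)) (g_seq (g_exact 0 3) (g_assume_same (k0 3) (k0 4)))))
       (g_store (times5 1 zN) (k0 1))))))).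

Definition g_nodeb (b : nat) : gen :=
  g_seq (g_load (k0 5) (times5 (4 + b) xN)) (g_seq (g_assume_eq (k0 5) (k0 2))
    (g_seq (g_assign (k0 5) (g_const0 b)) (g_store (times5 6 xN) (k0 5)))).

Definition g_node : gen :=
  g_seq (g_load (k0 5) (times5 11 xN)) (g_seq (g_assume_eq (k0 5) (k0 0))
    (g_seq (g_load (k0 5) (times5 11 xN)) (g_seq (g_assume_eq (k0 5) (k0 1))
      (g_choice (g_nodeb 0) (g_nodeb 1))))).

Definition g_env : gen :=
  g_choice g_leaf (GSeq (GFor zN xN (GSeq (gc 5) g_node)) (g_assume (g_const0 0))).

Section Sys.
Context (M : tm 0).
Local Notation base := (code_base M).

Definition g_nums (d : nat * nat * nat * nat * nat) : gen :=
  let: (x, s, o, p, s') := d in g_branch (k0 x) (k0 s) (k0 o) (k0 p) (k0 s').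

(* These transitions depend on [M] only, so that their code can be emitted
   verbatim. *)
Definition g_fixed : gen :=
  GEmit (flatten [seq enc_nat 5 ++ den [::] (g_nums d) (fun _ => 0)
    | d <- DeltaM M ++ [:: (0, 0, blank M, lc (inr (start M)), base)]]).

Definition g_input (b : bool) : gen :=
  GSeq (gc 5) (g_branch (k0 0) (base, [:: xi]) (k0 (blank M)) (k0 (lcin M b)) (base.+1, [:: xi])).

Definition g_delta : gen :=
  GSeq g_fixed (GSeq (GInput xi (g_input false) (g_input true))
    (GSeq (GSeq (gc 5) (g_branch (k0 0) (base, [:: cn]) (k0 (blank M)) (k0 (blank M))
                         (k0 (cc (M := M) CJE))))
          (g_assume (g_const0 0)))).

Definition g_body : gen :=
  g_seq (g_assume_eq (k0 0) (k0 0)) (g_seq g_delta (g_seq g_round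
    (g_seq (g_assign (k0 0) (g_const0 1)) (g_seq (g_seqs zm xm (g_inc (6, [:: xm])))
      (g_seq (g_assign (k0 1) (g_reg (k0 0))) g_high))))).

Definition g_dis : gen :=
  g_seq (g_star g_body) (g_seq (g_assume_eq (k0 0) (k0 1))
    (g_seq (g_assume_eq (k0 2) (k0 (cc (M := M) CAcc)))
    (g_seq (g_load (k0 5) (k0 6)) (g_seq (g_assume_eq (k0 5) (k0 0))
      (g_seq (g_load (k0 5) (k0 6)) (g_seq (g_assume_eq (k0 5) (k0 1)) (gc 2))))))).

Definition g_sys : gen :=
  GSeq (gn (6, [:: zN])) (GSeq (gn (times5 7 zN)) (GSeq (gn (base, [:: cn]))
    (GSeq (gc 2) (GSeq g_env g_dis)))).

Context (m : nat) (w : word) (f : nat -> nat).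
Hypothesis m_gt0 : 0 < m.
Hypothesis fN : f zN = nbits m.
Hypothesis fm : f zm = m.
Hypothesis fn : f cn = size w.

Local Notation D := (base + size w).
Local Notation cmd := (cmd (regmax m).+1 (varmax m).+1 D).

Lemma base_ge3 : 3 <= base. Proof. by rewrite /code_base leq_addl. Qed.

Lemma dom_gt1 : 1 < D. Proof. exact: leq_trans (ltnW base_ge3) (leq_addr _ _). Qed.
Lemma dom_gt0 : 0 < D. Proof. exact: ltnW dom_gt1. Qed.

Lemma nbits_gt0 : 0 < nbits m. Proof. by rewrite /nbits; lia. Qed.

Lemma nv0 g a : nv g (k0 a) = a. Proof. by rewrite /nv addn0. Qed.
Lemma nv1 g a x : nv g (a, [:: x]) = a + g x. Proof. by rewrite /nv /= addn0. Qed.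
Lemma nv5 g a x : nv g (times5 a x) = a + 5 * g x.
Proof. by rewrite /nv /=; congr (_ + _); lia. Qed.

Lemma v_small v : v < 7 -> v <= varmax m. Proof. by rewrite /varmax; lia. Qed.

Ltac den_tac := repeat first [apply: den_seq | apply: den_choice | apply: den_star | apply: den_assume_eq
  | apply: den_assume_same | apply: den_assign | apply: den_load | apply: den_store | apply: den_cond
  | apply: den_reg | apply: den_const]; rewrite ?nv0 ?nv1 ?nv5 //; try solve [exact: reg_small | exact: v_small].

Lemma den_inc g x j : nv g x = rbit j -> j < nbits m ->
  den w (g_inc x) g = enc_cmd (inc m D j).
Proof.
move=> E Hj; have Hr : rbit j <= regmax m by rewrite /rbit /regmax; lia.
by have D0 := dom_gt0; den_tac.
Qed.

Lemma den_branch w' g x s o p s' x0 s0 o0 p0 s0' :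
  nv g x = x0 -> nv g s = s0 -> nv g o = o0 -> nv g p = p0 -> nv g s' = s0' ->
  [/\ x0 <= D, s0 <= D, o0 <= D, p0 <= D & s0' <= D] ->
  den w' (g_branch x s o p s') g = enc_cmd (branch m D (x0, s0, o0, p0, s0')).
Proof.
move=> E1 E2 E3 E4 E5 [H1 H2 H3 H4 H5]; have D0 := dom_gt0.
by den_tac.
Qed.

Lemma enc_chs3 d0 d1 d2 :
  enc_cmd (chs [seq branch m D d | d <- d0 ++ d1 ++ [:: d2]]) =
  flatten [seq enc_nat 5 ++ enc_cmd (branch m D d) | d <- d0] ++
  (flatten [seq enc_nat 5 ++ enc_cmd (branch m D d) | d <- d1] ++
  ((enc_nat 5 ++ enc_cmd (branch m D d2)) ++ enc_cmd (assume (econst m D 0) : cmd))).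
Proof.
rewrite enc_chs -map_comp map_cat flatten_cat map_cat flatten_cat -catA -catA; congr (_ ++ (_ ++ _)).
by rewrite [map _ _]/= [flatten _]/= cats0.
Qed.

Lemma den_delta : den w g_delta f = enc_cmd (chs [seq branch m D d | d <- Delta M w]).
Proof.
have HB := @Delta_bound M w; have D0 := dom_gt0.
have HB' x s o p s' : (x, s, o, p, s') \in Delta M w ->
    [/\ x <= D, s <= D, o <= D, p <= D & s' <= D].
  by case/HB => *; split=> //; lia.
set d0 := DeltaM M ++ [:: (0, 0, blank M, lc (inr (start M)), base)].
set d1 := [seq (0, base + i, blank M, lcin M (nth false w i), base + i.+1) | i <- iota 0 (size w)].
set d2 := (0, base + size w, blank M, blank M, cc (M := M) CJE).
have E : Delta M w = d0 ++ d1 ++ [:: d2] by rewrite /d0 -catA.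
rewrite E enc_chs3 /g_delta denS; congr (_ ++ _).
  rewrite /g_fixed (_ : forall u, den w (GEmit u) f = u) //; congr flatten.
  apply/eq_in_map => -[[[[x s] o] p] s'] Hin; congr (_ ++ _); rewrite /g_nums.
  by apply: den_branch; rewrite /nv ?addn0 //; apply: HB'; rewrite E mem_cat Hin.
rewrite denS denInput; congr (_ ++ _).
  rewrite -map_comp; congr flatten; apply/eq_in_map => i; rewrite mem_iota add0n => /andP [_ Hi].
  have Hin := HB' _ _ _ _ _ (Delta_input M Hi).
  have -> : den w (if nth false w i then g_input true else g_input false) (setc f xi i) =
    den w (g_input (nth false w i)) (setc f xi i) by case: (nth false w i).
  rewrite denS den_gc; congr (_ ++ _).
  by apply: den_branch Hin; rewrite /nv /= ?addn0 ?addnS.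
have HL := HB' _ _ _ _ _ (Delta_last M w).
rewrite denS; congr (_ ++ _); last by apply: den_assume; apply: den_const.
rewrite denS den_gc; congr (_ ++ _).
by apply: den_branch HL; rewrite /nv //= ?fn ?addn0.
Qed.

Lemma enc_items_cat (s t : seq cmd) : enc_items (s ++ t) = enc_items s ++ enc_items t.
Proof. by rewrite /enc_items map_cat flatten_cat. Qed.

Lemma enc_items_cons (c : cmd) t : enc_items (c :: t) = (enc_nat 4 ++ enc_cmd c) ++ enc_items t.
Proof. by []. Qed.

Lemma N_pred i : i < nbits m -> (nbits m).-1 - i = nbits m - i.+1.
Proof. by clear; lia. Qed.

Lemma regof_lo i : i < nbits m -> regof m i = rbit (nbits m - i.+1).
Proof. by move=> Hi; rewrite /regof Hi N_pred. Qed.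
Lemma ordv_lo i : i < nbits m -> ordv m i = vB (nbits m - i.+1).
Proof. by move=> Hi; rewrite /ordv Hi N_pred. Qed.

Lemma regof_hi i : regof m (nbits m + 2 + i) = rbit i.
Proof.
rewrite /regof; have [-> -> ->] : [/\ (nbits m + 2 + i < nbits m) = false, (nbits m + 2 + i == nbits m) = false
   & (nbits m + 2 + i == (nbits m).+1) = false] by clear; split; lia.
by congr rbit; clear; lia.
Qed.
Lemma ordv_hi i : ordv m (nbits m + 2 + i) = vA i.
Proof.
rewrite /ordv; have [-> -> ->] : [/\ (nbits m + 2 + i < nbits m) = false, (nbits m + 2 + i == nbits m) = false
   & (nbits m + 2 + i == (nbits m).+1) = false] by clear; split; lia.
by congr vA; clear; lia.
Qed.

Lemma den_round : den w g_round f = enc_cmd (round m D).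
Proof.
rewrite enc_seqs.
have -> : iota 0 (rlen m) = iota 0 (nbits m) ++ [:: nbits m; (nbits m).+1] ++ [seq nbits m + 2 + i | i <- iota 0 (nbits m)].
  by rewrite /rlen; move: (nbits m) => n0; rewrite !iotaD !add0n -catA -[X in _ ++ _ ++ iota X _]addn0 iotaDl.
rewrite map_cat map_cat -map_comp enc_items_cat [map _ [:: _; _]]/= enc_items_cons enc_items_cons.
rewrite -(catA (enc_items _)) /g_round denS; congr (_ ++ _).
  apply: den_items => // i Hi; rewrite ordv_lo // regof_lo //; apply: den_store.
  - by rewrite nv1 /setc.
  - by rewrite /rbit /regmax; clear -Hi; lia.
  - by rewrite nv5.
  - by rewrite /vB /varmax; clear -Hi; lia.
rewrite -(catA (_ ++ _)) denS; congr (_ ++ _).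
  rewrite denS den_gc !ordvN !regofN; congr (_ ++ _).
  by den_tac.
rewrite -(catA (_ ++ _)) denS; congr (_ ++ _).
  rewrite denS den_gc !ordvN !regofN; congr (_ ++ _).
  by den_tac.
rewrite denS den_gc; congr (_ ++ _).
apply: den_items => // i Hi; rewrite ordv_hi regof_hi; apply: den_store.
- by rewrite nv1 /setc.
- by rewrite /rbit /regmax; clear -Hi; lia.
- by rewrite nv5.
- by rewrite /vA /varmax; clear -Hi; lia.
Qed.

Lemma den_check g x r i : i < rlen m -> nv g x = ordv m i -> nv g r = regof m i ->
  den w (g_check x r) g = enc_cmd (check m D i).
Proof. by move=> Hi Ex Er; have D0 := dom_gt0; den_tac; rewrite ?ordv_le ?regof_le. Qed.

Lemma den_exact x r : r < 6 -> x < 7 -> den w (g_exact x r) f = enc_cmd (exact m D x r).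
Proof.
move=> Hr Hx; apply: den_seq.
  apply: den_seqs => // i Hi.
  have E : (rlen m).-1 - i = nbits m + 2 + (nbits m - i.+1) by rewrite /rlen; clear -Hi; lia.
  apply: den_check; first by rewrite /rlen; clear -Hi; lia.
    by rewrite nv5 E ordv_hi.
  by rewrite nv1 E regof_hi.
apply: den_seq; first by den_tac.
apply: den_seqs => // i Hi.
have Hi' : (nbits m).-1 - i < nbits m by clear -Hi; lia.
have E : nbits m - ((nbits m).-1 - i).+1 = i by clear -Hi; lia.
apply: den_check; first by rewrite /rlen; clear -Hi; lia.
  by rewrite nv5 ordv_lo // E.
by rewrite nv1 regof_lo // E.
Qed.

Lemma den_guess g i : i < nbits m -> g xN = i -> den w g_guess g = enc_cmd (guess m D i).
Proof.
move=> Hi Ei; have D1 := dom_gt1; have D0 := dom_gt0.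
by den_tac; rewrite ?Ei // /rbit /vrail /regmax /varmax; clear -Hi; lia.
Qed.

Lemma den_low : den w (g_seqs zm xm (g_inc (6, [:: xm]))) f =
  enc_cmd (seqs [seq inc m D j | j <- iota 0 m]).
Proof.
apply: den_seqs => // i Hi; apply: den_inc; first by rewrite nv1.
by rewrite /nbits; clear -Hi; lia.
Qed.

Lemma den_high : den w g_high f = enc_cmd (seqs [seq inc m D j | j <- iota m m]).
Proof.
rewrite -[X in iota X]addn0 iotaDl -map_comp; apply: den_seqs => // i Hi; apply: den_inc.
  by rewrite /nv /setc /= /rbit; clear -Hi; lia.
by rewrite /nbits; clear -Hi; lia.
Qed.

Lemma den_leaf : den w g_leaf f = enc_cmd (leaf m D).
Proof.
have D0 := dom_gt0; have D1 := dom_gt1; have N0 := nbits_gt0.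
apply: den_seq; first by apply: den_seqs => // i Hi; apply: den_guess.
apply: den_seq; first by den_tac; rewrite ?fN /rbit /regmax; clear -N0; lia.
apply: den_seq; first exact: den_exact.
apply: den_seq; first by den_tac.
apply: den_seq; first exact: den_high.
apply: den_seq; last by den_tac; rewrite ?fN /vF /varmax; clear -N0; lia.
apply: den_choice; first by den_tac.
apply: den_seq; first by den_tac.
by apply: den_seq; [exact: den_exact|den_tac].
Qed.

Lemma den_nodeb g i b : i < nbits m -> b < 2 -> g xN = i ->
  den w (g_nodeb b) g = enc_cmd (nodeb m D i b).
Proof.
move=> Hi Hb Ei; have D1 := dom_gt1; have D0 := dom_gt0.
by den_tac; rewrite ?Ei // /vrail /vF /varmax; clear -Hi Hb D1; lia.
Qed.

Lemma den_node g i : i < nbits m -> g xN = i -> den w g_node g = enc_cmd (node m D i).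
Proof.
move=> Hi Ei; have D1 := dom_gt1; have D0 := dom_gt0.
have Hl : den w (g_load (k0 5) (times5 11 xN)) g = enc_cmd (load m D rt (vF i.+1)).
  by den_tac; rewrite ?Ei // /vF /varmax; clear -Hi; lia.
apply: (den_seq Hl); apply: den_seq; first by den_tac.
apply: (den_seq Hl); apply: den_seq; first by den_tac.
by apply: den_choice; apply: den_nodeb.
Qed.

Lemma den_env : den w g_env f = enc_cmd (cenv_sys m D).
Proof.
apply: den_choice; first exact: den_leaf.
rewrite enc_chs denS; congr (_ ++ _); last by apply: den_assume; apply: den_const; rewrite ?nv0.
rewrite denFor fN -map_comp; congr flatten; apply/eq_in_map => i; rewrite mem_iota add0n => /andP [_ Hi].
by rewrite denS den_gc; congr (_ ++ _); apply: den_node.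
Qed.

Lemma den_body : den w g_body f = enc_cmd (body m D (Delta M w)).
Proof.
have D1 := dom_gt1; have D0 := dom_gt0.
apply: den_seq; first by den_tac.
apply: den_seq; first exact: den_delta.
apply: den_seq; first exact: den_round.
apply: den_seq; first by den_tac.
apply: den_seq; first exact: den_low.
by apply: den_seq; [den_tac|exact: den_high].
Qed.

Lemma cc_le c : cc (M := M) c <= D.
Proof. by apply: ltnW; apply: leq_trans (cc_lt c) (leq_addr _ _). Qed.

Lemma den_dis : den w g_dis f = enc_cmd (cdis_sys m D (cc (M := M) CAcc) (Delta M w)).
Proof.
have D1 := dom_gt1; have D0 := dom_gt0; have Dacc := cc_le CAcc.
apply: den_seq; first by apply: den_star; exact: den_body.
do 6!(apply: den_seq; first by den_tac).
by rewrite den_gc.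
Qed.

Lemma den_sys : den w g_sys f = enc_system (sys m D (cc (M := M) CAcc) (Delta M w)).
Proof.
rewrite /enc_system denS den_gn nv1 fN; congr (enc_nat _ ++ _); first by rewrite /= /regmax; clear; lia.
rewrite denS den_gn nv5 fN; congr (enc_nat _ ++ _); first by rewrite /= /varmax; clear; lia.
rewrite denS den_gn nv1 fn; congr (_ ++ _).
rewrite denS den_gc; congr (_ ++ _).
  by rewrite enc_inord //; exact: dom_gt1.
by rewrite denS den_env den_dis.
Qed.

End Sys.

Lemma okg_sys (M : tm 0) e w : okg w [::] w (g_sys M) (params e (size w)).
Proof.
repeat match goal with
| |- okg _ _ _ (gn _) _ => exact: okg_gn
| |- okg _ _ _ (gc _) _ => exact: okg_gn
| |- okg _ _ _ (GEmit _) _ => exact: I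
| |- okg _ _ _ (if ?b then _ else _) _ => case: b
| |- forall i, is_true (i < _) -> _ => let i := fresh in let H := fresh in move=> i H; clear H
| |- is_true _ => done
| |- _ = _ => done
| |- _ => split
end.
Qed.

(** * The length of a row and the reduction *)

Lemma poly_bound_room c n : poly_bound c n + n + 4 <= (n + 2) ^ (c + 3).
Proof.
rewrite /poly_bound expnD; set x := (n + 2) ^ c.
have x1 : n ^ c <= x.
  rewrite /x; case: c {x} => [|c]; first by rewrite !expn0.
  by rewrite leq_exp2r // leq_addr.
have x2 : c < x.
  apply: (leq_trans (ltn_expl c (ltnSn 1))); rewrite /x; case: c {x x1} => [|c]; first by rewrite !expn0.
  by rewrite leq_exp2r // leq_addl.
(* Three more factors give [4 * (n + 2)] times [x], which leaves room for [n ^ c], [c] and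
   [n + 4]. *)
have x3 : 4 * (n + 2) <= (n + 2) ^ 3 by rewrite !expnS expn0 muln1; nia.
apply: leq_trans (leq_mul (leqnn x) x3).
clear -x1 x2; nia.
Qed.

(** With [x = 2 ^ poly_bound c n] and [y = 2 ^ n] the 4 in the exponent provides [16 * x * y], which
    exceeds [2 * x + y + 5]. *)
Lemma run_room k c n : k <= 2 ^ poly_bound c n -> 2 * k + n + 5 <= 2 ^ ((n + 2) ^ (c + 3)).
Proof.
move=> Hk; apply: (@leq_trans (2 ^ (poly_bound c n + n + 4))); last first.
  by rewrite leq_exp2l // poly_bound_room.
have Hn : n < 2 ^ n by apply: ltn_expl.
have : 0 < 2 ^ poly_bound c n by rewrite expn_gt0.
rewrite (expnD _ (_ + n)) (expnD _ (poly_bound c n)); move: (2 ^ poly_bound c n) (2 ^ n) Hk Hn => x y Hk Hn x0.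
have y0 : 0 < y := leq_trans (ltn0Sn n) Hn.
have := leq_pmulr x y0; have := leq_pmull y x0; move: (x * y) => z; rewrite -[2 ^ 4]/16; lia.
Qed.

Theorem mainTheorem6 :
  NEXPTIME_hard (safety_verification env_nocas_acyc_dis_nocas).
Proof.
move=> Lg [M [c [Hrun HL]]].
exists (fun w => den w (g_sys M) (params (c + 3) (size w))).
split=> [|w]; first by apply: gen_polytime => w; exact: okg_sys.
set m := (size w + 2) ^ (c + 3).
have m0 : 0 < m by rewrite expn_gt0 addn2.
pose S := sys m (code_base M + size w) (cc (M := M) CAcc) (Delta M w).
have -> : den w (g_sys M) (params (c + 3) (size w)) = enc_system S.
  by apply: den_sys => //; rewrite /params /setc /= -/m /nbits; lia.
have D2 : 1 < code_base M + size w by exact: dom_gt1.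
have HD x s o p s' : (x, s, o, p, s') \in Delta M w -> [/\ x <= 1, s <= code_base M + size w,
    o <= code_base M + size w, p <= code_base M + size w & s' <= code_base M + size w] by exact: Delta_bound.
(* The time bound concerns all computations, so one row length fits every accepting one. *)
have Hacc : accepts M w <-> queue_run m (cc (M := M) CAcc) (Delta M w).
  by split=> /(queueP m0 _) H; apply: H => n cf /Hrun; exact: run_room.
(* As the encoding is injective, [S] is the only system with this code. *)
have -> : safety_verification env_nocas_acyc_dis_nocas (enc_system S) <-> unsafe S.
  split=> [[S' [_ /enc_system_inj -> //]]|H]; exists S; split=> //; exact: sys_class.
rewrite HL -/(accepts M w) Hacc; split=> [[sg [o [p [H1 H2 H3 H4]]]]|].
  exact: (sys_complete_run m0 D2 HD (cc_le _ _) H1 H2 H3 H4).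
exact: sys_sound m0 D2 HD (cc_le _ _).
Qed.
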